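(* Let $(N,g,\xi,\eta,\varphi)$ be an ST manifold. Then the associated cone $(\mathcal C(N),g_{\mathcal C},J_{\mathcal C})$ is a KT manifold. Moreover, the cone is SKT if and only if the ST manifold $N$ is Sasaki.
   Context: Convention: $d\eta(X,Y)=X\eta(Y)-Y\eta(X)-\eta([X,Y])$. An almost contact metric manifold $(N,g,\xi,\eta,\varphi)$ is an odd-dimensional Riemannian manifold $(N,g)$ with a unit-norm vector field $\xi$, its dual $1$-form $\eta=g(\xi,\cdot)$, and a bundle endomorphism $\varphi\colon TN\to TN$ such that $\varphi(\xi)=0$, $\varphi^2=-1+\eta\otimes\xi$, and $g(\varphi(X),\varphi(Y))=g(X,Y)-\eta(X)\eta(Y)$. It is normal if, for all vector fields $X,Y$, $$S(X,Y)=[\varphi(X),\varphi(Y)]+\varphi^2[X,Y]-\varphi[\varphi(X),Y]-\varphi[X,\varphi(Y)]+d\eta(X,Y)\xi=0.$$ The fundamental $2$-form is $F=g(\varphi\cdot,\cdot)$. An ST (Sasaki with torsion) manifold is a normal almost contact metric manifold such that $\xi$ is a Killing vector field. It is Sasaki if $d\eta=2F$. A KT manifold is a Hermitian manifold $(M,g,J)$ (with $J$ integrable) together with its unique Hermitian connection with skew-symmetric torsion; with $\omega=g(J\cdot,\cdot)$ its torsion $3$-form is $c(X,Y,Z)=d\omega(JX,JY,JZ)$. It is SKT if $dc=0$. The cone associated with $(N,g,\xi,\eta,\varphi)$ is $\mathcal C(N)=\mathbb R_+\times N$ with metric $g_{\mathcal C}=dr^2+r^2g$ and almost complex structure $J_{\mathcal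 C}$ defined by $g_{\mathcal C}(J_{\mathcal C}\cdot,\cdot)=\omega_{\mathcal C}:=r\,dr\wedge\eta+r^2F$. *)

(* Defs.v *)
From HB Require Import structures.
From mathcomp Require Import all_boot all_order all_algebra.
From mathcomp Require Import all_classical all_reals all_analysis.

Set Implicit Arguments.
Unset Strict Implicit.
Unset Printing Implicit Defensive.

Import Order.TTheory GRing.Theory Num.Theory.
Import numFieldNormedType.Exports.

Local Open Scope classical_set_scope.
Local Open Scope ring_scope.

(* f is C^oo on U (meant for open U): each iterated directional derivative
   'D_v1 ('D_v2 (... f)), including f itself, is Frechet differentiable at
   each point of U. *)
Definition smooth_on (R : realType) (n : nat) (V : normedModType R)
    (U : set 'rV[R]_n) (f : 'rV[R]_n -> V) : Prop :=
  forall (vs : seq 'rV[R]_n) (x : 'rV[R]_n), U x ->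
    differentiable (foldr (fun v h => 'D_v h) f vs) x.

(* The data of an atlas on a topological space, indexed so that [chart p] is a
   chart around p.  Every atlas of a manifold contains (by choosing one chart
   around each point) such a subatlas, and it determines the same smooth
   structure.  [chart p] and [chart_inv p] are total; only their values on
   [chart_dom p], resp. on its image, are meaningful. *)
Record charted_space (R : realType) (n : nat) := ChartedSpace {
  carrier :> topologicalType;
  chart_dom : carrier -> set carrier;
  chart : carrier -> carrier -> 'rV[R]_n;
  chart_inv : carrier -> 'rV[R]_n -> carrier
}.

Definition chart_img (R : realType) (n : nat) (M : charted_space R n) (p : M) :
  set 'rV[R]_n := chart p @` chart_dom p.

Definition smooth_manifold (R : realType) (n : nat) (M : charted_space R n) :
    Prop :=
  [/\ hausdorff_space M, @second_countable M,
      forall p : M,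
        [/\ chart_dom p p, open (chart_dom p) & open (chart_img p)],
      forall p : M,
        [/\ {in chart_dom p, cancel (chart p) (chart_inv p)},
            {within chart_dom p, continuous (chart p)} &
            {within chart_img p, continuous (chart_inv p)}] &
      forall p q : M,
        smooth_on (chart p @` (chart_dom p `&` chart_dom q))
                  (chart q \o chart_inv p)].

Section Calculus.
Context (R : realType) (n : nat) (M : charted_space R n).

(* The tangent space at x is represented by 'rV[R]_n: a tangent vector at x is
   given by its components in the preferred chart [chart x]. *)
Definition vector_field : Type := M -> 'rV[R]_n.
Definition endo_field : Type := M -> 'rV[R]_n -> 'rV[R]_n.
Definition bilin_field : Type := M -> 'rV[R]_n -> 'rV[R]_n -> R.

(* If v lists the components in chart p of a tangent vector at x, then
   [transfer p q x v] lists its components in chart q. *)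
Definition transfer (p q x : M) (v : 'rV[R]_n) : 'rV[R]_n :=
  'D_v (chart q \o chart_inv p) (chart p x).

Definition smooth_function (f : M -> R) : Prop :=
  forall p : M, smooth_on (chart_img p) (f \o chart_inv p : 'rV[R]_n -> R^o).

(* The vector field X, read in chart p. *)
Definition field_in (p : M) (X : vector_field) (y : 'rV[R]_n) : 'rV[R]_n :=
  let x := chart_inv p y in transfer x p x (X x).

Definition smooth_field (X : vector_field) : Prop :=
  forall p : M, smooth_on (chart_img p) (field_in p X).

(* The value at x of the p-coordinate field with constant components u. *)
Definition coord_field (p : M) (u : 'rV[R]_n) : vector_field :=
  fun x => transfer p x x u.

Definition smooth_endo (A : endo_field) : Prop :=
  (forall x : M, linear (A x)) /\
  forall (p : M) (u : 'rV[R]_n), smooth_on (chart_img p)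
    (field_in p (fun x => A x (coord_field p u x))).

Definition smooth_bilin (b : bilin_field) : Prop :=
  (forall (x : M) (u : 'rV[R]_n), scalar (b x u) /\ scalar (b x ^~ u)) /\
  forall (p : M) (u v : 'rV[R]_n), smooth_on (chart_img p)
    ((fun x => b x (coord_field p u x) (coord_field p v x)) \o chart_inv p
      : 'rV[R]_n -> R^o).

Definition riemannian_metric (g : bilin_field) : Prop :=
  [/\ smooth_bilin g,
      forall (x : M) (u v : 'rV[R]_n), g x u v = g x v u &
      forall (x : M) (v : 'rV[R]_n), v != 0 -> 0 < g x v v].

(* The function X f. *)
Definition lie_deriv (X : vector_field) (f : M -> R) : M -> R :=
  fun x => 'D_(X x) (f \o chart_inv x : 'rV[R]_n -> R^o) (chart x x).

(* In coordinates [X, Y]^k = X^i d_i Y^k - Y^i d_i X^k; at x the coordinates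
   are those of the preferred chart. *)
Definition lie_bracket (X Y : vector_field) : vector_field := fun x =>
  'D_(X x) (field_in x Y) (chart x x) - 'D_(Y x) (field_in x X) (chart x x).

Definition app_endo (A : endo_field) (X : vector_field) : vector_field :=
  fun x => A x (X x).

Definition app_bilin (b : bilin_field) (X Y : vector_field) : M -> R :=
  fun x => b x (X x) (Y x).

Definition scale_field (f : M -> R) (X : vector_field) : vector_field :=
  fun x => f x *: X x.

(* Exterior derivative of 1-, 2- and 3-forms, as functions of vector fields,
   with the normalization d a(X,Y) = X a(Y) - Y a(X) - a([X,Y]). *)
Definition d1 (a : vector_field -> M -> R) (X Y : vector_field) (x : M) : R :=
  lie_deriv X (a Y) x - lie_deriv Y (a X) x - a (lie_bracket X Y) x.

Definition d2 (b : vector_field -> vector_field -> M -> R)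
    (X Y Z : vector_field) (x : M) : R :=
  lie_deriv X (b Y Z) x - lie_deriv Y (b X Z) x + lie_deriv Z (b X Y) x
  - b (lie_bracket X Y) Z x + b (lie_bracket X Z) Y x
  - b (lie_bracket Y Z) X x.

Definition d3 (c : vector_field -> vector_field -> vector_field -> M -> R)
    (X Y Z W : vector_field) (x : M) : R :=
  lie_deriv X (c Y Z W) x - lie_deriv Y (c X Z W) x
  + lie_deriv Z (c X Y W) x - lie_deriv W (c X Y Z) x
  - c (lie_bracket X Y) Z W x + c (lie_bracket X Z) Y W x
  - c (lie_bracket X W) Y Z x - c (lie_bracket Y Z) X W x
  + c (lie_bracket Y W) X Z x - c (lie_bracket Z W) X Y x.

End Calculus.

Section AlmostContact.
Context (R : realType) (n : nat) (N : charted_space R n).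
Context (g : bilin_field N) (xi : vector_field N) (phi : endo_field N).

Definition eta (x : N) (v : 'rV[R]_n) : R := g x (xi x) v.

Definition fund_form (x : N) (v w : 'rV[R]_n) : R := g x (phi x v) w.

Definition d_eta : vector_field N -> vector_field N -> N -> R :=
  d1 (fun X x => eta x (X x)).

Definition almost_contact_metric : Prop :=
  [/\ odd n, smooth_manifold N,
      [/\ riemannian_metric g, smooth_field xi & smooth_endo phi],
      (forall x : N, g x (xi x) (xi x) = 1) /\
      (forall x : N, phi x (xi x) = 0) &
      forall (x : N) (v w : 'rV[R]_n),
        phi x (phi x v) = - v + eta x v *: xi x /\
        g x (phi x v) (phi x w) = g x v w - eta x v * eta x w].

Definition normality_tensor (X Y : vector_field N) (x : N) : 'rV[R]_n :=
  lie_bracket (app_endo phi X) (app_endo phi Y) x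
  + phi x (phi x (lie_bracket X Y x))
  - phi x (lie_bracket (app_endo phi X) Y x)
  - phi x (lie_bracket X (app_endo phi Y) x)
  + d_eta X Y x *: xi x.

Definition normal_acm : Prop :=
  forall X Y : vector_field N, smooth_field X -> smooth_field Y ->
    forall x : N, normality_tensor X Y x = 0.

(* The Lie derivative of g along xi vanishes. *)
Definition killing : Prop :=
  forall X Y : vector_field N, smooth_field X -> smooth_field Y ->
    forall x : N, lie_deriv xi (app_bilin g X Y) x =
      app_bilin g (lie_bracket xi X) Y x + app_bilin g X (lie_bracket xi Y) x.

Definition is_ST : Prop := [/\ almost_contact_metric, normal_acm & killing].

Definition is_Sasaki : Prop :=
  is_ST /\
  forall X Y : vector_field N, smooth_field X -> smooth_field Y ->
    forall x : N, d_eta X Y x = 2 * fund_form x (X x) (Y x).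

End AlmostContact.

Section KT.
Context (R : realType) (n : nat) (M : charted_space R n).
Context (g : bilin_field M) (J : endo_field M).

Definition nijenhuis (X Y : vector_field M) (x : M) : 'rV[R]_n :=
  lie_bracket (app_endo J X) (app_endo J Y) x
  - J x (lie_bracket (app_endo J X) Y x)
  - J x (lie_bracket X (app_endo J Y) x)
  - lie_bracket X Y x.

(* Integrability of J is expressed by its Nijenhuis tensor. *)
Definition hermitian : Prop :=
  [/\ smooth_manifold M, riemannian_metric g, smooth_endo J,
      forall (x : M) (v w : 'rV[R]_n),
        J x (J x v) = - v /\ g x (J x v) (J x w) = g x v w &
      forall X Y : vector_field M, smooth_field X -> smooth_field Y ->
        forall x : M, nijenhuis X Y x = 0].

(* omega = g(J., .) and c(X,Y,Z) = d omega (JX, JY, JZ). *)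
Definition omega (X Y : vector_field M) : M -> R := app_bilin g (app_endo J X) Y.

Definition kt_form (X Y Z : vector_field M) : M -> R :=
  d2 omega (app_endo J X) (app_endo J Y) (app_endo J Z).

(* An affine connection, given by the covariant derivative (X, Y) |-> D X Y;
   only its values on smooth vector fields are meaningful. *)
Definition connection
    (D : vector_field M -> vector_field M -> vector_field M) : Prop :=
  [/\ forall X Y : vector_field M, smooth_field X -> smooth_field Y ->
        smooth_field (D X Y),
      forall X X' Y : vector_field M,
        smooth_field X -> smooth_field X' -> smooth_field Y ->
        forall x : M, D (X \+ X') Y x = D X Y x + D X' Y x,
      forall X Y Y' : vector_field M,
        smooth_field X -> smooth_field Y -> smooth_field Y' ->
        forall x : M, D X (Y \+ Y') x = D X Y x + D X Y' x,
      forall (f : M -> R) (X Y : vector_field M),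
        smooth_function f -> smooth_field X -> smooth_field Y ->
        forall x : M, D (scale_field f X) Y x = f x *: D X Y x &
      forall (f : M -> R) (X Y : vector_field M),
        smooth_function f -> smooth_field X -> smooth_field Y ->
        forall x : M, D X (scale_field f Y) x =
          f x *: D X Y x + lie_deriv X f x *: Y x].

Definition hermitian_connection
    (D : vector_field M -> vector_field M -> vector_field M) : Prop :=
  [/\ connection D,
      forall X Y Z : vector_field M,
        smooth_field X -> smooth_field Y -> smooth_field Z ->
        forall x : M, lie_deriv X (app_bilin g Y Z) x =
          app_bilin g (D X Y) Z x + app_bilin g Y (D X Z) x &
      forall X Y : vector_field M, smooth_field X -> smooth_field Y ->
        forall x : M, D X (app_endo J Y) x = J x (D X Y x)].

Definition torsion_form
    (D : vector_field M -> vector_field M -> vector_field M)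
    (X Y Z : vector_field M) (x : M) : R :=
  g x (D X Y x - D Y X x - lie_bracket X Y x) (Z x).

Definition skew_torsion
    (D : vector_field M -> vector_field M -> vector_field M) : Prop :=
  forall X Y Z : vector_field M,
    smooth_field X -> smooth_field Y -> smooth_field Z ->
    forall x : M, torsion_form D X Y Z x = - torsion_form D Y X Z x /\
                  torsion_form D X Y Z x = - torsion_form D X Z Y x.

(* Hermitian, together with the unique Hermitian connection with
   skew-symmetric torsion, whose torsion 3-form is [kt_form]. *)
Definition is_KT : Prop :=
  hermitian /\
  exists D : vector_field M -> vector_field M -> vector_field M,
    [/\ hermitian_connection D, skew_torsion D,
        forall D' : vector_field M -> vector_field M -> vector_field M,
          hermitian_connection D' -> skew_torsion D' ->
          forall X Y : vector_field M, smooth_field X -> smooth_field Y ->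
            D' X Y = D X Y &
        forall X Y Z : vector_field M,
          smooth_field X -> smooth_field Y -> smooth_field Z ->
          forall x : M, torsion_form D X Y Z x = kt_form X Y Z x].

Definition is_SKT : Prop :=
  is_KT /\
  forall X Y Z W : vector_field M, smooth_field X -> smooth_field Y ->
    smooth_field Z -> smooth_field W -> forall x : M, d3 kt_form X Y Z W x = 0.

End KT.

Section Cone.
Context (R : realType) (n : nat) (N : charted_space R n).

Definition pos_reals : set R := [set r | 0 < r].

(* R_+ x N with the product topology and the charts (s, q) |-> (s, chart p q).
   Accordingly a tangent vector at (r, p) has components (a, v), where a is its
   dr-component and v its projection to the tangent space of N at p. *)
Definition cone : charted_space R (1 + n) :=
  @ChartedSpace R (1 + n) (pos_reals * N)%type
    (fun p => [set q | chart_dom p.2 q.2])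
    (fun p q => row_mx (\val q.1)%:M (chart p.2 q.2))
    (fun p y => (insubd p.1 (lsubmx y 0 0), chart_inv p.2 (rsubmx y))).

Definition radius (x : cone) : R := \val x.1.

Definition base (x : cone) : N := x.2.

Definition dr (v : 'rV[R]_(1 + n)) : R := lsubmx v 0 0.

Definition dpr (v : 'rV[R]_(1 + n)) : 'rV[R]_n := rsubmx v.

Context (g : bilin_field N) (xi : vector_field N) (phi : endo_field N).

Definition cone_metric : bilin_field cone := fun x v w =>
  dr v * dr w + radius x ^+ 2 * g (base x) (dpr v) (dpr w).

Definition cone_form : bilin_field cone := fun x v w =>
  radius x * (dr v * eta g xi (base x) (dpr w)
              - dr w * eta g xi (base x) (dpr v))
  + radius x ^+ 2 * fund_form g phi (base x) (dpr v) (dpr w).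

(* J v is the vector determined by g_C (J v, w) = omega_C (v, w) for all w. *)
Definition cone_J : endo_field cone := fun x v =>
  xget 0 [set u | forall w, cone_metric x u w = cone_form x v w].

End Cone.

(* Main.v *)
(* At a point, in the preferred chart, brackets and Lie derivatives split into
   derivatives of the structure tensors and derivatives of the fields, and the
   latter cancel in every tensorial expression.  A Hermitian structure is KT: the
   Koszul formula with the torsion form added defines the connection, and the
   difference of two such connections is totally skew and commutes with J, hence
   vanishes.  On the cone, J (a, v) = (- r eta v, (a / r) xi + phi v), and its
   Nijenhuis tensor is made of the normality tensor, L_xi phi, i_xi d eta and
   d eta (phi -, -) + d eta (-, phi -), all zero on a normal manifold.  Finally
   d omega = r dr /\ (2 F - d eta) + r^2 dF, where i_xi dF = 0 because xi is
   Killing.  So c = 0 if N is Sasaki; conversely c (xi, V, W) is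
   - r^2 (2 F - d eta) (phi V, phi W), and dc on the Euler field, xi, V and W
   is 2 c (xi, V, W). *)
Require Import Defs.
From HB Require Import structures.
From mathcomp Require Import all_boot all_order all_algebra.
From mathcomp Require Import all_classical all_reals all_analysis.
From mathcomp Require Import ring lra.

Set Implicit Arguments.
Unset Strict Implicit.
Unset Printing Implicit Defensive.

Import Order.TTheory GRing.Theory Num.Theory.
Import numFieldNormedType.Exports.

Local Open Scope classical_set_scope.
Local Open Scope ring_scope.

Opaque derive diff.
Arguments derive : simpl never.

(** Two features of the definitions shape the proof. Tangent vectors at a point are written in the
    preferred chart of that point, and this chart may jump from one point to the next. So a
    derivative at [x] is taken with the chart of [x] held fixed, and smoothness of an object defined
    point by point, such as the connection or [J] on the cone, has to be recovered from a chart-free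
    formula or from fields of known shape. Moreover normality, the Killing equation and
    integrability speak of globally smooth fields only, so identities are proved at vectors that are
    values of such fields. This suffices because a field on the cone restricts to global fields on
    the slices [r = const], and because a field is shown to vanish by pairing it with itself. Read
    at a point, most claims become algebraic identities between the structure tensors and their
    first derivatives. Second derivatives enter through the chart independence of the bracket and
    through [d d eta = 0], which is why Schwarz's theorem is proved. *)

(** * First-order calculus: congruence, linear maps, products and inverses *)

Section FirstOrderCalculus.
Context {R : realType}.

(** The difference [h - f] vanishes near [a], so it has an expansion with zero linear part and zero
    remainder; adding it to [f] gives [h]. *)
Lemma near_eq_differentiable (U V : normedModType R) (f h : U -> V) (a : U) :
  (\near a, f a = h a) -> differentiable f a -> differentiable h a.
Proof.
move=> fh df.
suff dk : differentiable (h - f) a.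
  by have := differentiableD df dk; rewrite addrC subrK.
have k0 : (h - f) a = 0.
  by apply/eqP; rewrite subr_eq0; apply/eqP/esym/(nbhs_singleton fh).
have E : (h - f) \o shift a = cst ((h - f) a) + (\0 : {linear U -> V}) +o_ 0 id.
  apply/eqaddoP => _/posnumP[e]; rewrite k0.
  have : \forall x \near 0, f (x + a) = h (x + a).
    by move: fh; rewrite (near_shift 0 a) /=; apply: filterS => x; rewrite /= subr0.
  apply: filterS => x E.
  rewrite -[X in `|X|]/((h (x + a) - f (x + a)) - (0 + 0)).
  by rewrite E subrr addr0 subrr normr0 mulr_ge0.
apply/diff_locallyP; rewrite (diff_unique _ E) => //.
  by split => //; apply: cst_continuous.
exact: cst_continuous.
Qed.

(** Scalar multiplication under a head symbol of its own, which can carry the bilinear structure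
    that [diff_bilin] expects; this yields the product rule. *)
Definition scale_op (V : normedModType R) (a : R^o) (v : V) : V := a *: v.

Lemma scale_is_bilinear (V : normedModType R) :
  bilinear_for
    (GRing.Scale.Law.clone _ _ *:%R _) (GRing.Scale.Law.clone _ _ *:%R _)
    (@scale_op V).
Proof.
rewrite /scale_op; split=> [v a x y|u a x y] /=; first by rewrite scalerDl scalerA.
by rewrite scalerDr !scalerA mulrC.
Qed.
HB.instance Definition _ (V : normedModType R) :=
  bilinear_isBilinear.Build R R^o V V _ _ (@scale_op V)
  (scale_is_bilinear V).

Section Rules.
Context {U V : normedModType R}.
Implicit Types (f h : U -> V) (y v : U).

Lemma derive_add f h y v : differentiable f y -> differentiable h y ->
  'D_v (fun z => f z + h z) y = 'D_v f y + 'D_v h y.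
Proof. by move=> df dh; rewrite -deriveD //; apply: diff_derivable. Qed.

Lemma derive_linr f y a u v : differentiable f y ->
  'D_(a *: u + v) f y = a *: 'D_u f y + 'D_v f y.
Proof. by move=> df; rewrite !deriveE // linearP. Qed.

Lemma differentiable_scale (f : U -> R^o) h y :
  differentiable f y -> differentiable h y ->
  differentiable (fun z => f z *: h z) y.
Proof.
move=> df dh.
apply: (@differentiable_comp _ U (R^o * V)%type V (fun z => (f z, h z))
  (fun p => p.1 *: p.2)); first exact: differentiable_pair.
apply: (@differentiable_bilin _ R^o V V (@scale_op V)).
exact: scale_continuous.
Qed.

Lemma derive_scale (f : U -> R^o) h y v :
  differentiable f y -> differentiable h y ->
  'D_v (fun z => f z *: h z) y = 'D_v f y *: h y + f y *: 'D_v h y.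
Proof.
move=> df dh.
rewrite !deriveE //; last exact: differentiable_scale.
have bc : continuous (fun p : R^o * V => p.1 *: p.2) by exact: scale_continuous.
have -> : (fun z => f z *: h z) =
  (fun p : R^o * V => p.1 *: p.2) \o (fun z => (f z, h z)) by [].
rewrite diff_comp; [|exact: differentiable_pair|].
  rewrite /= diff_pair //.
  rewrite (@diff_bilin _ R^o V V (@scale_op V)) //=.
  by rewrite addrC.
by apply: (@differentiable_bilin _ R^o V V (@scale_op V)).
Qed.

Lemma derive_comp (W : normedModType R) f (k : V -> W) y v :
  differentiable f y -> differentiable k (f y) ->
  'D_v (k \o f) y = 'D_('D_v f y) k (f y).
Proof.
move=> df dk; rewrite !deriveE //; last exact: differentiable_comp.
by rewrite diff_comp.
Qed.

Lemma derive_linear (W : normedModType R) (L : V -> W) (y v : V) :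
  linear L -> continuous L -> 'D_v L y = L v.
Proof.
move=> Ll Lc.
pose LL : {linear V -> W} := HB.pack L (GRing.isLinear.Build _ _ _ _ L Ll).
rewrite deriveE; last exact: (@linear_differentiable _ _ _ LL).
by rewrite (@diff_lin _ _ _ LL).
Qed.

End Rules.

Lemma linear_differentiable_at (U V : normedModType R) (L : U -> V) y :
  linear L -> continuous L -> differentiable L y.
Proof.
move=> Ll Lc.
pose LL : {linear U -> V} := HB.pack L (GRing.isLinear.Build _ _ _ _ L Ll).
exact: (@linear_differentiable _ _ _ LL).
Qed.

Lemma derive_linear_comp (U V W : normedModType R) (f : U -> V) (L : V -> W)
  y v : linear L -> continuous L -> differentiable f y ->
  'D_v (L \o f) y = L ('D_v f y).
Proof.
move=> Ll Lc df; have dL : differentiable L (f y) by exact: linear_differentiable_at.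
by rewrite (derive_comp v df dL) derive_linear.
Qed.

Lemma linear_row_sum n (V : lmodType R) (L : 'rV[R]_n -> V) (u : 'rV[R]_n) :
  linear L -> L u = \sum_i u 0 i *: L (delta_mx 0 i).
Proof.
move=> Ll.
pose LL : {linear 'rV[R]_n -> V} :=
  HB.pack L (GRing.isLinear.Build _ _ _ _ L Ll).
rewrite {1}(row_sum_delta u) -[L]/(LL : _ -> _) linear_sum.
by apply: eq_bigr => i _; rewrite linearZ.
Qed.

Lemma linear_rV_continuous n (V : normedModType R) (L : 'rV[R]_n -> V) :
  linear L -> continuous L.
Proof.
move=> Ll y; apply: differentiable_continuous.
have -> : L = \sum_i (fun u : 'rV[R]_n => u 0 i *: L (delta_mx 0 i)).
  by apply/funext => u; rewrite {1}(linear_row_sum u Ll) fct_sumE.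
apply: differentiable_sum => i; apply: differentiableZl.
exact: differentiable_coord.
Qed.

Lemma derive_inv (U : normedModType R) (f : U -> R^o) y v :
  differentiable f y -> f y != 0 ->
  'D_v (fun z => (f z)^-1 : R^o) y = - ((f y)^-1 * (f y)^-1) * 'D_v f y.
Proof.
move=> df f0; rewrite !deriveE //; last exact: differentiableV.
by rewrite diffV //= -expr2 exprVn.
Qed.

End FirstOrderCalculus.

(** * Smooth germs *)

Section GermSmooth.
Context {R : realType} {n : nat}.
Local Notation E := 'rV[R]_n.

(* The neighbourhood may depend on the order of differentiation. *)
Definition germ_smooth (V : normedModType R) (y : E) (f : E -> V) : Prop :=
  forall vs : seq E,
    \forall z \near y, differentiable (foldr (fun v h => 'D_v h) f vs) z.

(** Finite differentiability by recursion on the order, the innermost derivative being peeled off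
    first. Closure under products, inverses and composition goes by induction on [k], for which the
    iterated derivatives of [germ_smooth] are unsuitable: the derivative of a product is a sum of
    products. *)
Fixpoint germ_Ck (V : normedModType R) (k : nat) (y : E) (f : E -> V) : Prop :=
  (\forall z \near y, differentiable f z) /\
  if k is k'.+1 then forall v, germ_Ck k' y ('D_v f) else True.

Section Basic.
Context {V : normedModType R}.
Implicit Types (f h : E -> V) (y v : E).

Lemma germ_smooth_near f y : germ_smooth y f ->
  \forall z \near y, differentiable f z.
Proof. by move=> /(_ [::]). Qed.

Lemma germ_smooth_at f y : germ_smooth y f -> differentiable f y.
Proof. by move=> /germ_smooth_near /nbhs_singleton. Qed.

Lemma germ_smooth_derive f y v : germ_smooth y f -> germ_smooth y ('D_v f).
Proof. by move=> sf vs; have := sf (rcons vs v); rewrite foldr_rcons. Qed.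

Lemma germ_smoothP f y : germ_smooth y f <-> forall k, germ_Ck k y f.
Proof.
split=> [sf k|].
  elim: k f sf => [|k IH] f sf /=; first by split => //; exact: germ_smooth_near.
  split; first exact: germ_smooth_near.
  by move=> v; apply/IH/germ_smooth_derive.
(* The last entry of [vs] is the innermost derivative, hence the induction from the right. *)
move=> sf vs; elim/last_ind: vs f sf => [|vs v IH] f sf.
  by case: (sf 0%N).
by rewrite foldr_rcons; apply: IH => k; case: (sf k.+1) => _; exact.
Qed.

Lemma germ_CkW k f y : germ_Ck k.+1 y f -> germ_Ck k y f.
Proof.
elim: k f => [|k IH] f [df sf]; split => //.
by move=> v; apply/IH/sf.
Qed.

Lemma near_eq_Ck k f h y : (\near y, f y = h y) ->
  germ_Ck k y f -> germ_Ck k y h.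
Proof.
elim: k f h => [|k IH] f h fh [df sf]; split => //.
- apply: filterS2 (near_join fh) df => z; exact: near_eq_differentiable.
- apply: filterS2 (near_join fh) df => z; exact: near_eq_differentiable.
move=> v; apply: IH (sf v).
by apply: filterS (near_join fh) => z; exact: near_eq_derive.
Qed.

Lemma near_eq_smooth f h y : (\near y, f y = h y) ->
  germ_smooth y f -> germ_smooth y h.
Proof.
move=> fh /germ_smoothP sf; apply/germ_smoothP => k.
exact: near_eq_Ck fh (sf k).
Qed.

Lemma smooth_on_germ (U : set E) f y : open U -> smooth_on U f -> U y ->
  germ_smooth y f.
Proof.
move=> oU sf Uy vs; have : nbhs y U by exact: open_nbhs_nbhs.
by apply: filterS => z; exact: sf.
Qed.

Lemma germ_smooth_on (U : set E) f : (forall y, U y -> germ_smooth y f) ->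
  smooth_on U f.
Proof. by move=> sf vs y /sf /(_ vs) /nbhs_singleton. Qed.

End Basic.

Section Closure.
Context {V W : normedModType R}.
Implicit Types (f h : E -> V) (y v : E).

Lemma Ck_cst k (c : V) y : germ_Ck k y (fun=> c).
Proof.
elim: k c => [|k IH] c; split => //.
- by near=> z; apply: differentiable_cst.
- by near=> z; apply: differentiable_cst.
move=> v; apply: near_eq_Ck (IH 0).
by near=> z; rewrite derive_cst.
Unshelve. all: by end_near. Qed.

Lemma Ck_add k f h y : germ_Ck k y f -> germ_Ck k y h ->
  germ_Ck k y (fun z => f z + h z).
Proof.
elim: k f h => [|k IH] f h [df sf] [dh sh]; split => //.
- by apply: filterS2 df dh => z; apply: differentiableD.
- by apply: filterS2 df dh => z; apply: differentiableD.
move=> v; apply: near_eq_Ck (IH _ _ (sf v) (sh v)).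
by apply: filterS2 df dh => z dfz dhz; rewrite derive_add.
Qed.

Lemma Ck_sum k (I : Type) (r : seq I) (P : pred I) (F : I -> E -> V) y :
  (forall i, germ_Ck k y (F i)) ->
  germ_Ck k y (fun z => \sum_(i <- r | P i) F i z).
Proof.
move=> sF; elim: r => [|i r IH].
  by under eq_fun do rewrite big_nil; exact: Ck_cst.
under eq_fun do rewrite big_cons.
by case: (P i) => //; apply: Ck_add.
Qed.

Lemma Ck_scale k (f : E -> R^o) h y : germ_Ck k y f -> germ_Ck k y h ->
  germ_Ck k y (fun z => f z *: h z).
Proof.
elim: k f h => [|k IH] f h cf ch; have [df sf] := cf; have [dh sh] := ch.
  by split => //; apply: filterS2 df dh => z; exact: differentiable_scale.
split; first by apply: filterS2 df dh => z; exact: differentiable_scale.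
move=> v.
have H1 := IH _ _ (sf v) (germ_CkW ch); have H2 := IH _ _ (germ_CkW cf) (sh v).
apply: near_eq_Ck (Ck_add H1 H2).
by apply: filterS2 df dh => z dfz dhz; rewrite derive_scale.
Qed.

Lemma Ck_linear k (L : V -> W) f y : linear L -> continuous L ->
  germ_Ck k y f -> germ_Ck k y (L \o f).
Proof.
move=> Ll Lc; elim: k f => [|k IH] f [df sf].
  split => //; apply: filterS df => z dfz.
  by apply: differentiable_comp => //; apply: linear_differentiable_at.
split.
  apply: filterS df => z dfz.
  by apply: differentiable_comp => //; apply: linear_differentiable_at.
move=> v; apply: near_eq_Ck (IH _ (sf v)).
by apply: filterS df => z dfz; rewrite (derive_linear_comp v Ll Lc dfz).
Qed.

End Closure.

(** The derivative of [1/f] is [- (1/f) (1/f) f'], where [1/f] is needed to one order less only, so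
    the induction on [k] closes. *)
Lemma Ck_inv k (f : E -> R^o) (y : E) : f y != 0 -> germ_Ck k y f ->
  germ_Ck k y (fun z => (f z)^-1 : R^o).
Proof.
move=> f0; elim: k => [|k IH] cf; have [df sf] := cf.
all: have fc : {for y, continuous f} by
  apply: differentiable_continuous (nbhs_singleton df).
all: have fn0 : \forall z \near y, f z != 0 by
  apply: (fc [set t | t != 0]); apply: open_nbhs_nbhs; split; [exact: open_neq|].
all: have di : \forall z \near y, differentiable (fun z => (f z)^-1 : R^o) z by
  apply: filterS2 df fn0 => z; exact: differentiableV.
  by split.
split => // v; have fI := IH (germ_CkW cf).
have H := Ck_scale (Ck_cst k (-1 : R^o) y) (Ck_scale fI (Ck_scale fI (sf v))).
apply: near_eq_Ck H; apply: filterS2 df fn0 => z dfz fz0.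
by rewrite derive_inv // scaleN1r mulNr; congr (- _); exact: mulrA.
Qed.

End GermSmooth.

Section GermSmoothComp.
Context {R : realType}.

Lemma linear_coord n (i : 'I_n) :
  linear (fun u : 'rV[R]_n => u 0 i : R^o).
Proof. by move=> a u v; rewrite !mxE. Qed.

Lemma Ck_coord n m k (f : 'rV[R]_n -> 'rV[R]_m) y i : germ_Ck k y f ->
  germ_Ck k y (fun z => f z 0 i : R^o).
Proof.
apply: (@Ck_linear _ _ _ _ k (fun u : 'rV[R]_m => u 0 i : R^o)).
  exact: linear_coord.
by apply: linear_rV_continuous; exact: linear_coord.
Qed.

(** By the chain rule the derivative of [h \o f] is a sum of components of the derivative of [f]
    times partial derivatives of [h] composed with [f]; each factor is covered by the induction at
    one order less. The sum is finite because the middle space is a space of row vectors. *)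
Lemma Ck_comp n m (V : normedModType R) k (f : 'rV[R]_n -> 'rV[R]_m)
  (h : 'rV[R]_m -> V) y : germ_Ck k y f -> germ_Ck k (f y) h ->
  germ_Ck k y (h \o f).
Proof.
elim: k h => [|k IH] h cf ch; have [df sf] := cf; have [dh sh] := ch.
all: have fc : {for y, continuous f} by
  apply: differentiable_continuous (nbhs_singleton df).
all: have dc : \forall z \near y, differentiable (h \o f) z by
  apply: filterS2 df (fc _ dh) => z; exact: differentiable_comp.
  by split.
split => // v.
have H : germ_Ck k y (fun z => \sum_i 'D_v f z 0 i *: 'D_(delta_mx 0 i) h (f z)).
  apply: Ck_sum => i; apply: Ck_scale; first exact: Ck_coord (sf v).
  exact: (IH ('D_(delta_mx 0 i) h) (germ_CkW cf) (sh _)).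
apply: near_eq_Ck H; apply: filterS2 df (fc _ dh) => z dfz dhz.
have Ll : linear (fun u => 'D_u h (f z)) by move=> a u w; apply: derive_linr.
have H := linear_row_sum ('D_v f z) Ll; by rewrite (derive_comp v dfz dhz) H.
Qed.

End GermSmoothComp.

(** * Symmetry of second derivatives *)

Section Schwarz.
Context {R : realType} {n : nat}.
Local Notation E := 'rV[R]_n.

Lemma is_derive_line (f : E -> R^o) (p u : E) (s : R) :
  differentiable f (p + s *: u) ->
  is_derive s 1 (fun s => f (p + s *: u) : R^o) ('D_u f (p + s *: u)).
Proof.
move=> df.
have lin : linear (fun s : R^o => s *: u).
  by move=> a x y; rewrite scalerDl scalerA.
have lc : continuous (fun s : R^o => s *: u) by exact: scalel_continuous.
have dl (t : R^o) : differentiable (fun s : R^o => p + s *: u) t.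
  by apply: differentiableD => //; exact: linear_differentiable_at.
have Dl (t : R^o) : 'D_1 (fun s : R^o => p + s *: u) t = u.
  have dL : differentiable (fun s : R^o => s *: u) t.
    exact: linear_differentiable_at.
  have D0 : 'D_1 (fun=> p) t = 0 :> E by exact: derive_cst.
  rewrite (derive_add (1 : R^o) (differentiable_cst p t) dL) D0 add0r derive_linear //.
  exact: scale1r.
have dc : differentiable (f \o (fun s : R^o => p + s *: u)) s.
  exact: differentiable_comp.
split; first exact: diff_derivable.
have := @derive_comp R R^o E R^o (fun s : R^o => p + s *: u) f s 1 (dl s) df.
by rewrite Dl.
Qed.

Lemma mean_value_line (f f' : E -> R) (p u : E) (t : R) : 0 < t ->
  (forall s : R, 0 <= s <= t ->
     is_derive s 1 (fun s : R => f (p + s *: u)) (f' (p + s *: u))) ->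
  exists2 s : R, 0 < s < t & f (p + t *: u) - f p = t * f' (p + s *: u).
Proof.
move=> t0 df.
have [] := @MVT R (fun s => f (p + s *: u)) (fun s => f' (p + s *: u)) 0 t t0.
- by move=> x; rewrite in_itv /= => /andP[x0 xt]; apply: df; rewrite !ltW.
- apply: derivable_within_continuous => x; rewrite in_itv /= => x0t.
  by have [] := df x x0t.
move=> s; rewrite in_itv /= => s0t E0; exists s => //.
by move: E0; rewrite scale0r addr0 subr0 => ->; rewrite mulrC.
Qed.

(** The mean value theorem is used twice: along [u] for the increment [f (z + t v) - f z], then
    along [v] for [fu]. *)
Lemma double_difference (f fu fuv : E -> R) (p u v : E) (t : R) : 0 < t ->
  (forall a b : R, 0 <= a <= t -> 0 <= b <= t ->
     is_derive a 1 (fun a : R => f (p + a *: u + b *: v))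
       (fu (p + a *: u + b *: v))) ->
  (forall a b : R, 0 <= a <= t -> 0 <= b <= t ->
     is_derive b 1 (fun b : R => fu (p + a *: u + b *: v))
       (fuv (p + a *: u + b *: v))) ->
  exists a b : R, [/\ 0 < a < t, 0 < b < t &
    f (p + t *: u + t *: v) - f (p + t *: u) - (f (p + t *: v) - f p) =
    t * (t * fuv (p + a *: u + b *: v))].
Proof.
move=> t0 df dfu.
have T : 0 <= t <= t by rewrite (ltW t0) lexx.
have Z : (0 : R) <= 0 <= t by rewrite lexx (ltW t0).
have dh (s : R) : 0 <= s <= t ->
    is_derive s 1 (fun s : R => f (p + s *: u + t *: v) - f (p + s *: u))
      (fu (p + s *: u + t *: v) - fu (p + s *: u)).
  move=> s0t; apply: (is_deriveB (df s t s0t T)).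
  by move: (df s 0 s0t Z); rewrite scale0r addr0; under eq_fun do rewrite addr0.
have [a a0t Ea] := @mean_value_line (fun z => f (z + t *: v) - f z)
    (fun z => fu (z + t *: v) - fu z) p u t t0 dh.
have a0t' : 0 <= a <= t by move: a0t => /andP[? ?]; rewrite !ltW.
have [b b0t Eb] := @mean_value_line fu fuv (p + a *: u) v t t0
  (fun s s0t => dfu a s a0t' s0t).
by exists a, b; split => //; rewrite -Eb -Ea.
Qed.

(** The double difference over the parallelogram spanned by [t u] and [t v] does not change when [u]
    and [v] are exchanged, so [double_difference] equates the two mixed derivatives at two points of
    it. Both are continuous at [y], hence their values at [y] differ by at most any [e > 0]. *)
Lemma derive_comm_real (f : E -> R^o) (y u v : E) : germ_smooth y f ->
  'D_v ('D_u f) y = 'D_u ('D_v f) y.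
Proof.
move=> sf; apply/eqP; rewrite eq_sym -subr_eq0; apply/eqP.
pose D z := 'D_u ('D_v f) z - 'D_v ('D_u f) z.
have su := germ_smooth_derive u sf; have sv := germ_smooth_derive v sf.
have cuv : {for y, continuous ('D_u ('D_v f))}.
  by apply/differentiable_continuous/germ_smooth_at/germ_smooth_derive.
have cvu : {for y, continuous ('D_v ('D_u f))}.
  by apply/differentiable_continuous/germ_smooth_at/germ_smooth_derive.
apply/eqP; rewrite -normr_le0; apply/ler_addgt0Pr => e e0; rewrite add0r.
have e2 : 0 < e / 2 by rewrite divr_gt0.
have [d /= d0 Hd] : exists2 d : R, 0 < d & forall z, `|y - z| < d ->
    [/\ differentiable f z, differentiable ('D_u f) z, differentiable ('D_v f) z,
      `|'D_u ('D_v f) y - 'D_u ('D_v f) z| < e / 2 &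
      `|'D_v ('D_u f) y - 'D_v ('D_u f) z| < e / 2].
  have N : \forall z \near y,
    [/\ differentiable f z, differentiable ('D_u f) z, differentiable ('D_v f) z,
      `|'D_u ('D_v f) y - 'D_u ('D_v f) z| < e / 2 &
      `|'D_v ('D_u f) y - 'D_v ('D_u f) z| < e / 2].
    have N1 := germ_smooth_near sf; have N2 := germ_smooth_near su.
    have N3 := germ_smooth_near sv.
    have /cvgrPdist_lt /(_ _ e2) N4 := cuv.
    have /cvgrPdist_lt /(_ _ e2) N5 := cvu.
    near=> z; split; [exact: (near N1 z)|exact: (near N2 z)|exact: (near N3 z)
      |exact: (near N4 z)|exact: (near N5 z)].
  move/nbhs_ballP: N => [d /= d0 Hd]; exists d => // z yz; apply: Hd.
  by rewrite -ball_normE.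
(* With this [t] the parallelogram at [y] stays within distance [d]; the added 1 keeps the
   denominator positive when [u] and [v] vanish. *)
have [t t0 Ht] : exists2 t : R, 0 < t & t * (`|u| + `|v|) < d.
  have k0 : 0 < `|u| + `|v| + 1 by rewrite ltr_wpDl // addr_ge0.
  exists (d / (`|u| + `|v| + 1)); first by rewrite divr_gt0.
  by rewrite mulrAC ltr_pdivrMr // ltr_pM2l // ltrDl.
have near_y (a b : R) : 0 <= a <= t -> 0 <= b <= t -> `|y - (y + a *: u + b *: v)| < d.
  move=> /andP[a0 at0] /andP[b0 bt0]; apply: le_lt_trans Ht.
  rewrite -addrA opprD addNKr normrN.
  apply: le_trans (ler_normD _ _) _; rewrite !normrZ !ger0_norm // mulrDr.
  by apply: lerD; apply: ler_wpM2r.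
have line (h : E -> R^o) (p w : E) (c : R) : differentiable h (p + c *: w) ->
  is_derive (c : R) 1 (fun c : R => h (p + c *: w) : R) ('D_w h (p + c *: w) : R).
  exact: is_derive_line.
have line' (h : E -> R^o) (p w z : E) (c : R) :
  differentiable h (p + c *: w + z) ->
  is_derive (c : R) 1 (fun c : R => h (p + c *: w + z) : R)
    ('D_w h (p + c *: w + z) : R).
  move=> dh; have : differentiable h (p + z + c *: w) by rewrite addrAC.
  by move/line; rewrite (addrAC p z); under eq_fun do rewrite addrAC.
have [a [b [a0 b0 E1]]] := @double_difference f ('D_u f) ('D_v ('D_u f)) y u v t t0
  (fun a b A B => line' _ _ _ _ _ (let: And5 H1 _ _ _ _ := Hd _ (near_y a b A B) in H1))
  (fun a b A B => line _ _ _ _ (let: And5 _ H1 _ _ _ := Hd _ (near_y a b A B) in H1)).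
have near_y' (c1 c2 : R) : 0 <= c1 <= t -> 0 <= c2 <= t ->
    `|y - (y + c1 *: v + c2 *: u)| < d.
  by move=> A B; rewrite addrAC; apply: near_y.
have [a' [b' [a0' b0' E2]]] := @double_difference f ('D_v f) ('D_u ('D_v f)) y v u t t0
  (fun a b A B => line' _ _ _ _ _ (let: And5 H1 _ _ _ _ := Hd _ (near_y' a b A B) in H1))
  (fun a b A B => line _ _ _ _ (let: And5 _ _ H1 _ _ := Hd _ (near_y' a b A B) in H1)).
have W (x : R) : 0 < x < t -> 0 <= x <= t by move=> /andP[? ?]; rewrite !ltW.
have [_ _ _ _ C1] := Hd _ (near_y _ _ (W _ a0) (W _ b0)).
have [_ _ _ C2 _] := Hd _ (near_y' _ _ (W _ a0') (W _ b0')).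
have E3 : 'D_v ('D_u f) (y + a *: u + b *: v) = 'D_u ('D_v f) (y + a' *: v + b' *: u).
  have tn0 : t != 0 by rewrite gt_eqF.
  have EE (x1 x2 x3 x4 : R) : x1 - x2 - (x3 - x4) = x1 - x3 - (x2 - x4) by ring.
  move: E2; rewrite (addrAC y (t *: v) (t *: u)) => E2.
  have := etrans (esym E1) (etrans (EE _ _ _ _) E2).
  by move/(mulfI tn0)/(mulfI tn0).
move: C1 C2; rewrite E3; move: ('D_u ('D_v f) (y + a' *: v + b' *: u)) => c.
move: ('D_v ('D_u f) y) ('D_u ('D_v f) y) => x1 x2 C1 C2.
have -> : x2 - x1 = (x2 - c) - (x1 - c) by ring.
apply: le_trans (ler_normB _ _) _.
by rewrite [e]splitr; apply: lerD; apply: ltW.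
Unshelve. all: by end_near. Qed.

Lemma derive_comm m (f : E -> 'rV[R]_m) (y u v : E) : germ_smooth y f ->
  'D_v ('D_u f) y = 'D_u ('D_v f) y.
Proof.
move=> sf; apply/rowP => i.
pose L (w : 'rV[R]_m) : R^o := w 0 i.
have Ll : linear L by exact: linear_coord.
have Lc : continuous L by apply: linear_rV_continuous.
have DL (h : E -> 'rV[R]_m) w z : differentiable h z ->
    'D_w (L \o h) z = L ('D_w h z) by exact: derive_linear_comp.
have sL : germ_smooth y (L \o f).
  by apply/germ_smoothP => k; apply: Ck_linear => //; exact: (germ_smoothP f y).1.
have := derive_comm_real u v sL.
have D2 w w' : 'D_w ('D_w' (L \o f)) y = L ('D_w ('D_w' f) y).
  rewrite -DL; last exact/germ_smooth_at/germ_smooth_derive.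
  apply: near_eq_derive; apply: filterS (germ_smooth_near sf) => z dz.
  exact: DL.
by rewrite !D2.
Qed.

End Schwarz.

(** * Rules for smooth germs, families of linear maps and linear systems *)

Section GermSmoothRules.
Context {R : realType} {n : nat}.
Local Notation E := 'rV[R]_n.

Section AnyTarget.
Context {V W : normedModType R}.
Implicit Types (f h : E -> V) (y v : E).

Lemma germ_smooth_cst (c : V) y : germ_smooth y (fun=> c).
Proof. by apply/germ_smoothP => k; exact: Ck_cst. Qed.

Lemma germ_smooth_add f h y : germ_smooth y f -> germ_smooth y h ->
  germ_smooth y (fun z => f z + h z).
Proof.
by move=> /germ_smoothP sf /germ_smoothP sh; apply/germ_smoothP => k;
  exact: Ck_add.
Qed.

Lemma germ_smooth_sum (I : Type) (r : seq I) (P : pred I) (F : I -> E -> V) y :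
  (forall i, germ_smooth y (F i)) ->
  germ_smooth y (fun z => \sum_(i <- r | P i) F i z).
Proof.
move=> sF; apply/germ_smoothP => k; apply: Ck_sum => i.
exact: (germ_smoothP _ _).1.
Qed.

Lemma germ_smooth_scale (f : E -> R^o) h y : germ_smooth y f ->
  germ_smooth y h -> germ_smooth y (fun z => f z *: h z).
Proof.
by move=> /germ_smoothP sf /germ_smoothP sh; apply/germ_smoothP => k;
  exact: Ck_scale.
Qed.

Lemma germ_smooth_linear (L : V -> W) f y : linear L -> continuous L ->
  germ_smooth y f -> germ_smooth y (L \o f).
Proof.
by move=> Ll Lc /germ_smoothP sf; apply/germ_smoothP => k; exact: Ck_linear.
Qed.

End AnyTarget.

Section AnyTargetBis.
Context {V : normedModType R}.
Implicit Types (f h : E -> V) (y v : E).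

Lemma germ_smooth_opp f y : germ_smooth y f -> germ_smooth y (fun z => - f z).
Proof.
move=> sf; have H := germ_smooth_scale (germ_smooth_cst (-1 : R^o) y) sf.
by apply: near_eq_smooth H; near=> z; rewrite scaleN1r.
Unshelve. all: by end_near. Qed.

Lemma germ_smooth_sub f h y : germ_smooth y f -> germ_smooth y h ->
  germ_smooth y (fun z => f z - h z).
Proof. by move=> sf sh; apply: germ_smooth_add => //; exact: germ_smooth_opp. Qed.

Lemma derive_sum (I : Type) (r : seq I) (P : pred I) (F : I -> E -> V) y v :
  (forall i, differentiable (F i) y) ->
  differentiable (fun z => \sum_(i <- r | P i) F i z) y /\
  'D_v (fun z => \sum_(i <- r | P i) F i z) y = \sum_(i <- r | P i) 'D_v (F i) y.
Proof.
move=> dF; elim: r => [|i r [dS DS]].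
  under eq_fun do rewrite big_nil; rewrite big_nil.
  by split; [exact: differentiable_cst|exact: derive_cst].
under eq_fun do rewrite big_cons; rewrite big_cons.
case: (P i) => //; split; first exact: differentiableD.
by rewrite -DS; exact: derive_add.
Qed.

End AnyTargetBis.

Implicit Types (y v : E) (f h : E -> R^o).

Lemma germ_smooth_mul f h y : germ_smooth y f -> germ_smooth y h ->
  germ_smooth y (fun z => f z * h z : R^o).
Proof. exact: germ_smooth_scale. Qed.

Lemma germ_smooth_inv f y : f y != 0 -> germ_smooth y f ->
  germ_smooth y (fun z => (f z)^-1 : R^o).
Proof.
by move=> f0 /germ_smoothP sf; apply/germ_smoothP => k; exact: Ck_inv.
Qed.

Lemma germ_smooth_prod (I : Type) (r : seq I) (P : pred I) (F : I -> E -> R^o) y :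
  (forall i, germ_smooth y (F i)) ->
  germ_smooth y (fun z => \prod_(i <- r | P i) F i z : R^o).
Proof.
move=> sF; elim: r => [|i r IH].
  by under eq_fun do rewrite big_nil; exact: germ_smooth_cst.
under eq_fun do rewrite big_cons.
by case: (P i) => //; apply: germ_smooth_mul.
Qed.

Lemma germ_smooth_comp m (V : normedModType R) (f : E -> 'rV[R]_m)
  (h : 'rV[R]_m -> V) y : germ_smooth y f -> germ_smooth (f y) h ->
  germ_smooth y (h \o f).
Proof.
by move=> /germ_smoothP sf /germ_smoothP sh; apply/germ_smoothP => k;
  exact: Ck_comp.
Qed.

Lemma germ_smooth_id y : germ_smooth y (fun z : E => z).
Proof.
have di : \forall z \near y, differentiable (fun z : E => z) z.
  near=> z; apply: (@linear_differentiable_at _ _ _ (fun z : E => z)) => //.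
  by move=> w; exact: cvg_id.
apply/germ_smoothP; case=> [|k]; split => // v.
apply: near_eq_Ck (Ck_cst k v y).
by near=> z; rewrite derive_id.
Unshelve. all: by end_near. Qed.

Lemma germ_smooth_linear_rV m (V : normedModType R) (L : 'rV[R]_m -> V)
  (f : E -> 'rV[R]_m) y : linear L -> germ_smooth y f -> germ_smooth y (L \o f).
Proof. by move=> Ll; apply: germ_smooth_linear => //; exact: linear_rV_continuous. Qed.

Lemma germ_smooth_coord m (f : E -> 'rV[R]_m) y i : germ_smooth y f ->
  germ_smooth y (fun z => f z 0 i : R^o).
Proof.
exact: (@germ_smooth_linear_rV _ _ (fun u : 'rV[R]_m => u 0 i : R^o) f y
  (linear_coord i)).
Qed.

Lemma germ_smooth_rV m (f : E -> 'rV[R]_m) y :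
  (forall i, germ_smooth y (fun z => f z 0 i : R^o)) -> germ_smooth y f.
Proof.
move=> sf.
have := @germ_smooth_sum 'rV[R]_m _ (index_enum 'I_m) xpredT
  (fun i z => f z 0 i *: delta_mx 0 i) y.
move=> H; apply: near_eq_smooth (H _) => [|i].
  by near=> z; rewrite -row_sum_delta.
by apply: germ_smooth_scale => //; exact: germ_smooth_cst.
Unshelve. all: by end_near. Qed.

Section Family.
Context {m : nat} {V : normedModType R}.
Context (L : E -> 'rV[R]_m -> V) (y : E).
Context (linL : \forall z \near y, linear (L z)).

Lemma family_near (f : E -> 'rV[R]_m) :
  \forall z \near y, \sum_i (f z 0 i : R^o) *: L z (delta_mx 0 i) = L z (f z).
Proof.
by apply: filterS linL => z Lz; rewrite [RHS](linear_row_sum _ Lz).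
Qed.

Lemma germ_smooth_family (f : E -> 'rV[R]_m) :
  (forall u, germ_smooth y (L ^~ u)) -> germ_smooth y f ->
  germ_smooth y (fun z => L z (f z)).
Proof.
move=> sL sf; apply: near_eq_smooth (family_near f) _.
apply: germ_smooth_sum => i; apply: germ_smooth_scale => //.
exact: germ_smooth_coord.
Qed.

(** Leibniz rule for a linear map that depends on the point. Expanding [f] in the standard basis
    leaves only derivatives of [L] at fixed vectors, which is the form in which the smoothness of
    tensors is given. *)
Lemma derive_family (f : E -> 'rV[R]_m) v :
  (forall u, differentiable (L ^~ u) y) -> differentiable f y ->
  differentiable (fun z => L z (f z)) y /\
  'D_v (fun z => L z (f z)) y = 'D_v (L ^~ (f y)) y + L y ('D_v f y).
Proof.
move=> dL df.
pose crd i (u : 'rV[R]_m) : R^o := u 0 i.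
have dcrd i : differentiable (fun z => f z 0 i : R^o) y.
  apply: (@differentiable_comp _ _ _ _ f (crd i)) => //.
  exact: differentiable_coord.
have Dcrd i : 'D_v (fun z => f z 0 i : R^o) y = ('D_v f y) 0 i.
  apply: (@derive_linear_comp _ _ _ _ f (crd i)) => //; first exact: linear_coord.
  by apply: linear_rV_continuous; exact: linear_coord.
have dterm i : differentiable (fun z => (f z 0 i : R^o) *: L z (delta_mx 0 i)) y.
  exact: differentiable_scale.
have [dS DS] := @derive_sum _ _ (index_enum 'I_m) xpredT
  (fun i z => (f z 0 i : R^o) *: L z (delta_mx 0 i)) y v dterm.
have nf := family_near f.
split; first exact: near_eq_differentiable nf dS.
rewrite -(near_eq_derive v nf) DS.
have dterm' i : differentiable (fun z => (f y 0 i : R^o) *: L z (delta_mx 0 i)) y.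
  by apply: differentiable_scale => //; exact: differentiable_cst.
have [dS' DS'] := @derive_sum _ _ (index_enum 'I_m) xpredT
  (fun i z => (f y 0 i : R^o) *: L z (delta_mx 0 i)) y v dterm'.
rewrite -(near_eq_derive v (family_near (fun=> f y))) DS'.
rewrite (linear_row_sum _ (nbhs_singleton linL)) -big_split /=.
apply: eq_bigr => i _; rewrite (derive_scale v (dcrd i) (dL _)) Dcrd addrC.
rewrite (derive_scale v (differentiable_cst (f y 0 i : R^o) y) (dL _)).
have D0 : 'D_v (fun=> f y 0 i : R^o) y = 0 by exact: derive_cst.
by rewrite D0 scale0r add0r.
Qed.

Lemma derive_family_linear v : (forall u, differentiable (L ^~ u) y) ->
  linear (fun u => 'D_v (L ^~ u) y).
Proof.
move=> dL a u w.
rewrite -[RHS]/(a *: 'D_v (L ^~ u) y + 'D_v (L ^~ w) y).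
have da : differentiable (fun z => (a : R^o) *: L z u) y.
  by apply: differentiable_scale => //; exact: differentiable_cst.
have -> : a *: 'D_v (L ^~ u) y = 'D_v (fun z => (a : R^o) *: L z u) y.
  have D0 : 'D_v (fun=> a : R^o) y = 0 by exact: derive_cst.
  by rewrite (derive_scale v (differentiable_cst (a : R^o) y) (dL u)) D0 scale0r add0r.
rewrite -derive_add //; apply: near_eq_derive.
by apply: filterS linL => z Lz; rewrite Lz.
Qed.

End Family.

Lemma germ_smooth_det m (A : E -> 'M[R]_m) y :
  (forall i j, germ_smooth y (fun z => A z i j : R^o)) ->
  germ_smooth y (fun z => \det (A z) : R^o).
Proof.
move=> sA; rewrite /determinant; apply: germ_smooth_sum => s.
apply: germ_smooth_mul; first exact: germ_smooth_cst.
by apply: germ_smooth_prod.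
Qed.

(** Cramer's formula: the entries of the inverse are cofactors over the determinant, which stays
    nonzero near [y]. *)
Lemma germ_smooth_solve m (A : E -> 'M[R]_m) (b : E -> 'rV[R]_m) y :
  A y \in unitmx -> (forall i j, germ_smooth y (fun z => A z i j : R^o)) ->
  germ_smooth y b -> germ_smooth y (fun z => b z *m invmx (A z)).
Proof.
move=> Ay sA sb.
have sdet := germ_smooth_det sA.
have det0 : \det (A y) != 0 by rewrite -unitfE -unitmxE.
have nU : \forall z \near y, A z \in unitmx.
  have := differentiable_continuous (germ_smooth_at sdet).
  move=> /(_ [set t | t != 0]) H.
  have : \forall z \near y, \det (A z) != 0.
    by apply: H; apply: open_nbhs_nbhs; split; [exact: open_neq|].
  by apply: filterS => z; rewrite unitmxE unitfE.
have sI i j : germ_smooth y (fun z => invmx (A z) i j : R^o).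
  have H : germ_smooth y (fun z => (\det (A z))^-1 * cofactor (A z) j i : R^o).
    apply: germ_smooth_mul; first exact: germ_smooth_inv.
    apply: germ_smooth_mul; first exact: germ_smooth_cst.
    apply: germ_smooth_det => i' j'.
    by apply: near_eq_smooth (sA (lift j i') (lift i j')); near=> z; rewrite !mxE.
  apply: near_eq_smooth H; apply: filterS nU => z Az.
  by rewrite /invmx Az !mxE.
apply: germ_smooth_rV => j.
have H := @germ_smooth_sum R^o _ (index_enum 'I_m) xpredT
   (fun i z => b z 0 i * invmx (A z) i j) y.
apply: near_eq_smooth (H _) => [|i]; first by near=> z; rewrite mxE.
by apply: germ_smooth_mul => //; exact: germ_smooth_coord.
Unshelve. all: by end_near. Qed.

End GermSmoothRules.

(** * Charts *)

Section Pullback.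
Context {R : realType} {n : nat}.
Local Notation E := 'rV[R]_n.

(** Here [t] and [s] will be the two transition maps between a pair of charts and [Z] a field read
    in the second one. The first term is a second derivative of [s], symmetric in its two
    directions, and is what has to cancel in a bracket. *)
Lemma derive_pullback (t s Z : E -> E) (y w : E) : differentiable t y ->
  germ_smooth (t y) s -> differentiable Z (t y) ->
  'D_w (fun x => 'D_(Z (t x)) s (t x)) y =
  'D_('D_w t y) ('D_(Z (t y)) s) (t y) + 'D_('D_('D_w t y) Z (t y)) s (t y).
Proof.
move=> dt ss dZ.
have dD u : differentiable ('D_u s) (t y) by exact/germ_smooth_at/germ_smooth_derive.
have dL u : differentiable (fun x => 'D_u s (t x)) y.
  exact: (@differentiable_comp _ _ _ _ t ('D_u s)).
have linL : \forall x \near y, linear (fun u => 'D_u s (t x)).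
  have : \forall x \near y, differentiable s (t x).
    have ct := differentiable_continuous dt.
    exact: (ct (fun z => differentiable s z) (germ_smooth_near ss)).
  by apply: filterS => x d a u v; exact: derive_linr.
have [_ D] := derive_family linL w dL (differentiable_comp dt dZ).
have e1 := derive_comp w dt (dD (Z (t y))).
have e2 := derive_comp w dt dZ.
apply: (etrans D); apply: (f_equal2 (fun a b => a + b) e1).
exact: (f_equal (fun u => 'D_u s (t y)) e2).
Qed.

Lemma germ_smooth_derive_along (V : normedModType R) (f : E -> V) (Z : E -> E)
  (y : E) : germ_smooth y f -> germ_smooth y Z ->
  germ_smooth y (fun z => 'D_(Z z) f z).
Proof.
move=> sf sZ; have linL : \forall z \near y, linear (fun u => 'D_u f z).
  by apply: filterS (germ_smooth_near sf) => z d a u v; exact: derive_linr.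
exact: (germ_smooth_family linL (fun u => germ_smooth_derive u sf) sZ).
Qed.

End Pullback.

Section Charts.
Context {R : realType} {n : nat} {M : charted_space R n}.
Context (hM : smooth_manifold M).
Local Notation E := 'rV[R]_n.
Implicit Types (p q x : M) (u v w : E) (X Y : vector_field M) (f : M -> R).

Lemma chart_dom_self p : chart_dom p p.
Proof. by have [_ _ /(_ p)[]] := hM. Qed.

Lemma chart_dom_open p : open (chart_dom p).
Proof. by have [_ _ /(_ p)[]] := hM. Qed.

Lemma chart_img_open p : open (chart_img p).
Proof. by have [_ _ /(_ p)[]] := hM. Qed.

Lemma chartK p x : chart_dom p x -> chart_inv p (chart p x) = x.
Proof. by have [_ _ _ /(_ p)[] H _ _ _] := hM => /mem_set; exact: H. Qed.

Lemma chart_img_chart p x : chart_dom p x -> chart_img p (chart p x).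
Proof. by exists x. Qed.

Lemma chart_dom_near p x : chart_dom p x -> \forall z \near x, chart_dom p z.
Proof.
by move=> px; apply: open_nbhs_nbhs; split => //; exact: chart_dom_open.
Qed.

Lemma chart_continuous p x : chart_dom p x -> {for x, continuous (chart p)}.
Proof.
move=> px; have [_ _ _ /(_ p)[] _ + _ _] := hM.
rewrite continuous_open_subspace; last exact: chart_dom_open.
by apply; rewrite inE.
Qed.

Lemma chart_inv_continuous p x : chart_dom p x ->
  chart_inv p @ chart p x --> x.
Proof.
move=> px; have [_ _ _ /(_ p)[] _ _ + _] := hM.
rewrite continuous_open_subspace; last exact: chart_img_open.
move=> /(_ (chart p x)); rewrite /prop_for /continuous_at chartK //.
by apply; rewrite inE; exact: chart_img_chart.
Qed.

Lemma near_chart_inv p x (P : set M) : chart_dom p x -> (\forall z \near x, P z) ->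
  \forall y \near chart p x, P (chart_inv p y).
Proof. by move=> px Px; exact: (chart_inv_continuous px). Qed.

Lemma near_chart_invK p x : chart_dom p x ->
  \forall y \near chart p x,
    chart_dom p (chart_inv p y) /\ chart p (chart_inv p y) = y.
Proof.
move=> px; have : nbhs (chart p x) (chart_img p).
  by apply: open_nbhs_nbhs; split; [exact: chart_img_open|exact: chart_img_chart].
by apply: filterS => _ [z pz <-]; rewrite chartK.
Qed.

Definition transition p q : E -> E := chart q \o chart_inv p.

Lemma transition_chart p q x : chart_dom p x -> transition p q (chart p x) = chart q x.
Proof. by move=> px; rewrite /transition /= chartK. Qed.

Lemma transition_smooth p q x : chart_dom p x -> chart_dom q x ->
  germ_smooth (chart p x) (transition p q).
Proof.
move=> px qx vs; have [_ _ _ _ /(_ p q) S] := hM.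
have : \forall y \near chart p x, (chart p @` (chart_dom p `&` chart_dom q)) y.
  apply: filterS2 (near_chart_invK px) (near_chart_inv px (chart_dom_near qx)).
  by move=> y [py Ey] qy; exists (chart_inv p y).
by apply: filterS => z; exact: S.
Qed.

Lemma near_transition p q x (P : set E) : chart_dom p x -> chart_dom q x ->
  (\forall y \near chart q x, P y) -> \forall y \near chart p x, P (transition p q y).
Proof.
move=> px qx Px.
have /germ_smooth_at/differentiable_continuous := transition_smooth px qx.
by apply; rewrite transition_chart.
Qed.

Lemma near_transition_trans p q r x : chart_dom p x -> chart_dom q x ->
  \forall y \near chart p x, transition q r (transition p q y) = transition p r y.
Proof.
move=> px qx; apply: filterS (near_chart_inv px (chart_dom_near qx)) => y qy.
by rewrite /transition /= chartK.
Qed.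

Lemma near_transition_id p x : chart_dom p x ->
  \forall y \near chart p x, transition p p y = y.
Proof. by move=> /near_chart_invK; apply: filterS => y []. Qed.

Lemma transferE p q x v : transfer p q x v = 'D_v (transition p q) (chart p x).
Proof. by []. Qed.

Lemma transfer_linear p q x : chart_dom p x -> chart_dom q x ->
  linear (transfer p q x).
Proof.
move=> px qx a u v; apply: derive_linr; apply: germ_smooth_at.
exact: transition_smooth.
Qed.

Lemma transfer_id p x v : chart_dom p x -> transfer p p x v = v.
Proof.
move=> px; rewrite transferE (near_eq_derive v (near_transition_id px)).
exact: derive_id.
Qed.

Lemma transfer_trans p q r x v : chart_dom p x -> chart_dom q x ->
  chart_dom r x -> transfer q r x (transfer p q x v) = transfer p r x v.
Proof.
move=> px qx rx; rewrite !transferE.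
rewrite -(near_eq_derive v (near_transition_trans r px qx)).
rewrite -{1}(transition_chart q px).
have d1 := germ_smooth_at (transition_smooth px qx).
have d2 := germ_smooth_at (transition_smooth qx rx).
rewrite -(transition_chart q px) in d2.
exact: esym (derive_comp v d1 d2).
Qed.

Lemma field_in_chart p X x : chart_dom p x ->
  field_in p X (chart p x) = transfer x p x (X x).
Proof. by move=> px; rewrite /field_in chartK. Qed.

Lemma field_in_self X x : field_in x X (chart x x) = X x.
Proof.
by rewrite field_in_chart ?transfer_id //; exact: chart_dom_self.
Qed.

(** The reading of [X] in [q] is the push-forward of its reading in [p] by the transition map. As
    this holds on a neighbourhood it may be differentiated, and the chart independence of smoothness
    and of brackets follows from it. *)
Lemma field_in_change p q X x : chart_dom p x -> chart_dom q x ->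
  \forall y \near chart q x, 'D_(field_in p X (transition q p y))
     (transition p q) (transition q p y) = field_in q X y.
Proof.
move=> px qx.
apply: filterS2 (near_chart_invK qx) (near_chart_inv qx (chart_dom_near px)).
move=> y [qy Ey] py; rewrite /transition /= field_in_chart //.
rewrite -/(transition p q) -transferE transfer_trans //.
exact: chart_dom_self.
Qed.

Lemma transition_family_linear p q x : chart_dom p x -> chart_dom q x ->
  \forall y \near chart q x,
    linear (fun u => 'D_u (transition p q) (transition q p y)).
Proof.
move=> px qx.
have := near_transition qx px (germ_smooth_near (transition_smooth px qx)).
by apply: filterS => y d a u v; exact: derive_linr.
Qed.

Lemma transition_family_smooth p q x u : chart_dom p x -> chart_dom q x ->
  germ_smooth (chart q x) (fun y => 'D_u (transition p q) (transition q p y)).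
Proof.
move=> px qx.
apply: (@germ_smooth_comp _ _ _ _ (transition q p) ('D_u (transition p q))).
  exact: transition_smooth.
by rewrite transition_chart //; apply/germ_smooth_derive/transition_smooth.
Qed.

Lemma smooth_field_change p q X x : chart_dom p x -> chart_dom q x ->
  germ_smooth (chart p x) (field_in p X) -> germ_smooth (chart q x) (field_in q X).
Proof.
move=> px qx sX; apply: near_eq_smooth (field_in_change X px qx) _.
apply: (germ_smooth_family (transition_family_linear px qx)).
  by move=> u; exact: transition_family_smooth.
apply: (@germ_smooth_comp _ _ _ _ (transition q p) (field_in p X)).
  exact: transition_smooth.
by rewrite transition_chart.
Qed.

Lemma function_change p q (V : Type) (f : M -> V) x : chart_dom p x -> chart_dom q x ->
  \forall y \near chart q x, f (chart_inv p (transition q p y)) = f (chart_inv q y).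
Proof.
move=> px qx; apply: filterS (near_chart_inv qx (chart_dom_near px)) => y py.
by rewrite /transition /= chartK.
Qed.

Lemma smooth_function_change p q f x : chart_dom p x -> chart_dom q x ->
  germ_smooth (chart p x) (f \o chart_inv p : E -> R^o) ->
  germ_smooth (chart q x) (f \o chart_inv q : E -> R^o).
Proof.
move=> px qx sf; apply: near_eq_smooth (function_change f px qx) _.
apply: (@germ_smooth_comp _ _ _ _ (transition q p) (f \o chart_inv p)).
  exact: transition_smooth.
by rewrite transition_chart.
Qed.

(** Smoothness as a germ, tested in the preferred chart of [x]; by [smooth_field_change] any chart
    around [x] gives the same notion. It accommodates coordinate fields, which are only known to be
    smooth on one chart domain. *)
Definition smooth_field_at x X := germ_smooth (chart x x) (field_in x X).

Definition smooth_function_at x f :=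
  germ_smooth (chart x x) (f \o chart_inv x : E -> R^o).

Lemma smooth_field_atP p x X : chart_dom p x ->
  smooth_field_at x X <-> germ_smooth (chart p x) (field_in p X).
Proof.
by move=> px; split; apply: smooth_field_change => //; exact: chart_dom_self.
Qed.

Lemma smooth_function_atP p x f : chart_dom p x ->
  smooth_function_at x f <-> germ_smooth (chart p x) (f \o chart_inv p : E -> R^o).
Proof.
by move=> px; split; apply: smooth_function_change => //; exact: chart_dom_self.
Qed.

Lemma smooth_fieldP X : smooth_field X <-> forall x, smooth_field_at x X.
Proof.
split=> [sX x|sX p].
  apply: smooth_on_germ (sX x) _; first exact: chart_img_open.
  exact/chart_img_chart/chart_dom_self.
apply: germ_smooth_on => _ [x px <-].
exact: (smooth_field_atP _ px).1.
Qed.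

Lemma smooth_functionP f : smooth_function f <-> forall x, smooth_function_at x f.
Proof.
split=> [sX x|sX p].
  apply: smooth_on_germ (sX x) _; first exact: chart_img_open.
  exact/chart_img_chart/chart_dom_self.
apply: germ_smooth_on => _ [x px <-].
exact: (smooth_function_atP _ px).1.
Qed.

Lemma lie_deriv_chart p x X f : chart_dom p x ->
  differentiable (f \o chart_inv p : E -> R^o) (chart p x) ->
  lie_deriv X f x =
    'D_(field_in p X (chart p x)) (f \o chart_inv p : E -> R^o) (chart p x).
Proof.
move=> px df; have xx := chart_dom_self x.
rewrite /lie_deriv -(near_eq_derive _ (function_change f px xx)).
rewrite -(transition_chart p xx) in df.
rewrite (derive_comp (X x) (germ_smooth_at (transition_smooth xx px)) df).
by rewrite (transition_chart p xx) (field_in_chart X px).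
Qed.

(* Both fields are pulled back from the chart p; the second derivatives of the
   transition map cancel by symmetry. *)
Lemma lie_bracket_chart p x X Y : chart_dom p x ->
  differentiable (field_in p X) (chart p x) ->
  differentiable (field_in p Y) (chart p x) ->
  field_in p (lie_bracket X Y) (chart p x) =
    'D_(field_in p X (chart p x)) (field_in p Y) (chart p x)
    - 'D_(field_in p Y (chart p x)) (field_in p X) (chart p x).
Proof.
move=> px dX dY; have xx := chart_dom_self x.
pose t := transition x p; pose s := transition p x.
have tx : t (chart x x) = chart p x by exact: transition_chart.
have dt : differentiable t (chart x x) by exact/germ_smooth_at/transition_smooth.
have ss : germ_smooth (t (chart x x)) s.
  by rewrite tx; exact: transition_smooth.
have key (Z : vector_field M) w : differentiable (field_in p Z) (chart p x) ->
    'D_w (field_in x Z) (chart x x) =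
    'D_(transfer x p x w) ('D_(field_in p Z (chart p x)) s) (chart p x) +
    'D_('D_(transfer x p x w) (field_in p Z) (chart p x)) s (chart p x).
  move=> dZ; apply: (etrans (esym (near_eq_derive w (field_in_change Z px xx)))).
  have dZt : differentiable (field_in p Z) (t (chart x x)) by rewrite tx.
  by have := derive_pullback w dt ss dZt; rewrite tx; exact.
have Ls : linear (transfer p x x) by exact: transfer_linear.
rewrite field_in_chart //.
suff -> : lie_bracket X Y x = transfer p x x
    ('D_(field_in p X (chart p x)) (field_in p Y) (chart p x)
     - 'D_(field_in p Y (chart p x)) (field_in p X) (chart p x)).
  by rewrite transfer_trans // transfer_id.
have LB a b : transfer p x x (a - b) = transfer p x x a - transfer p x x b.
  by rewrite addrC -scaleN1r Ls scaleN1r addrC.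
rewrite LB /lie_bracket (key Y _ dY) (key X _ dX) -!field_in_chart // /transfer.
rewrite -tx.
have cancel (a b c d : E) : a = c -> a + b - (c + d) = b - d.
  by move=> ->; rewrite opprD addrACA subrr add0r.
exact/cancel/(derive_comm (field_in p Y (t (chart x x))) (field_in p X (t (chart x x))) ss).
Qed.

Lemma smooth_field_coord p x u : chart_dom p x -> smooth_field_at x (coord_field p u).
Proof.
move=> px; apply/(smooth_field_atP _ px).
apply: near_eq_smooth (germ_smooth_cst u (chart p x)).
apply: filterS (near_chart_invK px) => y [py Ey].
rewrite /field_in /coord_field transfer_trans ?transfer_id //.
exact: chart_dom_self.
Qed.

Lemma coord_field_self x u : coord_field x u x = u.
Proof. exact/transfer_id/chart_dom_self. Qed.

Lemma field_coord p X x : chart_dom p x ->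
  coord_field p (field_in p X (chart p x)) x = X x.
Proof.
move=> px; have xx := chart_dom_self x.
by rewrite /coord_field field_in_chart // transfer_trans // transfer_id.
Qed.

Lemma near_eq_field p x X Y : chart_dom p x -> (\forall z \near x, X z = Y z) ->
  \forall y \near chart p x, field_in p X y = field_in p Y y.
Proof.
move=> px XY; apply: filterS (near_chart_inv px XY) => y Ey.
by rewrite /field_in Ey.
Qed.

Lemma smooth_lie_deriv x X f : smooth_field_at x X -> smooth_function_at x f ->
  smooth_function_at x (lie_deriv X f).
Proof.
move=> sX sf; have xx := chart_dom_self x.
have H := germ_smooth_derive_along sf sX.
apply: near_eq_smooth H.
apply: filterS2 (near_chart_invK xx) (germ_smooth_near sf) => y [xy Ey] d.
by rewrite /= (lie_deriv_chart X xy) Ey.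
Qed.

Lemma smooth_lie_bracket x X Y : smooth_field_at x X -> smooth_field_at x Y ->
  smooth_field_at x (lie_bracket X Y).
Proof.
move=> sX sY; have xx := chart_dom_self x.
have H1 := germ_smooth_derive_along sY sX; have H2 := germ_smooth_derive_along sX sY.
apply: near_eq_smooth (germ_smooth_sub H1 H2).
apply: filterS3 (near_chart_invK xx) (germ_smooth_near sX) (germ_smooth_near sY).
move=> y [xy Ey] dX dY; have := @lie_bracket_chart x (chart_inv x y) X Y xy.
by rewrite Ey => ->.
Qed.

End Charts.

(** * Componentwise derivatives in the preferred chart *)

Section LinearPredicate.
Context {R : pzRingType} {V W : lmodType R} (L : V -> W).
Context (hL : linear L).

Lemma lin0 : L 0 = 0.
Proof.
have := hL 1 0 0; rewrite !scale1r addr0 => /esym/eqP.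
by rewrite -subr_eq0 addrK => /eqP.
Qed.

Lemma linD u v : L (u + v) = L u + L v.
Proof. by rewrite -{1}[u]scale1r hL scale1r. Qed.

Lemma linZ a u : L (a *: u) = a *: L u.
Proof. by rewrite -{1}[_ *: _]addr0 hL lin0 addr0. Qed.

Lemma linN u : L (- u) = - L u.
Proof. by rewrite -scaleN1r linZ scaleN1r. Qed.

Lemma linB u v : L (u - v) = L u - L v.
Proof. by rewrite linD linN. Qed.

End LinearPredicate.

Section PointDerivatives.
Context {R : realType} {n : nat} {M : charted_space R n}.
Local Notation E := 'rV[R]_n.

Definition dfun (x : M) (f : M -> R) (w : E) : R :=
  'D_w (f \o chart_inv x : E -> R^o) (chart x x).

(* Componentwise derivative in the preferred chart of x; it is not covariant. *)
Definition dfield (x : M) (X : vector_field M) (w : E) : E :=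
  'D_w (field_in x X) (chart x x).

(** Coordinate fields have zero componentwise derivative, so only the components of [b] are
    differentiated here; likewise in [dendo]. *)
Definition dbilin (x : M) (b : bilin_field M) (w u v : E) : R :=
  dfun x (app_bilin b (coord_field x u) (coord_field x v)) w.

Definition dendo (x : M) (A : endo_field M) (w u : E) : E :=
  dfield x (app_endo A (coord_field x u)) w.

Lemma lie_derivE X f (x : M) : lie_deriv X f x = dfun x f (X x).
Proof. by []. Qed.

Lemma lie_bracketE X Y (x : M) :
  lie_bracket X Y x = dfield x Y (X x) - dfield x X (Y x).
Proof. by []. Qed.

Lemma dbilinE (x : M) b w u v :
  dbilin x b w u v = dfun x (app_bilin b (coord_field x u) (coord_field x v)) w.
Proof. by []. Qed.

Lemma dendoE (x : M) A w u :
  dendo x A w u = dfield x (app_endo A (coord_field x u)) w.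
Proof. by []. Qed.

Context (hM : smooth_manifold M).
Implicit Types (x p : M) (u v w : E) (X Y : vector_field M) (f h : M -> R).

Let xx x := chart_dom_self hM x.

Section Functions.

Lemma near_eq_dfun x f h w : (\forall z \near x, f z = h z) ->
  dfun x f w = dfun x h w.
Proof. by move=> fh; apply/near_eq_derive/(near_chart_inv hM (xx x) fh). Qed.

Lemma near_eq_smooth_function x f h : (\forall z \near x, f z = h z) ->
  smooth_function_at x f -> smooth_function_at x h.
Proof. by move=> fh; apply/near_eq_smooth/(near_chart_inv hM (xx x) fh). Qed.

Lemma dfun_linear x f : smooth_function_at x f -> scalar (dfun x f).
Proof. by move=> sf a u v; apply/derive_linr/germ_smooth_at. Qed.

Lemma smooth_function_cst x (c : R) : smooth_function_at x (fun=> c).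
Proof. exact: (@germ_smooth_cst _ _ R^o c). Qed.

Lemma dfun_cst x (c : R) w : dfun x (fun=> c) w = 0.
Proof. exact: (@derive_cst _ _ R^o c). Qed.

Lemma smooth_function_add x f h : smooth_function_at x f ->
  smooth_function_at x h -> smooth_function_at x (fun z => f z + h z).
Proof.
exact: (@germ_smooth_add _ _ R^o (f \o chart_inv x) (h \o chart_inv x) (chart x x)).
Qed.

Lemma dfun_add x f h w : smooth_function_at x f ->
  smooth_function_at x h -> dfun x (fun z => f z + h z) w = dfun x f w + dfun x h w.
Proof.
move=> sf sh; exact: derive_add (germ_smooth_at sf) (germ_smooth_at sh).
Qed.

Lemma smooth_function_mul x f h : smooth_function_at x f ->
  smooth_function_at x h -> smooth_function_at x (fun z => f z * h z).
Proof. exact: germ_smooth_mul. Qed.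

Lemma dfun_mul x f h w : smooth_function_at x f -> smooth_function_at x h ->
  dfun x (fun z => f z * h z) w = dfun x f w * h x + f x * dfun x h w.
Proof.
move=> sf sh.
have := derive_scale w (germ_smooth_at sf) (germ_smooth_at sh).
by rewrite /= (chartK hM (xx x)).
Qed.

Lemma smooth_function_sub x f h : smooth_function_at x f ->
  smooth_function_at x h -> smooth_function_at x (fun z => f z - h z).
Proof. exact: germ_smooth_sub. Qed.

Lemma smooth_function_opp x f : smooth_function_at x f ->
  smooth_function_at x (fun z => - f z).
Proof. exact: germ_smooth_opp. Qed.

Lemma dfun_opp x f w : smooth_function_at x f ->
  dfun x (fun z => - f z) w = - dfun x f w.
Proof.
move=> sf.
have := dfun_add w sf (smooth_function_opp sf).
have -> : (fun z => f z - f z) = (fun=> 0) by apply/funext => z; rewrite subrr.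
by rewrite dfun_cst => /esym/eqP; rewrite addrC addr_eq0 => /eqP.
Qed.

Lemma dfun_sub x f h w : smooth_function_at x f -> smooth_function_at x h ->
  dfun x (fun z => f z - h z) w = dfun x f w - dfun x h w.
Proof.
move=> sf sh; rewrite -(dfun_opp w sh).
exact: dfun_add sf (smooth_function_opp sh).
Qed.

Lemma smooth_function_inv x f : f x != 0 -> smooth_function_at x f ->
  smooth_function_at x (fun z => (f z)^-1).
Proof. by move=> f0; apply: germ_smooth_inv; rewrite /= (chartK hM (xx x)). Qed.

Lemma dfun_inv x f w : f x != 0 -> smooth_function_at x f ->
  dfun x (fun z => (f z)^-1) w = - ((f x)^-1 * (f x)^-1) * dfun x f w.
Proof.
move=> f0 sf; have f0' : (f \o chart_inv x) (chart x x) != 0.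
  by rewrite /= (chartK hM (xx x)).
by have := derive_inv w (germ_smooth_at sf) f0'; rewrite /= (chartK hM (xx x)).
Qed.

End Functions.

Section Fields.

Lemma near_eq_dfield x X Y w : (\forall z \near x, X z = Y z) ->
  dfield x X w = dfield x Y w.
Proof. by move=> XY; apply/near_eq_derive/(near_eq_field hM (xx x) XY). Qed.

Lemma near_eq_smooth_field x X Y : (\forall z \near x, X z = Y z) ->
  smooth_field_at x X -> smooth_field_at x Y.
Proof. by move=> XY; apply/near_eq_smooth/(near_eq_field hM (xx x) XY). Qed.

Lemma dfield_linear x X : smooth_field_at x X -> linear (dfield x X).
Proof. by move=> sf a u v; apply/derive_linr/germ_smooth_at. Qed.

Lemma near_transfer_linear x : \forall y \near chart x x,
  linear (transfer (chart_inv x y) x (chart_inv x y)).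
Proof.
apply: filterS (near_chart_invK hM (xx x)) => y [xy _].
by apply: transfer_linear.
Qed.

Lemma near_field_in_add x X Y : \forall y \near chart x x,
  field_in x X y + field_in x Y y = field_in x (fun z => X z + Y z) y.
Proof.
apply: filterS (near_transfer_linear x) => y L.
by rewrite /field_in (linD L).
Qed.

Lemma near_field_in_scale x f X : \forall y \near chart x x,
  (f (chart_inv x y) : R^o) *: field_in x X y = field_in x (fun z => f z *: X z) y.
Proof.
apply: filterS (near_transfer_linear x) => y L.
by rewrite /field_in (linZ L).
Qed.

Lemma smooth_field_add x X Y : smooth_field_at x X -> smooth_field_at x Y ->
  smooth_field_at x (fun z => X z + Y z).
Proof.
move=> sX sY; apply: near_eq_smooth (near_field_in_add x X Y) _.
exact: germ_smooth_add.
Qed.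

Lemma dfield_add x X Y w : smooth_field_at x X -> smooth_field_at x Y ->
  dfield x (fun z => X z + Y z) w = dfield x X w + dfield x Y w.
Proof.
move=> sX sY; apply: (etrans (esym (near_eq_derive w (near_field_in_add x X Y)))).
exact: derive_add (germ_smooth_at sX) (germ_smooth_at sY).
Qed.

Lemma smooth_field_scale x f X : smooth_function_at x f -> smooth_field_at x X ->
  smooth_field_at x (fun z => f z *: X z).
Proof.
move=> sf sX; apply: near_eq_smooth (near_field_in_scale x f X) _.
exact: germ_smooth_scale.
Qed.

Lemma dfield_scale x f X w : smooth_function_at x f -> smooth_field_at x X ->
  dfield x (fun z => f z *: X z) w = dfun x f w *: X x + f x *: dfield x X w.
Proof.
move=> sf sX; apply: (etrans (esym (near_eq_derive w (near_field_in_scale x f X)))).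
have := derive_scale w (germ_smooth_at sf) (germ_smooth_at sX).
by rewrite /= (chartK hM (xx x)) (field_in_self hM).
Qed.

Lemma smooth_field_opp x X : smooth_field_at x X -> smooth_field_at x (fun z => - X z).
Proof.
move=> sX; have := smooth_field_scale (smooth_function_cst x (-1)) sX.
by apply: near_eq_smooth_field; near=> z; rewrite scaleN1r.
Unshelve. all: by end_near. Qed.

Lemma dfield_opp x X w : smooth_field_at x X ->
  dfield x (fun z => - X z) w = - dfield x X w.
Proof.
move=> sX; have := dfield_scale w (smooth_function_cst x (-1)) sX.
rewrite dfun_cst scale0r add0r scaleN1r => <-.
by congr (dfield x _ w); apply/funext => z; rewrite scaleN1r.
Qed.

Lemma smooth_field_sub x X Y : smooth_field_at x X -> smooth_field_at x Y ->
  smooth_field_at x (fun z => X z - Y z).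
Proof.
by move=> sX sY; exact: (smooth_field_add sX (smooth_field_opp sY)).
Qed.

Lemma dfield_sub x X Y w : smooth_field_at x X -> smooth_field_at x Y ->
  dfield x (fun z => X z - Y z) w = dfield x X w - dfield x Y w.
Proof.
move=> sX sY; rewrite -(dfield_opp w sY).
exact: dfield_add sX (smooth_field_opp sY).
Qed.

Lemma dfield_coord x u w : dfield x (coord_field x u) w = 0.
Proof.
have N : \forall y \near chart x x, field_in x (coord_field x u) y = u.
  apply: filterS (near_chart_invK hM (xx x)) => y [xy _].
  by rewrite /field_in /coord_field transfer_trans // transfer_id.
by apply: (etrans (near_eq_derive w N)); exact: derive_cst.
Qed.

Lemma dfield0 x w : dfield x (fun=> 0) w = 0.
Proof.
have s0 := smooth_field_coord hM (0 : E) (xx x).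
have -> : (fun=> 0) = (fun z => coord_field x 0 z - coord_field x 0 z).
  by apply/funext => z; rewrite subrr.
by rewrite (dfield_sub w s0 s0) subrr.
Qed.

End Fields.

Section Bilinear.
Context (b : bilin_field M) (hb : smooth_bilin b).

Let bl x u : scalar (b x u). Proof. by have [/(_ x u)[]] := hb. Qed.
Let br x v : scalar (b x ^~ v). Proof. by have [/(_ x v)[]] := hb. Qed.

Let bf x y u v : R^o :=
  app_bilin b (coord_field x u) (coord_field x v) (chart_inv x y).

Let sbf x u v : germ_smooth (chart x x) (fun y => bf x y u v).
Proof.
have [_ /(_ x u v) S] := hb.
apply: smooth_on_germ S _; first exact: (chart_img_open hM).
exact/chart_img_chart/xx.
Qed.

Let near_coord_linear x : \forall y \near chart x x,
  linear (fun u => coord_field x u (chart_inv x y)).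
Proof.
apply: filterS (near_chart_invK hM (xx x)) => y [xy _].
by apply: (transfer_linear hM) => //; exact: xx.
Qed.

Let bfl x u : \forall y \near chart x x, linear (bf x y u : E -> R^o).
Proof.
apply: filterS (near_coord_linear x) => y L a v w.
by rewrite /bf /app_bilin L bl.
Qed.

Let bfr x v : \forall y \near chart x x, linear (fun u => bf x y u v : R^o).
Proof.
apply: filterS (near_coord_linear x) => y L a u w.
by rewrite /bf /app_bilin L br.
Qed.

Let near_bf x X Y : \forall y \near chart x x,
  bf x y (field_in x X y) (field_in x Y y) = app_bilin b X Y (chart_inv x y).
Proof.
apply: filterS (near_chart_invK hM (xx x)) => y [xy Ey].
have FX := field_coord hM X xy; have FY := field_coord hM Y xy.
by rewrite Ey in FX FY; rewrite /bf /app_bilin FX FY.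
Qed.

Let bflF x (X : vector_field M) : \forall y \near chart x x,
  linear (fun v => bf x y (field_in x X y) v : R^o).
Proof.
apply: filterS (near_coord_linear x) => y L a v w.
by rewrite /bf /app_bilin L bl.
Qed.

Lemma smooth_app_bilin x X Y : smooth_field_at x X -> smooth_field_at x Y ->
  smooth_function_at x (app_bilin b X Y).
Proof.
move=> sX sY; apply: near_eq_smooth (near_bf x X Y) _.
have S1 v := @germ_smooth_family _ _ _ R^o (fun y u => bf x y u v) _ (bfr x v)
  (field_in x X) (fun u => sbf x u v) sX.
exact: (@germ_smooth_family _ _ _ R^o (fun y v => bf x y (field_in x X y) v) _
  (bflF x X) (field_in x Y) S1 sY).
Qed.

(** The Leibniz rule for families, once for each slot. No single term on the right is tensorial; the
    derivatives of the fields are kept apart so that they can be cancelled by algebra. *)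
Lemma dfun_app_bilin x X Y w : smooth_field_at x X -> smooth_field_at x Y ->
  dfun x (app_bilin b X Y) w =
  dbilin x b w (X x) (Y x) + b x (dfield x X w) (Y x) + b x (X x) (dfield x Y w).
Proof.
move=> sX sY.
have E0 u v : bf x (chart x x) u v = b x u v.
  by rewrite /bf /app_bilin (chartK hM (xx x)) !(coord_field_self hM).
have D1 v := @derive_family _ _ _ R^o (fun y u => bf x y u v) _ (bfr x v)
  (field_in x X) w (fun u => germ_smooth_at (sbf x u v)) (germ_smooth_at sX).
have [_ D2] := @derive_family _ _ _ R^o (fun y v => bf x y (field_in x X y) v) _
  (bflF x X) (field_in x Y) w (fun v => (D1 v).1) (germ_smooth_at sY).
apply: (etrans (esym (near_eq_derive w (near_bf x X Y)))).
apply: (etrans D2); rewrite (D1 _).2 !(field_in_self hM) !E0.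
by [].
Qed.

Lemma dbilin_linear x u v : scalar (fun w => dbilin x b w u v).
Proof. by apply: dfun_linear; apply: smooth_app_bilin; apply: smooth_field_coord. Qed.

Lemma dbilin_linear_l x w v : scalar (fun u => dbilin x b w u v).
Proof.
exact: (@derive_family_linear _ _ _ R^o (fun y u => bf x y u v) _ (bfr x v) w
  (fun u => germ_smooth_at (sbf x u v))).
Qed.

Lemma dbilin_linear_r x w u : scalar (dbilin x b w u).
Proof.
exact: (@derive_family_linear _ _ _ R^o (fun y v => bf x y u v) _ (bfl x u) w
  (fun v => germ_smooth_at (sbf x u v))).
Qed.

End Bilinear.

Lemma smooth_bilin_intro (b : bilin_field M) :
  (forall x u, scalar (b x u) /\ scalar (b x ^~ u)) ->
  (forall x X Y, smooth_field_at x X -> smooth_field_at x Y ->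
    smooth_function_at x (app_bilin b X Y)) -> smooth_bilin b.
Proof.
move=> bb sb; split => // p u v; apply: germ_smooth_on => _ [x px <-].
apply: (smooth_function_atP hM _ px).1.
by apply: sb; apply: smooth_field_coord.
Qed.

Section Endomorphism.
Context (A : endo_field M) (hA : smooth_endo A).

Let Al x : linear (A x). Proof. by have [] := hA. Qed.

Let af x y u := field_in x (app_endo A (coord_field x u)) y.

Let saf x u : germ_smooth (chart x x) (fun y => af x y u).
Proof.
have [_ /(_ x u) S] := hA.
apply: smooth_on_germ S _; first exact: (chart_img_open hM).
exact/chart_img_chart/xx.
Qed.

Let afl x : \forall y \near chart x x, linear (af x y).
Proof.
apply: filterS (near_chart_invK hM (xx x)) => y [xy _] a u v.
have L1 := transfer_linear hM xy (xx (chart_inv x y)).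
have L2 := transfer_linear hM (xx (chart_inv x y)) xy.
by rewrite /af /field_in /app_endo /coord_field L1 Al L2.
Qed.

Let near_af x X : \forall y \near chart x x,
  af x y (field_in x X y) = field_in x (app_endo A X) y.
Proof.
apply: filterS (near_chart_invK hM (xx x)) => y [xy Ey].
have FX := field_coord hM X xy; rewrite Ey in FX.
by rewrite /af /app_endo /field_in -/(field_in x X y) FX.
Qed.

Lemma smooth_app_endo x X : smooth_field_at x X -> smooth_field_at x (app_endo A X).
Proof.
move=> sX; apply: near_eq_smooth (near_af x X) _.
exact: (germ_smooth_family (afl x) (saf x) sX).
Qed.

Lemma dfield_app_endo x X w : smooth_field_at x X ->
  dfield x (app_endo A X) w = dendo x A w (X x) + A x (dfield x X w).
Proof.
move=> sX.
have E0 u : af x (chart x x) u = A x u.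
  by rewrite /af (field_in_self hM) /app_endo (coord_field_self hM).
have [_ D] := derive_family (afl x) w (fun u => germ_smooth_at (saf x u))
  (germ_smooth_at sX).
apply: (etrans (esym (near_eq_derive w (near_af x X)))).
by apply: (etrans D); rewrite (field_in_self hM) E0.
Qed.

Lemma dendo_linear x u : linear (fun w => dendo x A w u).
Proof. by apply: dfield_linear; apply: smooth_app_endo; apply: smooth_field_coord. Qed.

Lemma dendo_linear_r x w : linear (dendo x A w).
Proof.
exact: (derive_family_linear (afl x) w (fun u => germ_smooth_at (saf x u))).
Qed.

End Endomorphism.

End PointDerivatives.

Opaque dfun dfield dbilin dendo.

(* ring and lra would unfold derivatives, so these become variables first. *)
Ltac gen_dbilin := repeat match goal with
  | |- context [dbilin ?b ?x ?u ?v ?w] => generalize (dbilin b x u v w); intro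
  end.

(** * Exterior derivatives of two-forms at a point *)

Section TwoForms.
Context {R : realType}.

Section Algebra.
Context {V : lmodType R} (B : V -> V -> R).
Context (Bl : forall u, scalar (B u)) (Br : forall v, scalar (B ^~ v)).
Context (Balt : forall u v, B u v = - B v u).

(** [XY] stands for the derivative of the field [Y] along [X], so that [XY - YX] is the bracket. By
    antisymmetry of [B] all derivatives of fields cancel in [d2], which makes it tensorial. *)
Lemma d2_algebra (X Y Z XY YX XZ ZX YZ ZY : V) (a b c : R) :
  (a + B XY Z + B Y XZ) - (b + B YX Z + B X YZ) + (c + B ZX Y + B X ZY)
  - B (XY - YX) Z + B (XZ - ZX) Y - B (YZ - ZY) X = a - b + c.
Proof.
rewrite (linB (Br Z)) (linB (Br Y)) (linB (Br X)).
rewrite (Balt Y XZ) (Balt X YZ) (Balt X ZY).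
ring.
Qed.

End Algebra.

Context {n : nat} {M : charted_space R n} (hM : smooth_manifold M).
Context (b : bilin_field M) (hb : smooth_bilin b).
Local Notation E := 'rV[R]_n.

(** The exterior derivative on vectors instead of fields: for commuting coordinate fields the
    bracket terms of [d2] are absent. *)
Definition dform (x : M) (u v w : E) : R :=
  dbilin x b u v w - dbilin x b v u w + dbilin x b w u v.

Lemma bilin_l x u : scalar (b x u). Proof. by have [/(_ x u)[]] := hb. Qed.
Lemma bilin_r x v : scalar (b x ^~ v). Proof. by have [/(_ x v)[]] := hb. Qed.

Lemma d2E (X Y Z : vector_field M) x : (forall x u v, b x u v = - b x v u) ->
  smooth_field_at x X -> smooth_field_at x Y -> smooth_field_at x Z ->
  d2 (app_bilin b) X Y Z x = dform x (X x) (Y x) (Z x).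
Proof.
move=> alt sX sY sZ; rewrite /d2 !lie_derivE.
rewrite (dfun_app_bilin hM hb _ sY sZ) (dfun_app_bilin hM hb _ sX sZ).
rewrite (dfun_app_bilin hM hb _ sX sY) /app_bilin !lie_bracketE.
exact: (d2_algebra (bilin_r x) (alt x)).
Qed.

Lemma smooth_d2 (X Y Z : vector_field M) x :
  smooth_field_at x X -> smooth_field_at x Y -> smooth_field_at x Z ->
  smooth_function_at x (d2 (app_bilin b) X Y Z).
Proof.
move=> sX sY sZ.
have sXY := smooth_lie_bracket hM sX sY; have sXZ := smooth_lie_bracket hM sX sZ.
have sYZ := smooth_lie_bracket hM sY sZ.
have sb (U W : vector_field M) : smooth_field_at x U -> smooth_field_at x W ->
  smooth_function_at x (app_bilin b U W) by exact: smooth_app_bilin.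
have sl (U U' W : vector_field M) : smooth_field_at x U -> smooth_field_at x U' ->
   smooth_field_at x W -> smooth_function_at x (lie_deriv U (app_bilin b U' W)).
  by move=> sU sU' sW; exact: (smooth_lie_deriv hM sU (sb _ _ sU' sW)).
have H1 := smooth_function_sub (sl _ _ _ sX sY sZ) (sl _ _ _ sY sX sZ).
have H2 := smooth_function_add H1 (sl _ _ _ sZ sX sY).
have H3 := smooth_function_sub H2 (sb _ _ sXY sZ).
have H4 := smooth_function_add H3 (sb _ _ sXZ sY).
exact: (smooth_function_sub H4 (sb _ _ sYZ sX)).
Qed.

Lemma dform_linear1 x v w : scalar (fun u => dform x u v w).
Proof.
move=> a u u'; rewrite /dform (dbilin_linear hM hb) (dbilin_linear_l hM hb).
rewrite (dbilin_linear_l hM hb).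
gen_dbilin; ring.
Qed.

Lemma dform_linear2 x u w : scalar (fun v => dform x u v w).
Proof.
move=> a v v'; rewrite /dform (dbilin_linear hM hb) (dbilin_linear_l hM hb).
rewrite (dbilin_linear_r hM hb).
gen_dbilin; ring.
Qed.

Lemma dform_linear3 x u v : scalar (fun w => dform x u v w).
Proof.
move=> a w w'; rewrite /dform (dbilin_linear hM hb) !(dbilin_linear_r hM hb).
gen_dbilin; ring.
Qed.

Lemma dbilin_alt x w u v : (forall x u v, b x u v = - b x v u) ->
  dbilin x b w u v = - dbilin x b w v u.
Proof.
move=> alt.
have su := smooth_field_coord hM u (chart_dom_self hM x).
have sv := smooth_field_coord hM v (chart_dom_self hM x).
rewrite !dbilinE -(dfun_opp w (smooth_app_bilin hM hb sv su)).
by congr (dfun x _ w); apply/funext => z; exact: alt.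
Qed.

End TwoForms.

(** * The pointwise identity that makes [J] parallel *)

Section HermitianPoint.
Context {R : realType} {V : lmodType R} (G : V -> V -> R) (j : V -> V).
Context (P : V -> V -> V) (DG : V -> V -> V -> R).
Context (Gl : forall u, scalar (G u)) (Gr : forall v, scalar (G ^~ v)).
Context (jl : linear j) (Gj : forall u v, G (j u) (j v) = G u v).
Context (jj : forall u, j (j u) = - u).
Context (Gs : forall u v, G u v = G v u).
Context (DGs : forall w u v, DG w u v = DG w v u).
Context (DGr : forall w u, scalar (DG w u)) (DGl : forall w v, scalar (DG w ^~ v)).
Context (DG1 : forall u v, scalar (fun w => DG w u v)).
Context (P1 : forall u, linear (P ^~ u)) (P2 : forall w, linear (P w)).
Context (dJJ : forall w u, P w (j u) = - j (P w u)).
Context (dGJ : forall w u v,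
  DG w (j u) (j v) + G (P w u) (j v) + G (j u) (P w v) = DG w u v).

Let Dom u v w := DG u (j v) w + G (P u v) w.
Let T u v w := Dom u v w - Dom v u w + Dom w u v.
Let nij u v := P (j u) v - P (j v) u + j (P v u) - j (P u v).

Lemma nijenhuis_hermitian u v w : nij u v = 0 -> nij u w = 0 ->
  2 * G (P u v) w
  + (DG u (j v) w + DG (j v) u w - DG w u (j v) + T (j u) (j (j v)) (j w))
  + (DG u v (j w) + DG v u (j w) - DG (j w) u v + T (j u) (j v) (j (j w))) = 0.
Proof.
move=> Nv Nw.
have GNl a b : G (- a) b = - G a b by exact: (linN (Gr b)).
have GNr a b : G a (- b) = - G a b by exact: (linN (Gl a)).
have Gjs a b : G (j a) b = - G a (j b) by rewrite -(Gj a (j b)) jj GNr opprK.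
have DN1 a b c : DG (- a) b c = - DG a b c by exact: (linN (DG1 b c)).
have DN2 a b c : DG a (- b) c = - DG a b c by exact: (linN (DGl a c)).
have DN3 a b c : DG a b (- c) = - DG a b c by exact: (linN (DGr a b)).
have PN1 a b : P (- a) b = - P a b by exact: (linN (P1 b)).
have PN2 a b : P a (- b) = - P a b by exact: (linN (P2 a)).
have jN a : j (- a) = - j a by exact: (linN jl).
have Tv : T (j u) (- v) (j w) = - (DG (j u) (j v) (j w) + G (P (j u) v) (j w))
    + (- DG v u (j w) - G (j (P v u)) (j w)) - (- DG (j w) u v - G (j (P (j w) u)) v).
  rewrite /T /Dom !(jj, jN, DN1, DN2, DN3, PN1, PN2, GNl, GNr, dJJ); ring.
have Tw : T (j u) (j v) (- w) = (DG (j u) v w + G (j (P (j u) v)) w)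
    - (DG (j v) u w + G (j (P (j v) u)) w) + (DG w u (j v) + G (j (P w u)) (j v)).
  rewrite /T /Dom !(jj, jN, DN1, DN2, DN3, PN1, PN2, GNl, GNr, dJJ); ring.
(* The conclusion is a linear combination of four equations: the derivative of the compatibility of
   [j] with [G] along [u] and along [j u], and the two Nijenhuis equations paired with [w] and with
   [v] after applying [j]. *)
have e1 := dGJ u v (j w); rewrite !(jj, DN3, GNr, dJJ, Gj) in e1.
have e2 := dGJ (j u) v w.
have n1 : G (j (nij u v)) w = 0 by rewrite Nv (lin0 jl) (lin0 (Gr _)).
have n2 : G v (j (nij u w)) = 0 by rewrite Nw (lin0 jl) (lin0 (Gl _)).
rewrite /nij (linB jl) (linD jl) (linB jl) !jj opprK in n1.
rewrite /nij (linB jl) (linD jl) (linB jl) !jj opprK in n2.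
rewrite !(linD (Gr _)) !GNl in n1; rewrite !(linD (Gl _)) !GNr in n2.
rewrite !jj Tv Tw.
have k1 := Gjs (P (j u) v) w; have k2 := Gjs v (P (j u) w).
have k3 := Gj (P v u) w; have k4 := Gs (j (P (j w) u)) v.
have k5 := Gj (P w u) v; have k6 := Gs (P w u) v.
move: e1 e2 n1 n2 k1 k2 k3 k4 k5 k6.
clear Tv Tw Nv Nw; lra.
Qed.

End HermitianPoint.

Lemma scalarZ (R : realType) (V : lmodType R) (f : V -> R) a u :
  scalar f -> f (a *: u) = a * f u.
Proof. by move=> hf; exact: (linZ hf). Qed.

(** * Gram matrices and metric duality *)

Section Gram.
Context {R : realType} {n : nat} {V : lmodType R}.
Context (G : V -> V -> R) (L : 'rV[R]_n -> V).
Context (Gl : forall u, scalar (G u)) (Gr : forall v, scalar (G ^~ v)).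
Context (Gpos : forall v, v != 0 -> 0 < G v v).
Context (Ll : linear L) (Linj : forall u, L u = 0 -> u = 0).

Definition gram : 'M[R]_n :=
  \matrix_(i, j) G (L (delta_mx 0 i)) (L (delta_mx 0 j)).

Lemma gram_row (u : 'rV[R]_n) j : (u *m gram) 0 j = G (L u) (L (delta_mx 0 j)).
Proof.
rewrite (linear_row_sum u Ll) mxE.
have -> : G (\sum_i u 0 i *: L (delta_mx 0 i)) (L (delta_mx 0 j)) =
  \sum_i G (u 0 i *: L (delta_mx 0 i)) (L (delta_mx 0 j)).
  elim/big_ind2: _ => //; first exact: (lin0 (Gr _)).
  by move=> x a y b <- <-; rewrite (linD (Gr _)).
by apply: eq_bigr => i _; rewrite mxE (linZ (Gr _)).
Qed.

(** A row vector killed by the Gram matrix has an image under [L] that is orthogonal to the whole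
    image of [L], itself included. *)
Lemma gram_unit : gram \in unitmx.
Proof.
rewrite -row_free_unit -kermx_eq0; apply/rowV0P => u /sub_kermxP ug.
apply: Linj; apply/eqP/negPn/negP => /Gpos; rewrite lt_neqAle eq_sym => /andP[+ _].
apply/negP; rewrite negbK {2}(linear_row_sum u Ll).
have -> : G (L u) (\sum_i u 0 i *: L (delta_mx 0 i)) =
  \sum_i G (L u) (u 0 i *: L (delta_mx 0 i)).
  elim/big_ind2: _ => //; first exact: (lin0 (Gl _)).
  by move=> x a y b <- <-; rewrite (linD (Gl _)).
apply/eqP/big1 => i _; rewrite (linZ (Gl _)) -gram_row ug mxE.
exact: mulr0.
Qed.

End Gram.

Section Riesz.
Context {R : realType} {n : nat} {M : charted_space R n}.
Context (hM : smooth_manifold M) (g : bilin_field M) (hg : riemannian_metric g).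
Local Notation E := 'rV[R]_n.

Lemma metric_smooth : smooth_bilin g. Proof. by case: hg. Qed.
Lemma metric_sym x u v : g x u v = g x v u. Proof. by case: hg. Qed.
Lemma metric_pos x v : v != 0 -> 0 < g x v v. Proof. by case: hg => _ _; apply. Qed.

Lemma metric_eq0 x v : (forall w, g x v w = 0) -> v = 0.
Proof.
move=> g0; apply/eqP/negPn/negP => /(metric_pos x).
by rewrite g0 ltxx.
Qed.

Lemma metric_inj x u v : (forall w, g x u w = g x v w) -> u = v.
Proof.
move=> uv; apply/subr0_eq/(@metric_eq0 x) => w.
by rewrite (linB (bilin_r metric_smooth x w)) uv subrr.
Qed.

Definition riesz (x : M) (l : E -> R) : E :=
  (\row_i l (delta_mx 0 i)) *m invmx (gram (g x) id).

Lemma rieszP x (l : E -> R) w : scalar l -> g x (riesz x l) w = l w.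
Proof.
move=> ll.
have gl := bilin_l metric_smooth x; have gr := bilin_r metric_smooth x.
have idl : linear (@id E) by [].
have U : gram (g x) id \in unitmx by apply: (gram_unit gl gr (@metric_pos x) idl).
have K j : g x (riesz x l) (delta_mx 0 j) = l (delta_mx 0 j).
  by have := gram_row gr idl (riesz x l) j; rewrite {1}/riesz mulmxKV // mxE => <-.
rewrite (@linear_row_sum _ _ R^o (g x (riesz x l)) w (gl _)).
rewrite [RHS](@linear_row_sum _ _ R^o l w ll).
by apply: eq_bigr => j _; rewrite K.
Qed.

(** In the chart of [x] the components of [Z] solve a linear system whose matrix is the Gram matrix
    of the coordinate fields, smooth and invertible. This serves for the connection, whose
    smoothness is visible only in its pairings. *)
Lemma smooth_metric_dual x (Z : vector_field M) :
  (forall u, smooth_function_at x (fun z => g z (Z z) (coord_field x u z))) ->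
  smooth_field_at x Z.
Proof.
move=> sZ; have xx := chart_dom_self hM x; have sg := metric_smooth.
pose A (y : E) := gram (g (chart_inv x y)) (fun u => coord_field x u (chart_inv x y)).
pose b (y : E) : E := \row_j g (chart_inv x y) (Z (chart_inv x y))
    (coord_field x (delta_mx 0 j) (chart_inv x y)).
have lin y : chart_dom x (chart_inv x y) ->
    linear (fun u => coord_field x u (chart_inv x y)).
  by move=> xy; apply: (transfer_linear hM) => //; exact: chart_dom_self.
have inj y u : chart_dom x (chart_inv x y) ->
    coord_field x u (chart_inv x y) = 0 -> u = 0.
  move=> xy e0; have yy := chart_dom_self hM (chart_inv x y).
  rewrite -(transfer_id hM u xy) -(transfer_trans hM u xy yy xy).
  by rewrite -/(coord_field x u (chart_inv x y)) e0 (lin0 (transfer_linear hM yy xy)).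
have U y : chart_dom x (chart_inv x y) -> A y \in unitmx.
  move=> xy; apply: (gram_unit (bilin_l sg _) (bilin_r sg _) (@metric_pos _) (lin y xy)).
  by move=> u; exact: inj.
have sA i k : germ_smooth (chart x x) (fun y => A y i k : R^o).
  have sC u := smooth_field_coord hM u xx.
  have H := smooth_app_bilin hM sg (sC (delta_mx 0 i)) (sC (delta_mx 0 k)).
  by apply: near_eq_smooth H; near=> y; rewrite mxE.
have sb : germ_smooth (chart x x) b.
  apply: germ_smooth_rV => i; apply: near_eq_smooth (sZ (delta_mx 0 i)).
  by near=> y; rewrite mxE.
have U0 : A (chart x x) \in unitmx by apply: U; rewrite (chartK hM xx).
apply: near_eq_smooth (germ_smooth_solve U0 sA sb).
apply: filterS (near_chart_invK hM xx) => y [xy Ey].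
have FZ := field_coord hM Z xy; rewrite Ey in FZ.
suff -> : b y = field_in x Z y *m A y by rewrite mulmxK // U.
apply/rowP => j; rewrite (gram_row (bilin_r sg _) (lin y xy)) FZ mxE.
by [].
Unshelve. all: by end_near. Qed.

End Riesz.

(** * The Hermitian connection with skew torsion *)

(** [a] to [d] are derivatives of [J], and [p] to [s] are derivatives of the two fields; the latter
    cancel because [j] squares to [-1]. *)
Lemma nijenhuis_algebra (R : realType) n (j : 'rV[R]_n -> 'rV[R]_n)
  (a b c d p q r s : 'rV[R]_n) : linear j -> (forall u, j (j u) = - u) ->
  a + j p - (b + j q) - j (p - (c + j r)) - j (d + j s - q) - (s - r) =
  a - b + j c - j d.
Proof.
move=> jl jj; rewrite !(linB jl) !(linD jl) !jj.
by apply/rowP => k; rewrite !mxE; ring.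
Qed.

Lemma nijenhuisE (R : realType) n (M : charted_space R n) (J : endo_field M)
  (X Y : vector_field M) (x : M) : smooth_manifold M -> smooth_endo J ->
  (forall x u, J x (J x u) = - u) -> smooth_field_at x X -> smooth_field_at x Y ->
  nijenhuis J X Y x = dendo x J (J x (X x)) (Y x) - dendo x J (J x (Y x)) (X x)
    + J x (dendo x J (Y x) (X x)) - J x (dendo x J (X x) (Y x)).
Proof.
move=> hM sJ JJ sX sY; rewrite /nijenhuis !lie_bracketE.
rewrite !(dfield_app_endo hM sJ) // /app_endo.
by apply: nijenhuis_algebra (JJ x); case: sJ.
Qed.

Section KoszulAlgebra.
Context {R : realType} {V : lmodType R} (G : V -> V -> R).
Context (Gl : forall u, scalar (G u)) (Gr : forall v, scalar (G ^~ v)).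
Context (Gs : forall u v, G u v = G v u).

(** In contrast with [d2_algebra], the term [2 * G XY Z] survives: it is the coordinate derivative
    of [Y] along [X], the part of a connection that is not tensorial in [Y]. *)
Lemma koszul_algebra (X Y Z XY YX XZ ZX YZ ZY : V) (a b c t : R) :
  2 * G XY Z + (a + b - c + t) =
  (a + G XY Z + G Y XZ) + (b + G YX Z + G X YZ) - (c + G ZX Y + G X ZY)
  + G (XY - YX) Z - G (XZ - ZX) Y - G (YZ - ZY) X + t.
Proof.
rewrite (linB (Gr Z)) (linB (Gr Y)) (linB (Gr X)).
rewrite (Gs Y XZ) (Gs X YZ) (Gs X ZY).
ring.
Qed.

End KoszulAlgebra.

Lemma two_mul_inj (R : realType) (a b : R) : 2 * a = 2 * b -> a = b.
Proof. by move=> H; lra. Qed.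

Section HermitianManifold.
Context {R : realType} {n : nat} {M : charted_space R n}.
Context {g : bilin_field M} {J : endo_field M} (hH : Defs.hermitian g J).
Local Notation E := 'rV[R]_n.
Implicit Types (x : M) (u v w : E) (X Y Z : vector_field M).

Let hM : smooth_manifold M. Proof. by case: hH. Qed.
Let hg : riemannian_metric g. Proof. by case: hH. Qed.
Let sg : smooth_bilin g. Proof. by case: hg. Qed.
Let sJ : smooth_endo J. Proof. by case: hH. Qed.
Let gs x u v : g x u v = g x v u. Proof. exact: (metric_sym hg). Qed.
Let JJ x u : J x (J x u) = - u.
Proof. by case: hH => _ _ _ /(_ x u u)[]. Qed.
Let gJJ x u v : g x (J x u) (J x v) = g x u v.
Proof. by case: hH => _ _ _ /(_ x u v)[]. Qed.
Let Jl x : linear (J x). Proof. by case: sJ. Qed.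
Let gl x u : scalar (g x u). Proof. exact: bilin_l. Qed.
Let gr x v : scalar (g x ^~ v). Proof. exact: bilin_r. Qed.
Let gNr x u v : g x u (- v) = - g x u v. Proof. exact: (linN (gl x u)). Qed.
Let gJs x u v : g x (J x u) v = - g x u (J x v).
Proof. by rewrite -(gJJ x u) JJ gNr opprK. Qed.
Let sC x u := smooth_field_coord hM u (chart_dom_self hM x).
Let C0 x u := coord_field_self hM x u.

Definition fundamental_form : bilin_field M := fun x u v => g x (J x u) v.
Local Notation om := fundamental_form.

Lemma fundamental_form_alt x u v : om x u v = - om x v u.
Proof. by rewrite /om gs -(gJJ x v) JJ gNr. Qed.

Lemma smooth_fundamental_form : smooth_bilin om.
Proof.
apply: (smooth_bilin_intro hM) => [x u|x X Y sX sY].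
  split=> [a v w|a v w]; rewrite /om; first exact: (gl x (J x u) a v w).
  by rewrite Jl; exact: (gr x u a (J x v) (J x w)).
exact: (smooth_app_bilin hM sg (smooth_app_endo hM sJ sX) sY).
Qed.

Definition torsion_at x u v w := dform om x (J x u) (J x v) (J x w).

Lemma kt_formE X Y Z x : smooth_field_at x X -> smooth_field_at x Y ->
  smooth_field_at x Z -> kt_form g J X Y Z x = torsion_at x (X x) (Y x) (Z x).
Proof.
move=> sX sY sZ; apply: (d2E hM smooth_fundamental_form fundamental_form_alt).
- exact: (smooth_app_endo hM sJ sX).
- exact: (smooth_app_endo hM sJ sY).
- exact: (smooth_app_endo hM sJ sZ).
Qed.

Lemma smooth_kt_form X Y Z x : smooth_field_at x X -> smooth_field_at x Y ->
  smooth_field_at x Z -> smooth_function_at x (kt_form g J X Y Z).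
Proof.
move=> sX sY sZ; apply: (smooth_d2 hM smooth_fundamental_form).
- exact: (smooth_app_endo hM sJ sX).
- exact: (smooth_app_endo hM sJ sY).
- exact: (smooth_app_endo hM sJ sZ).
Qed.

Lemma dbilin_fundamental x w u v :
  dbilin x om w u v = dbilin x g w (J x u) v + g x (dendo x J w u) v.
Proof.
rewrite dbilinE.
have := dfun_app_bilin hM sg w (smooth_app_endo hM sJ (sC x u)) (sC x v).
rewrite (dfield_coord hM) (lin0 (gl x _)) addr0 -dendoE /app_endo !C0.
exact.
Qed.

Lemma dendo_J x w u : dendo x J w (J x u) = - J x (dendo x J w u).
Proof.
have := dfield_app_endo hM sJ w (smooth_app_endo hM sJ (sC x u)).
rewrite -dendoE /app_endo C0 => H.
apply/eqP; rewrite -addr_eq0 -H; apply/eqP.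
have -> : (fun x0 => J x0 (J x0 (coord_field x u x0))) =
    (fun z => - coord_field x u z) by apply/funext => z; exact: JJ.
by rewrite (dfield_opp hM _ (sC x u)) (dfield_coord hM) oppr0.
Qed.

Lemma dbilin_sym x w u v : dbilin x g w u v = dbilin x g w v u.
Proof.
by rewrite !dbilinE; congr (dfun x _ w); apply/funext => z; exact: gs.
Qed.

Lemma dbilin_JJ x w u v :
  dbilin x g w (J x u) (J x v) + g x (dendo x J w u) (J x v)
  + g x (J x u) (dendo x J w v) = dbilin x g w u v.
Proof.
have := dfun_app_bilin hM sg w (smooth_app_endo hM sJ (sC x u))
  (smooth_app_endo hM sJ (sC x v)).
have VJ a : app_endo J (coord_field x a) x = J x a by rewrite /app_endo C0.
rewrite -!dendoE !VJ => H; apply: (etrans (esym H)).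
by rewrite dbilinE; congr (dfun x _ w); apply/funext => z; exact: gJJ.
Qed.

(* The Levi-Civita connection shifted by half of the torsion form, read in the
   preferred chart of each point. *)
Definition kt_koszul x u v w : R :=
  dbilin x g u v w + dbilin x g v u w - dbilin x g w u v + torsion_at x u v w.

Definition kt_connection X Y : vector_field M := fun x =>
  dfield x Y (X x) + 2^-1 *: riesz g x (kt_koszul x (X x) (Y x)).

Let DG1 x u v : scalar (fun w => dbilin x g w u v).
Proof. exact: dbilin_linear. Qed.
Let DGl x w v : scalar (dbilin x g w ^~ v).
Proof. exact: dbilin_linear_l. Qed.
Let DGr x w u : scalar (dbilin x g w u).
Proof. exact: dbilin_linear_r. Qed.

Lemma torsion_at_linear1 x v w : scalar (fun u => torsion_at x u v w).
Proof.
by move=> a u u'; rewrite /torsion_at Jl; exact: (dform_linear1 hM smooth_fundamental_form).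
Qed.

Lemma torsion_at_linear2 x u w : scalar (fun v => torsion_at x u v w).
Proof.
by move=> a v v'; rewrite /torsion_at Jl; exact: (dform_linear2 hM smooth_fundamental_form).
Qed.

Lemma torsion_at_linear3 x u v : scalar (fun w => torsion_at x u v w).
Proof.
by move=> a w w'; rewrite /torsion_at Jl; exact: (dform_linear3 hM smooth_fundamental_form).
Qed.

Lemma torsion_at_swap12 x u v w : torsion_at x u v w = - torsion_at x v u w.
Proof.
rewrite /torsion_at /dform.
rewrite (dbilin_alt hM smooth_fundamental_form _ (J x w) (J x v) (J x u) fundamental_form_alt).
by gen_dbilin; ring.
Qed.

Lemma torsion_at_swap23 x u v w : torsion_at x u v w = - torsion_at x u w v.
Proof.
rewrite /torsion_at /dform.
rewrite (dbilin_alt hM smooth_fundamental_form _ (J x u) (J x w) (J x v) fundamental_form_alt).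
by gen_dbilin; ring.
Qed.

Ltac gen_atoms := repeat match goal with
  | |- context [dbilin ?b ?x ?u ?v ?w] => generalize (dbilin b x u v w); intro
  | |- context [torsion_at ?x ?u ?v ?w] => generalize (torsion_at x u v w); intro
  | |- context [kt_koszul ?x ?u ?v ?w] => generalize (kt_koszul x u v w); intro
  | |- context [g ?x ?u ?v] => generalize (g x u v); intro
  end.

Lemma kt_koszul_linear1 x v w : scalar (fun u => kt_koszul x u v w).
Proof.
move=> a u u'; rewrite /kt_koszul DG1 !DGl torsion_at_linear1.
by gen_atoms; ring.
Qed.

Lemma kt_koszul_linear2 x u w : scalar (fun v => kt_koszul x u v w).
Proof.
move=> a v v'; rewrite /kt_koszul DG1 DGl DGr torsion_at_linear2.
by gen_atoms; ring.
Qed.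

Lemma kt_koszul_linear3 x u v : scalar (kt_koszul x u v).
Proof.
move=> a w w'; rewrite /kt_koszul !DGr DG1 torsion_at_linear3.
by gen_atoms; ring.
Qed.

Lemma kt_connectionE X Y x w :
  2 * g x (kt_connection X Y x) w =
  2 * g x (dfield x Y (X x)) w + kt_koszul x (X x) (Y x) w.
Proof.
have H := @rieszP _ _ _ g hg x _ w (kt_koszul_linear3 x (X x) (Y x)).
rewrite /kt_connection (linD (gr x w)) (scalarZ _ _ (gr x w)) H.
by gen_atoms; field.
Qed.

Opaque kt_connection.

(** The definition of [kt_connection] reads each point in its own chart, so it says nothing about
    how the result varies. Every term on the right is chart-free and a smooth function, and
    smoothness of the connection comes from here. *)
Lemma kt_connection_koszul X Y Z x : smooth_field_at x X -> smooth_field_at x Y ->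
  smooth_field_at x Z ->
  2 * g x (kt_connection X Y x) (Z x) =
  lie_deriv X (app_bilin g Y Z) x + lie_deriv Y (app_bilin g X Z) x
  - lie_deriv Z (app_bilin g X Y) x + app_bilin g (lie_bracket X Y) Z x
  - app_bilin g (lie_bracket X Z) Y x - app_bilin g (lie_bracket Y Z) X x
  + kt_form g J X Y Z x.
Proof.
move=> sX sY sZ; rewrite kt_connectionE kt_formE // !lie_derivE.
rewrite (dfun_app_bilin hM sg _ sY sZ) (dfun_app_bilin hM sg _ sX sZ).
rewrite (dfun_app_bilin hM sg _ sX sY) /app_bilin !lie_bracketE.
exact: (koszul_algebra (gr x) (gs x)).
Qed.

Lemma smooth_kt_connection X Y : smooth_field X -> smooth_field Y ->
  smooth_field (kt_connection X Y).
Proof.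
move=> /(smooth_fieldP hM) sX /(smooth_fieldP hM) sY; apply/(smooth_fieldP hM) => x.
apply: (smooth_metric_dual hM hg) => u; set C := coord_field x u.
have sXx := sX x; have sYx := sY x; have sCx : smooth_field_at x C by exact: sC.
have sb U W := @smooth_app_bilin _ _ _ hM g sg x U W.
have sl U U' W (a : smooth_field_at x U) b c :=
  smooth_lie_deriv hM a (sb U' W b c).
have H1 := smooth_function_add (sl _ _ _ sXx sYx sCx) (sl _ _ _ sYx sXx sCx).
have H2 := smooth_function_sub H1 (sl _ _ _ sCx sXx sYx).
have H3 := smooth_function_add H2 (sb _ _ (smooth_lie_bracket hM sXx sYx) sCx).
have H4 := smooth_function_sub H3 (sb _ _ (smooth_lie_bracket hM sXx sCx) sYx).
have H5 := smooth_function_sub H4 (sb _ _ (smooth_lie_bracket hM sYx sCx) sXx).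
have H6 := smooth_function_add H5 (smooth_kt_form sXx sYx sCx).
have H7 := smooth_function_mul (smooth_function_cst x 2^-1) H6.
apply: (near_eq_smooth_function hM _ H7).
(* The field [C] is smooth on the domain of the chart of [x], so the Koszul formula is applied at
   each [z] in that domain. *)
apply: filterS (chart_dom_near hM (chart_dom_self hM x)) => z xz.
have sCz : smooth_field_at z C by exact: smooth_field_coord.
rewrite -(kt_connection_koszul (sX z) (sY z) sCz) mulrA mulVf ?mul1r //.
Qed.

(** The torsion contributions cancel by skewness in the last two slots, and the symmetric part of
    the Koszul expression is the derivative of [g]. *)
Lemma kt_connection_metric X Y Z x : smooth_field_at x Y -> smooth_field_at x Z ->
  lie_deriv X (app_bilin g Y Z) x =
  g x (kt_connection X Y x) (Z x) + g x (Y x) (kt_connection X Z x).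
Proof.
move=> sY sZ; rewrite lie_derivE (dfun_app_bilin hM sg _ sY sZ).
rewrite (gs x (Y x) (kt_connection X Z x)) (gs x (Y x) (dfield x Z (X x))).
have H1 := kt_connectionE X Y x (Z x); have H2 := kt_connectionE X Z x (Y x).
move: H1 H2; rewrite /kt_koszul (torsion_at_swap23 x (X x) (Z x) (Y x)).
rewrite (dbilin_sym x (X x) (Z x) (Y x)).
by gen_atoms; move=> *; lra.
Qed.

Lemma kt_connection_torsion X Y x w :
  g x (kt_connection X Y x - kt_connection Y X x - lie_bracket X Y x) w =
  torsion_at x (X x) (Y x) w.
Proof.
rewrite lie_bracketE !(linB (gr x w)).
have H1 := kt_connectionE X Y x w; have H2 := kt_connectionE Y X x w.
move: H1 H2; rewrite /kt_koszul (torsion_at_swap12 x (Y x) (X x) w).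
rewrite (dbilin_sym x w (Y x) (X x)).
by gen_atoms; move=> *; lra.
Qed.

(** Paired with a field [Z], the defect loses the derivative of [Y] because [J] is skew for [g];
    what remains is the combination of [nijenhuis_hermitian]. *)
Lemma kt_connection_J X Y : smooth_field X -> smooth_field Y ->
  forall x, kt_connection X (app_endo J Y) x = J x (kt_connection X Y x).
Proof.
move=> sX sY.
have gX := (smooth_fieldP hM X).1 sX; have gY := (smooth_fieldP hM Y).1 sY.
have sJY : smooth_field (app_endo J Y).
  by apply/(smooth_fieldP hM) => x; exact: smooth_app_endo.
have key Z x : smooth_field Z ->
    g x (kt_connection X (app_endo J Y) x - J x (kt_connection X Y x)) (Z x) = 0.
  move=> sZ.
  have N U : smooth_field U ->
      dendo x J (J x (X x)) (U x) - dendo x J (J x (U x)) (X x)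
      + J x (dendo x J (U x) (X x)) - J x (dendo x J (X x) (U x)) = 0.
    move=> sU; have gU := (smooth_fieldP hM U).1 sU.
    rewrite -(nijenhuisE hM sJ JJ (gX x) (gU x)).
    by case: hH => _ _ _ _; apply.
  have := nijenhuis_hermitian (gl x) (gr x) (Jl x) (gJJ x) (JJ x) (gs x)
    (DGr x) (DGl x) (DG1 x) (dendo_linear hM sJ x) (dendo_linear_r hM sJ x)
    (dendo_J x) (dbilin_JJ x) (N Y sY) (N Z sZ).
  have -> : g x (kt_connection X (app_endo J Y) x - J x (kt_connection X Y x)) (Z x)
    = g x (kt_connection X (app_endo J Y) x) (Z x)
      + g x (kt_connection X Y x) (J x (Z x)).
    by rewrite (linB (gr x (Z x))) gJs opprK.
  have H1 := kt_connectionE X (app_endo J Y) x (Z x).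
  have H2 := kt_connectionE X Y x (J x (Z x)).
  have H3 : g x (dfield x (app_endo J Y) (X x)) (Z x) =
      g x (dendo x J (X x) (Y x)) (Z x) - g x (dfield x Y (X x)) (J x (Z x)).
    by rewrite (dfield_app_endo hM sJ _ (gY x)) (linD (gr x (Z x))) gJs.
  rewrite {}H3 in H1.
  rewrite /kt_koszul /torsion_at /dform !dbilin_fundamental in H1.
  rewrite /kt_koszul /torsion_at /dform !dbilin_fundamental in H2.
  rewrite /app_endo -/(app_endo J Y) in H1.
  move: H1 H2.
  by gen_atoms; move=> *; lra.
(* The defect is itself a global smooth field, hence an admissible test field; positivity of the
   metric then makes it vanish. *)
move=> x; pose Z : vector_field M :=
  fun z => kt_connection X (app_endo J Y) z - J z (kt_connection X Y z).
have sZ : smooth_field Z.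
  apply/(smooth_fieldP hM) => z; apply: (smooth_field_sub hM).
    exact: ((smooth_fieldP hM _).1 (smooth_kt_connection sX sJY)).
  apply: (smooth_app_endo hM sJ).
  exact: ((smooth_fieldP hM _).1 (smooth_kt_connection sX sY)).
apply/subr0_eq/eqP/negPn/negP => /(metric_pos hg x).
by rewrite (key Z x sZ) ltxx.
Qed.

Lemma kt_connection_is_connection : connection kt_connection.
Proof.
have gD (p q w : E) x : g x (p + q) w = g x p w + g x q w by exact: (linD (gr x w)).
have gZ a (p w : E) x : g x (a *: p) w = a * g x p w by exact: (scalarZ _ _ (gr x w)).
have ext x (p q : E) : (forall w, g x p w = g x q w) -> p = q.
  exact: (@metric_inj _ _ _ g hg x).
split.
- exact: smooth_kt_connection.
- move=> X X' Y sX _ /(smooth_fieldP hM) sY x; apply: (ext x) => w.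
  have K1 := kt_connectionE (X \+ X') Y x w.
  have K2 := kt_connectionE X Y x w; have K3 := kt_connectionE X' Y x w.
  have K4 : kt_koszul x ((X \+ X') x) (Y x) w =
      kt_koszul x (X x) (Y x) w + kt_koszul x (X' x) (Y x) w.
    exact: (linD (kt_koszul_linear1 x (Y x) w)).
  have K5 : g x (dfield x Y ((X \+ X') x)) w =
      g x (dfield x Y (X x)) w + g x (dfield x Y (X' x)) w.
    exact: etrans (f_equal (fun t => g x t w) (linD (dfield_linear (sY x)) _ _)) (gD _ _ _ _).
  apply: (etrans _ (esym (gD _ _ _ _))).
  move: K1 K2 K3 K4 K5; gen_atoms; move=> *; lra.
- move=> X Y Y' _ /(smooth_fieldP hM) sY /(smooth_fieldP hM) sY' x; apply: (ext x) => w.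
  have K1 := kt_connectionE X (Y \+ Y') x w.
  have K2 := kt_connectionE X Y x w; have K3 := kt_connectionE X Y' x w.
  have K4 : kt_koszul x (X x) ((Y \+ Y') x) w =
      kt_koszul x (X x) (Y x) w + kt_koszul x (X x) (Y' x) w.
    exact: (linD (kt_koszul_linear2 x (X x) w)).
  have K5 : g x (dfield x (Y \+ Y') (X x)) w =
      g x (dfield x Y (X x)) w + g x (dfield x Y' (X x)) w.
    exact: etrans (f_equal (fun t => g x t w) (dfield_add hM _ (sY x) (sY' x))) (gD _ _ _ _).
  apply: (etrans _ (esym (gD _ _ _ _))).
  move: K1 K2 K3 K4 K5; gen_atoms; move=> *; lra.
- move=> f X Y _ sX /(smooth_fieldP hM) sY x; apply: (ext x) => w.
  have K1 := kt_connectionE (scale_field f X) Y x w.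
  have K2 := kt_connectionE X Y x w.
  have K4 : kt_koszul x (scale_field f X x) (Y x) w = f x * kt_koszul x (X x) (Y x) w.
    exact: (scalarZ _ _ (kt_koszul_linear1 x (Y x) w)).
  have K5 : g x (dfield x Y (scale_field f X x)) w = f x * g x (dfield x Y (X x)) w.
    exact: etrans (f_equal (fun t => g x t w) (linZ (dfield_linear (sY x)) _ _)) (gZ _ _ _ _).
  apply: (etrans _ (esym (gZ _ _ _ _))).
  apply: (two_mul_inj (etrans K1 _)); rewrite K4 K5.
  by rewrite [RHS]mulrCA K2; gen_atoms; generalize (f x) => fx; ring.
- move=> f X Y /(smooth_functionP hM) sf _ /(smooth_fieldP hM) sY x; apply: (ext x) => w.
  have K1 := kt_connectionE X (scale_field f Y) x w.
  have K2 := kt_connectionE X Y x w.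
  have K4 : kt_koszul x (X x) (scale_field f Y x) w = f x * kt_koszul x (X x) (Y x) w.
    exact: (scalarZ _ _ (kt_koszul_linear2 x (X x) w)).
  have K5 : g x (dfield x (scale_field f Y) (X x)) w =
      dfun x f (X x) * g x (Y x) w + f x * g x (dfield x Y (X x)) w.
    apply: (etrans (f_equal (fun t => g x t w) (dfield_scale hM (X x) (sf x) (sY x)))).
    apply: (etrans (gD _ _ _ _)).
    exact: (f_equal2 (fun p q => p + q) (gZ _ _ _ _) (gZ _ _ _ _)).
  apply: (etrans _ (esym (gD _ _ _ _))).
  apply: (etrans _ (esym (f_equal2 (fun p q => p + q) (gZ _ _ _ _) (gZ _ _ _ _)))).
  apply: (two_mul_inj (etrans K1 _)); rewrite K4 K5 lie_derivE.
  rewrite [RHS]mulrDr [X in _ = X + _]mulrCA K2.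
  by gen_atoms; generalize (f x) (dfun x f (X x)) => fx dfx; ring.
Qed.

Lemma kt_connection_hermitian : hermitian_connection g J kt_connection.
Proof.
split; first exact: kt_connection_is_connection.
- move=> X Y Z sX /(smooth_fieldP hM) sY /(smooth_fieldP hM) sZ x.
  exact: kt_connection_metric (sY x) (sZ x).
- by move=> X Y sX sY x; exact: kt_connection_J.
Qed.

Lemma kt_connection_skew : skew_torsion g kt_connection.
Proof.
move=> X Y Z sX sY sZ x.
have T U V W : torsion_form g kt_connection U V W x = torsion_at x (U x) (V x) (W x).
  exact: kt_connection_torsion.
rewrite (T X Y Z) (T Y X Z) (T X Z Y); split.
  exact: torsion_at_swap12.
exact: torsion_at_swap23.
Qed.

(* The difference E(X,Y,Z) = g(D'_X Y - D_X Y, Z) is totally skew, and J can be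
   moved between its slots with a sign; moving it around the three slots gives
   E(X,JY,Z) = 0. *)
Lemma hermitian_connection_unique
    (D D' : vector_field M -> vector_field M -> vector_field M) X Y :
  hermitian_connection g J D -> skew_torsion g D ->
  hermitian_connection g J D' -> skew_torsion g D' ->
  smooth_field X -> smooth_field Y -> D' X Y = D X Y.
Proof.
move=> [[sD _ _ _ _] mD jD] tD [[sD' _ _ _ _] mD' jD'] tD' sX sY.
have sA U : smooth_field U -> smooth_field (app_endo J U).
  move=> /(smooth_fieldP hM) sU; apply/(smooth_fieldP hM) => x.
  exact: smooth_app_endo.
pose e U V W x := g x (D' U V x - D U V x) (W x).
have eE U V W x : e U V W x = g x (D' U V x) (W x) - g x (D U V x) (W x).
  exact: (linB (gr x (W x))).
have tE D1 U V W x : torsion_form g D1 U V W x = g x (D1 U V x) (W x)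
    - g x (D1 V U x) (W x) - g x (lie_bracket U V x) (W x).
  by rewrite /torsion_form; move: (D1 U V x) (D1 V U x) (lie_bracket U V x) => p q r;
    rewrite !(linB (gr x (W x))).
have e23 U V W x : smooth_field U -> smooth_field V -> smooth_field W ->
    e U V W x = - e U W V x.
  move=> sU sV sW; rewrite !eE.
  have := mD U V W sU sV sW x; rewrite (mD' U V W sU sV sW x) /app_bilin.
  rewrite (gs x (V x) (D U W x)) (gs x (V x) (D' U W x)).
  by gen_atoms; move=> *; lra.
have ecyc U V W x : smooth_field U -> smooth_field V -> smooth_field W ->
    e U V W x = e V W U x.
  move=> sU sV sW.
  have H1 := (tD W U V sW sU sV x).2; have H2 := (tD' W U V sW sU sV x).2.
  have H3 := e23 W U V x sW sU sV; have H4 := e23 U W V x sU sW sV.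
  move: H1 H2 H3 H4; rewrite !eE !tE.
  by gen_atoms; move=> *; lra.
have eJ U V W x : smooth_field U -> smooth_field V ->
    e U (app_endo J V) W x = - e U V (app_endo J W) x.
  by move=> sU sV; rewrite /e jD // jD' // -(linB (Jl x)) gJs.
have e0 U V W x : smooth_field U -> smooth_field V -> smooth_field W ->
    e U (app_endo J V) W x = 0.
  move=> sU sV sW.
  have sJU := sA U sU; have sJV := sA V sV; have sJW := sA W sW.
  have H1 := eJ U V W x sU sV.
  have H2 := ecyc U V _ x sU sV sJW.
  have H3 := eJ V W U x sV sW.
  have H4 := ecyc V W _ x sV sW sJU.
  have H5 := eJ W U V x sW sU.
  have H6 := ecyc W U _ x sW sU sJV.
  by move: H1 H2 H3 H4 H5 H6; move: (e) => e'; move=> *; lra.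
apply/funext => x.
have sZ : smooth_field (fun z => D' X Y z - D X Y z).
  apply/(smooth_fieldP hM) => z; apply: (smooth_field_sub hM).
    exact: ((smooth_fieldP hM _).1 (sD' _ _ sX sY)).
  exact: ((smooth_fieldP hM _).1 (sD _ _ sX sY)).
(* With [Z] the difference of the two connections, [e0] is applied to [J (J Y)]; moving both factors
   [J] onto [Z] gives [e X Y Z x = 0], the squared length of the difference. *)
have := e0 X (app_endo J Y) _ x sX (sA _ sY) sZ.
rewrite (eJ X (app_endo J Y) _ x sX (sA _ sY)).
have := eJ X Y (app_endo J (fun z => D' X Y z - D X Y z)) x sX sY.
move=> -> /eqP; rewrite opprK /e /app_endo JJ gNr oppr_eq0 => /eqP E0.
apply/subr0_eq/eqP/negPn/negP => /(metric_pos hg x).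
by rewrite E0 ltxx.
Qed.

Theorem hermitian_is_KT : is_KT g J.
Proof.
split; first exact: hH.
exists kt_connection; split.
- exact: kt_connection_hermitian.
- exact: kt_connection_skew.
- move=> D' hD' tD' X Y sX sY.
  exact: (hermitian_connection_unique kt_connection_hermitian kt_connection_skew
    hD' tD' sX sY).
- move=> X Y Z /(smooth_fieldP hM) sX /(smooth_fieldP hM) sY /(smooth_fieldP hM) sZ x.
  by rewrite kt_formE //; exact: kt_connection_torsion.
Qed.

End HermitianManifold.

(** * The cone *)

(* The name [radius] of Defs is shadowed by the analysis library. *)
Notation rad := Defs.radius.

(** * Separation and countability of products, subspaces and the real line *)

Section SecondCountable.

Lemma hausdorff_injective (S T : topologicalType) (f : S -> T) :
  continuous f -> injective f -> hausdorff_space T -> hausdorff_space S.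
Proof.
move=> cf fi hT x y cxy; apply/fi/hT => A B /cf Ax /cf By.
have [z [Az Bz]] := cxy _ _ Ax By.
by exists (f z).
Qed.

Lemma hausdorff_pair (S T : topologicalType) :
  hausdorff_space S -> hausdorff_space T -> hausdorff_space (S * T)%type.
Proof.
move=> hS hT [a b] [a' b'] cab; congr pair.
- apply: hS => A B Aa Ba'.
  have [[s t] [/= As Bs]] := cab _ _ (cvg_fst Aa) (cvg_fst Ba').
  by exists s.
- apply: hT => A B Aa Ba'.
  have [[s t] [/= As Bs]] := cab _ _ (cvg_snd Aa) (cvg_snd Ba').
  by exists t.
Qed.

Lemma second_countable_pair (S T : topologicalType) :
  @second_countable S -> @second_countable T -> @second_countable (S * T)%type.
Proof.
move=> [BS cS [oS nS]] [BT cT [oT nT]].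
exists ((fun p : set S * set T => p.1 `*` p.2) @` (BS `*` BT)).
  by apply: sub_countable (card_image_le _ _) _; exact: countableX.
split=> [_ [[A C] /= [BA BC] <-]|[a b] U].
  rewrite openE => -[s t] [/= As Ct]; exists (A, C) => //=.
  by split; apply: open_nbhs_nbhs; split => //; [exact: oS|exact: oT].
move=> [[P Q] /= [Pa Qb] sub].
have [A [BA Aa] sA] := nS a _ Pa; have [C [BC Cb] sC] := nT b _ Qb.
exists (A `*` C); first by split => //; exists (A, C).
by move=> [s t] [/= As Ct]; apply: sub; split => /=; [exact: sA|exact: sC].
Qed.

Lemma set_type_nbhs (X : topologicalType) (A : set X) (x : A) (U : set A) :
  nbhs x U <-> exists2 W : set X, open W /\ W (\val x) & forall y : A, W (\val y) -> U y.
Proof.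
split=> [[V [[W oW <-] Wx] sub]|[W [oW Wx] sub]].
  by exists W => // y Wy; exact: sub.
by rewrite nbhsE; exists (set_val @^-1` W) => //; split => //; exists W.
Qed.

Lemma second_countable_set_type (X : topologicalType) (A : set X) :
  @second_countable X -> @second_countable A.
Proof.
move=> [B cB [oB nB]]; exists ((fun V => (set_val : A -> X) @^-1` V) @` B).
  by apply: sub_countable (card_image_le _ _) cB.
split=> [_ [V BV <-]|x U /set_type_nbhs [W [oW Wx] sub]].
  by exists V => //; exact: oB.
have [V [BV Vx] sV] := nB (\val x) W (open_nbhs_nbhs (conj oW Wx)).
exists ((set_val : A -> X) @^-1` V); first by split => //; exists V.
by move=> y Vy; apply/sub/sV.
Qed.

Lemma second_countable_real (R : realType) : @second_countable R.
Proof.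
exists ((fun p : rat * nat => ball (ratr p.1 : R) (p.2.+1%:R^-1)) @` setT).
  by apply: sub_countable (card_image_le _ _) _.
split=> [_ [p _ <-]|x U /nbhs_ballP [e /= e0 eU]]; first exact: ball_open.
have e2 : 0 < e / 2 by rewrite divr_gt0.
(* A rational [q] with [x < q < x + 1/(k+1)] is the centre of a basic ball that contains [x]; its
   radius is below [e / 2], so the ball lies within distance [e] of [x]. *)
have [k ke] := ltr_add_invr e2; rewrite add0r in ke.
have k0 : 0 < k.+1%:R^-1 :> R by rewrite invr_gt0.
have xk : x < x + k.+1%:R^-1 by rewrite ltrDl.
have [q] := rat_in_itvoo xk; rewrite in_itv /= => /andP[xq qx].
have xqk : `|x - ratr q| < k.+1%:R^-1 :> R 
  by rewrite ltr_distlC qx andbT; apply: lt_trans xq; rewrite ltrBlDr.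
exists (ball (ratr q : R) k.+1%:R^-1).
  by split; [exists (q, k)|rewrite -ball_normE /= distrC].
move=> y; rewrite -ball_normE /= => qy; apply: eU; rewrite -ball_normE /=.
rewrite (_ : x - y = (x - ratr q) + (ratr q - y)); last by rewrite addrA subrK.
apply: le_lt_trans (ler_normD _ _) _; rewrite [e]splitr.
by apply: ltrD; [exact: lt_trans xqk ke|exact: lt_trans qy ke].
Qed.

End SecondCountable.

Section ConeVectors.
Context {R : realType} {n : nat}.
Local Notation E := 'rV[R]_n.
Local Notation F := 'rV[R]_(1 + n).

(** The inverse of the splitting into [dr] and [dpr]. It is used both for tangent vectors of the
    cone and for chart values, whose first coordinate is the radius. *)
Definition cvec (a : R) (v : E) : F := row_mx a%:M v.

Lemma dr_cvec a v : dr (cvec a v) = a.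
Proof. by rewrite /dr /cvec row_mxKl mxE eqxx mulr1n. Qed.

Lemma dpr_cvec a v : dpr (cvec a v) = v.
Proof. exact: row_mxKr. Qed.

Lemma cvecK w : cvec (dr w) (dpr w) = w.
Proof. by rewrite /cvec /dr -mx11_scalar hsubmxK. Qed.

Lemma dr_linear : linear (@dr R n : F -> R^o).
Proof. by move=> a u v; rewrite /dr !mxE. Qed.

Lemma dpr_linear : linear (@dpr R n).
Proof. by move=> a u v; apply/rowP => i; rewrite /dpr !mxE. Qed.

Lemma cvec_linear a b v c w : cvec (a * b + c) (a *: v + w) = a *: cvec b v + cvec c w.
Proof.
rewrite /cvec scale_row_mx add_row_mx; congr row_mx.
by rewrite scale_scalar_mx raddfD.
Qed.

Lemma cvecD a v b w : cvec a v + cvec b w = cvec (a + b) (v + w).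
Proof. by have := cvec_linear 1 a v b w; rewrite mul1r !scale1r. Qed.

Lemma cvecZ c a v : c *: cvec a v = cvec (c * a) (c *: v).
Proof.
have := cvec_linear c a v 0 0; rewrite !addr0 => ->.
rewrite [X in _ + X](_ : _ = 0) ?addr0 //.
by have := cvec_linear (-1) 0 0 0 0; rewrite mulr0 scaler0 !addr0 scaleN1r addNr.
Qed.

Lemma cvec0 : cvec 0 0 = 0.
Proof. by have := cvecZ 0 0 0; rewrite scale0r mul0r scaler0. Qed.

Lemma cvecB a v b w : cvec a v - cvec b w = cvec (a - b) (v - w).
Proof. by rewrite -scaleN1r cvecZ mulN1r scaleN1r cvecD. Qed.

Lemma cvec_emb_linear : linear (cvec 0 : E -> F).
Proof. by move=> a v w; rewrite -cvec_linear mulr0 addr0. Qed.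

Lemma cvecE a v : cvec a v = a *: cvec 1 0 + cvec 0 v.
Proof. by rewrite cvecZ cvecD mulr1 scaler0 addr0 add0r. Qed.

End ConeVectors.

(** * The cone as a smooth manifold *)

Section ConeManifold.
Context {R : realType} {n : nat} {N : charted_space R n}.
Context (hN : smooth_manifold N).
Local Notation C := (cone N).
Local Notation E := 'rV[R]_n.
Local Notation F := 'rV[R]_(1 + n).

Lemma radius_gt0 (x : C) : 0 < rad x.
Proof. by case: x => [[r r0] q]; have := set_mem r0. Qed.

Lemma val_insub_pos (u : @pos_reals R) (s : R) : 0 < s -> \val (insubd u s) = s.
Proof. by move=> s0; apply: insubdK; exact: mem_set. Qed.

Lemma cone_chartE (p x : C) : chart p x = cvec (rad x) (chart p.2 x.2).
Proof. by []. Qed.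

Lemma cone_chart_invE (p : C) y :
  chart_inv p y = (insubd p.1 (dr y), chart_inv p.2 (dpr y)) :> C.
Proof. by []. Qed.

Lemma cone_chart_img (p : C) (y : F) :
  chart_img p y <-> 0 < dr y /\ chart_img p.2 (dpr y).
Proof.
split=> [[x px <-]|[y0 [q pq qy]]].
  rewrite cone_chartE dr_cvec dpr_cvec; split; first exact: radius_gt0.
  by exists x.2.
exists (insubd p.1 (dr y), q) => //=.
have := cone_chartE p (insubd p.1 (dr y), q); rewrite /rad /= val_insub_pos // qy => ->.
exact: cvecK.
Qed.

Lemma dr_continuous : continuous (@dr R n : F -> R^o).
Proof. exact: linear_rV_continuous dr_linear. Qed.

Lemma dpr_continuous : continuous (@dpr R n).
Proof. exact: linear_rV_continuous dpr_linear. Qed.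

Lemma near_dr_pos (y : F) : 0 < dr y -> \forall z \near y, 0 < dr z.
Proof.
move=> y0; apply: (@dr_continuous y [set t : R^o | 0 < t]).
by apply: open_nbhs_nbhs; split => //; exact: open_gt.
Qed.

Lemma cone_chartK (p : C) : {in chart_dom p, cancel (chart p) (chart_inv p)}.
Proof.
move=> x /set_mem px; rewrite cone_chart_invE cone_chartE dr_cvec dpr_cvec chartK //.
by case: x px => r q px; congr pair; exact: valKd.
Qed.

(** Transition maps fix the radial coordinate. Where this coordinate is not positive [insubd]
    returns its default [p.1], so the formula belongs to the half-space [dr y > 0], which is
    open. *)
Lemma cone_trans (p q : C) (y : F) : 0 < dr y ->
  (chart q \o chart_inv p) y = dr y *: cvec 1 0 + cvec 0 (transition p.2 q.2 (dpr y)).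
Proof.
move=> y0; rewrite /comp cone_chart_invE cone_chartE /rad /= val_insub_pos //.
by rewrite -cvecE.
Qed.

Lemma cone_trans_smooth (p q x : C) : chart_dom p x -> chart_dom q x ->
  germ_smooth (chart p x) (chart q \o chart_inv p).
Proof.
move=> px qx.
have H1 : germ_smooth (chart p x) (fun y : F => dr y : R^o).
  apply: (@germ_smooth_linear_rV _ _ _ _ (@dr R n : F -> R^o) id) dr_linear _.
  exact: germ_smooth_id.
have H2 : germ_smooth (chart p x) (@dpr R n : F -> E).
  apply: (@germ_smooth_linear_rV _ _ _ _ (@dpr R n) id) dpr_linear _.
  exact: germ_smooth_id.
have H3 : germ_smooth (chart p x) (transition p.2 q.2 \o (@dpr R n)).
  apply: germ_smooth_comp H2 _; rewrite cone_chartE dpr_cvec.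
  exact: transition_smooth.
have H4 := germ_smooth_linear_rV cvec_emb_linear H3.
have H5 := germ_smooth_add (germ_smooth_scale H1 (germ_smooth_cst (cvec 1 0) _)) H4.
apply: near_eq_smooth H5.
have y0 : 0 < dr (chart p x) by rewrite cone_chartE dr_cvec radius_gt0.
by apply: filterS (near_dr_pos y0) => y yy0; rewrite cone_trans.
Qed.

Lemma cone_smooth_manifold : smooth_manifold C.
Proof.
have [hN1 hN2 _ _ _] := hN.
have vc : continuous (set_val : @pos_reals R -> R) by exact: initial_continuous.
have rc : continuous (fun z : C => rad z).
  move=> z; apply: (@continuous_comp _ _ _ (fst : C -> @pos_reals R) set_val z).
    exact: cvg_fst.
  exact: vc.
split.
- apply: hausdorff_pair hN1.
  exact: (@hausdorff_injective _ _ (set_val : @pos_reals R -> R) vc val_inj (@Rhausdorff R)).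
- apply: second_countable_pair hN2.
  exact/second_countable_set_type/second_countable_real.
- move=> p; split; first exact: (chart_dom_self hN).
    have := @open_comp _ _ (snd : @pos_reals R * N -> N) (chart_dom p.2).
    apply; last exact: (chart_dom_open hN).
    by move=> x _; exact: cvg_snd.
  have -> : chart_img p = ((@dr R n : F -> R^o) @^-1` [set t : R^o | 0 < t])
      `&` (@dpr R n @^-1` chart_img p.2).
    by apply/seteqP; split=> y; rewrite cone_chart_img.
  apply: openI.
    by apply: open_comp; [move=> y _; exact: dr_continuous|exact: open_gt].
  by apply: open_comp; [move=> y _; exact: dpr_continuous|exact: (chart_img_open hN)].
- move=> p; split; first exact: cone_chartK.
    rewrite continuous_open_subspace; last first.
      have := @open_comp _ _ (snd : @pos_reals R * N -> N) (chart_dom p.2).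
      apply; last exact: (chart_dom_open hN).
      by move=> x _; exact: cvg_snd.
    move=> x /set_mem px; rewrite /prop_for /continuous_at.
    have -> : (chart p : C -> F) = (fun x => rad x *: cvec 1 0 + cvec 0 (chart p.2 x.2)).
      by apply/funext => z; rewrite cone_chartE cvecE.
    apply: cvgD.
      apply: (@cvgZr_tmp R F _ _ _ (fun z : C => rad z)).
      exact: rc.
    apply: (@cvg_comp _ _ _ (fun z : C => chart p.2 z.2) (cvec 0)); last first.
      exact: linear_rV_continuous cvec_emb_linear _.
    apply: (@cvg_comp _ _ _ (snd : C -> N) (chart p.2)); first exact: cvg_snd.
    exact: (chart_continuous hN).
  rewrite continuous_open_subspace; last first.
    have -> : chart_img p = ((@dr R n : F -> R^o) @^-1` [set t : R^o | 0 < t])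
        `&` (@dpr R n @^-1` chart_img p.2).
      by apply/seteqP; split=> y; rewrite cone_chart_img.
    apply: openI.
      by apply: open_comp; [move=> y _; exact: dr_continuous|exact: open_gt].
    by apply: open_comp; [move=> y _; exact: dpr_continuous|exact: (chart_img_open hN)].
  move=> _ /set_mem [x px <-]; rewrite /prop_for /continuous_at.
  have y0 : 0 < dr (chart p x) by rewrite cone_chartE dr_cvec radius_gt0.
  pose ins (y : F) : set_type (@pos_reals R) := insubd p.1 (dr y).
  have c1 : ins @ chart p x --> ins (chart p x).
    move=> U /set_type_nbhs [W [oW Wx] sub].
    have : \forall y \near chart p x, W (dr y).
      apply: (@dr_continuous (chart p x) W); apply: open_nbhs_nbhs; split => //.
      by move: Wx; rewrite /= val_insub_pos.
    apply: filterS2 (near_dr_pos y0) => y y1 Wy.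
    by apply: sub; rewrite /= val_insub_pos.
  have c2 : (fun y : F => chart_inv p.2 (dpr y)) @ chart p x -->
      chart_inv p.2 (dpr (chart p x)).
    apply: (@cvg_comp _ _ _ (@dpr R n) (chart_inv p.2)); first exact: dpr_continuous.
    have -> : dpr (chart p x) = chart p.2 x.2 by rewrite cone_chartE dpr_cvec.
    rewrite (chartK hN px).
    exact: (chart_inv_continuous hN).
  exact: (cvg_pair c1 c2).
- move=> p q vs _ [x [px qx] <-].
  exact: nbhs_singleton (cone_trans_smooth px qx vs).
Qed.

End ConeManifold.

(** * Derivatives of lifts, of pullbacks and of the radius *)

Section ConeCalculus.
Context {R : realType} {n : nat} {N : charted_space R n}.
Context (hN : smooth_manifold N).
Local Notation C := (cone N).
Local Notation E := 'rV[R]_n.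
Local Notation F := 'rV[R]_(1 + n).
Let hC : smooth_manifold C := cone_smooth_manifold hN.
Implicit Types (x p : C) (w : F) (V : vector_field N) (X : vector_field C).

Let dr_smooth (y : F) : germ_smooth y (fun y : F => dr y : R^o).
Proof.
apply: (@germ_smooth_linear_rV _ _ _ _ (@dr R n : F -> R^o) id) dr_linear _.
exact: germ_smooth_id.
Qed.

Let dpr_smooth (y : F) : germ_smooth y (@dpr R n : F -> E).
Proof.
apply: (@germ_smooth_linear_rV _ _ _ _ (@dpr R n) id) dpr_linear _.
exact: germ_smooth_id.
Qed.

Let D_dpr (y w : F) : 'D_w (@dpr R n : F -> E) y = dpr w.
Proof. exact: derive_linear dpr_linear (@dpr_continuous R n). Qed.

Let D_dr (y w : F) : 'D_w (@dr R n : F -> R^o) y = dr w.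
Proof. exact: derive_linear dr_linear (@dr_continuous R n). Qed.

Let cone_pos x : 0 < dr (chart x x).
Proof. by rewrite cone_chartE dr_cvec radius_gt0. Qed.

Let D_emb (f : E -> E) (y w : F) : differentiable f (dpr y) ->
  differentiable (fun y : F => cvec 0 (f (dpr y))) y /\
  'D_w (fun y : F => cvec 0 (f (dpr y))) y = cvec 0 ('D_(dpr w) f (dpr y)).
Proof.
move=> df; have dd := germ_smooth_at (dpr_smooth y).
have dfd := differentiable_comp dd df.
have lc := linear_rV_continuous (@cvec_emb_linear R n).
split.
  apply: (@differentiable_comp _ _ _ _ (f \o @dpr R n) (cvec 0)) => //.
  exact: (linear_differentiable_at _ (@cvec_emb_linear R n) lc).
have := derive_linear_comp w (@cvec_emb_linear R n) lc dfd.
by rewrite (derive_comp w dd df) D_dpr.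
Qed.

Lemma cone_transfer p (q : C) x w : chart_dom p x -> chart_dom q x ->
  transfer p q x w = cvec (dr w) (transfer p.2 q.2 x.2 (dpr w)).
Proof.
move=> px qx.
have y0 : 0 < dr (chart p x) by rewrite cone_chartE dr_cvec radius_gt0.
have nT : \forall y \near chart p x,
    dr y *: cvec 1 0 + cvec 0 (transition p.2 q.2 (dpr y)) = (chart q \o chart_inv p) y.
  by apply: filterS (near_dr_pos y0) => y yy0; rewrite cone_trans.
have dt : differentiable (transition p.2 q.2) (dpr (chart p x)).
  by rewrite cone_chartE dpr_cvec; exact/germ_smooth_at/transition_smooth.
have [d1 D1] := D_emb w dt.
have Ll : linear (fun y : F => (dr y : R) *: (cvec 1 0 : F)).
  by move=> a u v; rewrite dr_linear scalerDl -scalerA.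
have Lc := linear_rV_continuous Ll.
rewrite /transfer -(near_eq_derive w nT).
apply: (etrans (derive_add w (linear_differentiable_at _ Ll Lc) d1)).
apply: (etrans (f_equal2 (fun a b => a + b) (derive_linear _ _ Ll Lc) D1)).
by rewrite -cvecE cone_chartE dpr_cvec.
Qed.

Lemma cone_coord p u x : chart_dom p x ->
  coord_field p u x = cvec (dr u) (coord_field p.2 (dpr u) x.2).
Proof. by move=> px; apply: cone_transfer => //; exact: (chart_dom_self hC). Qed.

Let near_field_in x X : \forall y \near chart x x,
  field_in x X y = let x' := chart_inv x y : C in
    cvec (dr (X x')) (transfer x'.2 x.2 x'.2 (dpr (X x'))).
Proof.
apply: filterS (near_chart_invK hC (chart_dom_self hC x)) => y [xy _].
by apply: cone_transfer => //; exact: (chart_dom_self hC).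
Qed.

Definition lift V : vector_field C := fun x => cvec 0 (V x.2).

Definition dradius : vector_field C := fun=> cvec 1 0.

Let near_lift x V : \forall y \near chart x x,
  cvec 0 (field_in x.2 V (dpr y)) = field_in x (lift V) y.
Proof.
by apply: filterS (near_field_in x (lift V)) => y ->; rewrite /lift dr_cvec dpr_cvec.
Qed.

Let near_dradius x : \forall y \near chart x x, cvec 1 0 = field_in x dradius y.
Proof.
apply: filterS2 (near_field_in x dradius) (near_chart_invK hC (chart_dom_self hC x)).
move=> y -> [xy _]; rewrite /dradius dr_cvec dpr_cvec /=.
by rewrite (lin0 (transfer_linear hN _ _)) //; exact: (chart_dom_self hN).
Qed.

Lemma smooth_lift x V : smooth_field_at x.2 V -> smooth_field_at x (lift V).
Proof.
move=> sV; apply: near_eq_smooth (near_lift x V) _.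
apply: (germ_smooth_linear_rV (@cvec_emb_linear R n)).
apply: (@germ_smooth_comp _ _ _ _ (@dpr R n) (field_in x.2 V)) => //.
by rewrite cone_chartE dpr_cvec.
Qed.

Lemma dfield_lift x V w : smooth_field_at x.2 V ->
  dfield x (lift V) w = cvec 0 (dfield x.2 V (dpr w)).
Proof.
move=> sV; have dV : differentiable (field_in x.2 V) (dpr (chart x x)).
  by rewrite cone_chartE dpr_cvec; exact: germ_smooth_at.
have [_ D] := D_emb w dV; rewrite {2}cone_chartE dpr_cvec in D.
exact: etrans (esym (near_eq_derive w (near_lift x V))) D.
Qed.

Lemma smooth_dradius x : smooth_field_at x dradius.
Proof. by apply: near_eq_smooth (near_dradius x) _; exact: germ_smooth_cst. Qed.

Lemma dfield_dradius x w : dfield x dradius w = 0.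
Proof.
by apply: (etrans (esym (near_eq_derive w (near_dradius x)))); exact: derive_cst.
Qed.

Lemma smooth_function_base x (f : N -> R) : smooth_function_at x.2 f ->
  smooth_function_at x (fun z : C => f z.2).
Proof.
move=> sf.
apply: (@germ_smooth_comp _ _ _ R^o (@dpr R n) (f \o chart_inv x.2)) => //.
by rewrite cone_chartE dpr_cvec.
Qed.

Lemma dfun_base x (f : N -> R) w : smooth_function_at x.2 f ->
  dfun x (fun z : C => f z.2) w = dfun x.2 f (dpr w).
Proof.
move=> sf; have dd := germ_smooth_at (dpr_smooth (chart x x)).
have df : differentiable (f \o chart_inv x.2 : E -> R^o) (dpr (chart x x)).
  by rewrite cone_chartE dpr_cvec; exact: germ_smooth_at.
have := derive_comp w dd df; rewrite D_dpr {2}cone_chartE dpr_cvec.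
exact.
Qed.

Let near_radius x : \forall y \near chart x x, dr y = rad (chart_inv x y : C).
Proof.
by apply: filterS (near_dr_pos (cone_pos x)) => y y0; rewrite /rad /= val_insub_pos.
Qed.

Lemma smooth_radius x : smooth_function_at x (fun z : C => rad z).
Proof. by apply: near_eq_smooth (near_radius x) _; exact: dr_smooth. Qed.

Lemma dfun_radius x w : dfun x (fun z : C => rad z) w = dr w.
Proof.
have H := @near_eq_derive _ _ R^o (fun y : F => dr y)
  (fun y : F => rad (chart_inv x y : C)) (chart x x) w (near_radius x).
exact: etrans (esym H) (D_dr (chart x x) w).
Qed.

(** The projection to [N] of [X] along the copy of [N] at radius [r]. It shows that the
    [N]-component of a global field on the cone is the value of a global field on [N]. *)
Definition slice X (r : @pos_reals R) : vector_field N := fun q : N => dpr (X (r, q)).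

Lemma smooth_slice X (r : @pos_reals R) (q : N) :
  smooth_field_at ((r, q) : C) X -> smooth_field_at q (slice X r).
Proof.
move=> sX; pose x : C := (r, q).
pose k (z : E) : F := cvec (\val r) z.
have kq : k (chart q q) = chart x x by [].
have sk : germ_smooth (chart q q) k.
  have H := germ_smooth_linear_rV (@cvec_emb_linear R n) (germ_smooth_id (chart q q)).
  have H' := germ_smooth_add (germ_smooth_cst (\val r *: cvec 1 0 : F) (chart q q)) H.
  by apply: near_eq_smooth H'; near=> z; rewrite /k [RHS]cvecE.
have H : germ_smooth (chart q q) ((@dpr R n \o field_in x X) \o k).
  apply: germ_smooth_comp sk _; rewrite kq.
  exact: germ_smooth_linear_rV dpr_linear sX.
apply: near_eq_smooth H.
have := differentiable_continuous (germ_smooth_at sk).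
rewrite /prop_for /continuous_at kq => ck.
have cks : \forall z \near chart q q,
    field_in x X (k z) = let x' := chart_inv x (k z) : C in
    cvec (dr (X x')) (transfer x'.2 x.2 x'.2 (dpr (X x'))).
  exact: (ck (fun y => field_in x X y = let x' := chart_inv x y : C in
    cvec (dr (X x')) (transfer x'.2 x.2 x'.2 (dpr (X x')))) (near_field_in x X)).
apply: filterS cks => z Ez.
have xz : chart_inv x (k z) = (r, chart_inv q z) :> C.
  by rewrite cone_chart_invE /k dr_cvec dpr_cvec; congr pair; exact: valKd.
by rewrite /comp Ez xz dpr_cvec.
Unshelve. all: by end_near. Qed.

End ConeCalculus.

(** * Almost contact metric structures *)

(* G, xi, phi are the structure at one point; P, Q, DG stand for the derivatives
   of phi, xi, G in the preferred chart, and the equations between them are the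
   derivatives of phi xi = 0, phi (phi v) = - v + eta v xi and eta xi = 1. *)
Section NormalPoint.
Context {R : realType} {n : nat}.
Local Notation E := 'rV[R]_n.
Context (G : E -> E -> R) (xi : E) (phi : E -> E).
Context (P : E -> E -> E) (Q : E -> E) (DG : E -> E -> E -> R).
Context (Gl : forall u, scalar (G u)) (Gr : forall v, scalar (G ^~ v)).
Context (Gs : forall u v, G u v = G v u) (xi1 : G xi xi = 1).
Context (phil : linear phi) (phixi : phi xi = 0).
Context (phi2 : forall v, phi (phi v) = - v + G xi v *: xi).
Context (Gphi : forall v w, G (phi v) (phi w) = G v w - G xi v * G xi w).
Context (P1 : forall v, linear (P ^~ v)) (P2 : forall u, linear (P u)) (Ql : linear Q).
Context (DG1 : forall u v, scalar (fun w => DG w u v)).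
Context (DGr : forall w u, scalar (DG w u)) (DGs : forall w u v, DG w u v = DG w v u).

(** The componentwise derivative of the 1-form [eta] along [u], evaluated at [v]. It is not yet the
    exterior derivative: [d eta] is its antisymmetrisation [A u v - A v u]. *)
Definition d_eta_at u v := DG u xi v + G (Q u) v.
Local Notation A := d_eta_at.
Local Notation eta := (G xi).

Context (dphixi : forall u, P u xi + phi (Q u) = 0).
Context (dphi2 : forall u v, P u (phi v) + phi (P u v) = A u v *: xi + eta v *: Q u).
Context (dxi1 : forall u, A u xi + eta (Q u) = 0).

(* The normality tensor, after the derivatives of the two fields have cancelled. *)
Definition normality_at u v := P (phi u) v - P (phi v) u + phi (P v u) - phi (P u v)
  + (A u v - A v u) *: xi.

(** Computing the cube of [phi] in two ways gives [eta (phi v) *: xi = 0], and [xi] is not zero. *)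
Lemma eta_phi v : eta (phi v) = 0.
Proof.
have e1 := phi2 (phi v); rewrite (phi2 v) (linD phil) (linN phil) (linZ phil) phixi in e1.
rewrite scaler0 addr0 in e1.
have /eqP : eta (phi v) *: xi = 0 by apply: (addrI (- phi v)); rewrite -e1 addr0.
rewrite scaler_eq0 => /orP[/eqP //|/eqP x0].
by have := xi1; rewrite x0 (lin0 (Gr _)) => /esym/eqP; rewrite oner_eq0.
Qed.

Lemma phi_skew v w : G (phi v) w = - G v (phi w).
Proof.
have := Gphi v (phi w); rewrite phi2 eta_phi mulr0 subr0.
rewrite (linD (Gl _)) (linN (Gl _)) (scalarZ _ _ (Gl _)) (Gs _ xi) eta_phi mulr0 addr0.
by move=> <-; rewrite opprK.
Qed.

Lemma A_linear1 v : scalar (A ^~ v).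
Proof. by move=> a u u'; rewrite /A DG1 Ql Gr; ring. Qed.

Lemma A_linear2 u : scalar (A u).
Proof. by move=> a v v'; rewrite /A DGr Gl; ring. Qed.

(* Derivative of eta (phi v) = 0. *)
Lemma A_phi u v : A u (phi v) + eta (P u v) = 0.
Proof.
have := f_equal eta (dphi2 u (phi v)).
rewrite phi2 (linD (P2 u)) (linN (P2 u)) (linZ (P2 u)) eta_phi scale0r addr0.
rewrite (linD (Gl xi)) eta_phi (linD (Gl xi)) (linN (Gl xi)) !(scalarZ _ _ (Gl xi)) xi1.
have := f_equal eta (dphixi u); rewrite (linD (Gl xi)) eta_phi (lin0 (Gl xi)).
move: (eta (P u v)) (eta (P u xi)) (eta v) (A u (phi v)) => a b c d; rewrite addr0 => ->.
by lra.
Qed.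

Section Admissible.
Context (ad : E -> Prop) (adphi : forall v, ad v -> ad (phi v)) (adxi : ad xi).
Context (normal : forall u v, ad u -> ad v -> normality_at u v = 0).

(** This is [i_xi d eta = 0]. In the normality tensor at [(xi, w)] every term but the last lies in
    the image of [phi], on which [eta] vanishes. The predicate [ad] will be instantiated with the
    values of global fields. *)
Lemma deta_xi w : ad w -> A xi w = A w xi.
Proof.
move=> aw; have := f_equal eta (normal adxi aw).
rewrite /normality_at phixi (lin0 (P1 _)) sub0r.
have e1 : P (phi w) xi = - phi (Q (phi w)).
  by apply/eqP; rewrite -addr_eq0 dphixi.
rewrite e1 opprK (linD (Gl xi)) !(linB (Gl xi)) !(linD (Gl xi)) !eta_phi.
rewrite (scalarZ _ _ (Gl xi)) xi1 (lin0 (Gl xi)).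
by move: (A xi w) (A w xi) => a b; lra.
Qed.

(** The left-hand side is [(L_xi phi) w]. Normality at [(xi, w)] says that [phi] kills it, once
    [i_xi d eta = 0] is known; [eta] kills it by differentiating [eta (phi w) = 0]. A vector killed
    by both is zero since [phi] squares to [- 1 + eta xi]. *)
Lemma lie_xi_phi w : ad w -> P xi w - Q (phi w) + phi (Q w) = 0.
Proof.
move=> aw; set Z := (X in X = 0).
have Z0 : phi Z = 0.
  have := normal adxi aw; rewrite /normality_at phixi (lin0 (P1 _)) sub0r.
  have e1 : P (phi w) xi = - phi (Q (phi w)).
    by apply/eqP; rewrite -addr_eq0 dphixi.
  have e2 : P w xi = - phi (Q w) by apply/eqP; rewrite -addr_eq0 dphixi.
  rewrite e1 e2 deta_xi // subrr scale0r addr0 opprK (linN phil) => e3.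
  rewrite /Z (linD phil) (linB phil); apply: oppr_inj; rewrite oppr0 -e3.
  by apply/rowP => k; rewrite !mxE; ring.
have etaZ : eta Z = 0.
  rewrite /Z (linD (Gl xi)) (linB (Gl xi)) eta_phi.
  have e4 := A_phi xi w; have e5 := dxi1 (phi w); have e6 := deta_xi (adphi aw).
  by move: e4 e5 e6; move: (eta (P xi w)) (eta (Q (phi w))) (A xi (phi w)) (A (phi w) xi);
    move=> a b c d *; lra.
have := phi2 Z; rewrite Z0 (lin0 phil) etaZ scale0r addr0 => /esym/eqP.
by rewrite oppr_eq0 => /eqP.
Qed.

(** The [eta]-component of normality says that [d eta] is invariant under [phi] in both slots at
    once. Applied to [phi v] and [w], with [i_xi d eta = 0] removing the [xi] term of the square of
    [phi], it gives the claim. *)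
Lemma deta_phi v w : ad v -> ad w -> A (phi v) w - A w (phi v) = - (A v (phi w) - A (phi w) v).
Proof.
have inv u u' : ad u -> ad u' -> A u u' - A u' u = A (phi u) (phi u') - A (phi u') (phi u).
  move=> au au'; have := f_equal eta (normal au au').
  rewrite /normality_at !(linD (Gl xi), linN (Gl xi), eta_phi).
  rewrite (scalarZ _ _ (Gl xi)) xi1 (lin0 (Gl xi)).
  have e1 := A_phi (phi u) u'; have e2 := A_phi (phi u') u.
  move: e1 e2; move: (A _ _) (A _ _) (A _ _) (A _ _) (eta _) (eta _) => a b c d e f.
  by move=> *; lra.
move=> av aw; rewrite (inv (phi v) w (adphi av) aw) phi2.
rewrite (linD (A_linear1 _)) (linD (A_linear2 _)) (linN (A_linear1 _)) (linN (A_linear2 _)).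
rewrite (scalarZ _ _ (A_linear1 _)) (scalarZ _ _ (A_linear2 _)) (deta_xi (adphi aw)).
by move: (A _ _) (A _ _) (A _ _) (eta _) => a b c d; ring.
Qed.

End Admissible.

End NormalPoint.

Lemma scalar_app (R : realType) (V : lmodType R) (f : V -> R) u v :
  scalar f -> f (u + v) = f u + f v.
Proof. by move=> hf; exact: (linD hf). Qed.

Lemma dr_scalar (R : realType) n : scalar (@dr R n).
Proof. exact: dr_linear. Qed.

(** * Metric and almost complex structure of the cone *)

Section AlmostContactCone.
Context {R : realType} {n : nat} {N : charted_space R n}.
Context {g : bilin_field N} {xi : vector_field N} {phi : endo_field N}.
Context (hacm : almost_contact_metric g xi phi).
Local Notation C := (cone N).
Local Notation E := 'rV[R]_n.
Local Notation F := 'rV[R]_(1 + n).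
Local Notation J := (cone_J g xi phi).
Local Notation gC := (cone_metric g).
Implicit Types (q : N) (x : C) (v w : E) (V W : vector_field N).

Let hN : smooth_manifold N. Proof. by case: hacm. Qed.
Let hC : smooth_manifold C. Proof. exact: cone_smooth_manifold. Qed.
Let hg : riemannian_metric g. Proof. by case: hacm => _ _ []. Qed.
Let sg : smooth_bilin g. Proof. by case: hg. Qed.
Let sxi q : smooth_field_at q xi.
Proof. by case: hacm => _ _ [_ /(smooth_fieldP hN) H _] _ _; exact: H. Qed.
Let sphi : smooth_endo phi. Proof. by case: hacm => _ _ []. Qed.
Let gl q u : scalar (g q u). Proof. exact: bilin_l. Qed.
Let gr q v : scalar (g q ^~ v). Proof. exact: bilin_r. Qed.
Let gs q u v : g q u v = g q v u. Proof. exact: (metric_sym hg). Qed.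
Let phil q : linear (phi q). Proof. by case: sphi. Qed.
Let xi1 q : g q (xi q) (xi q) = 1. Proof. by case: hacm => _ _ _ []. Qed.
Let phixi q : phi q (xi q) = 0. Proof. by case: hacm => _ _ _ []. Qed.
Let phi2 q v : phi q (phi q v) = - v + g q (xi q) v *: xi q.
Proof. by case: hacm => _ _ _ _ /(_ q v v)[]. Qed.
Let gphi q v w : g q (phi q v) (phi q w) = g q v w - g q (xi q) v * g q (xi q) w.
Proof. by case: hacm => _ _ _ _ /(_ q v w)[]. Qed.
Let etaphi q v : g q (xi q) (phi q v) = 0.
Proof. exact: (eta_phi (gr q) (xi1 q) (phil q) (phixi q) (phi2 q)). Qed.

Lemma cone_metric_linear x (u : F) : scalar (gC x u) /\ scalar (gC x ^~ u).
Proof.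
split=> a v w; rewrite /cone_metric dr_scalar dpr_linear.
  rewrite (gl (base x) (dpr u) a (dpr v) (dpr w)).
  by move: (g _ _ _) (g _ _ _) => s t; ring.
rewrite (gr (base x) (dpr u) a (dpr v) (dpr w)).
by move: (g _ _ _) (g _ _ _) => s t; ring.
Qed.

Lemma cone_metric_cvec x (a b : R) v w :
  gC x (cvec a v) (cvec b w) = a * b + rad x ^+ 2 * g x.2 v w.
Proof. by rewrite /cone_metric !dr_cvec !dpr_cvec. Qed.

Lemma cone_riemannian : riemannian_metric gC.
Proof.
split.
- split=> [x u|p u v]; first exact: cone_metric_linear.
  apply: germ_smooth_on => _ [x px <-].
  apply: (smooth_function_atP hC _ px).1.
  have sC (w : F) : smooth_field_at x.2 (coord_field p.2 (dpr w)).
    exact: smooth_field_coord.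
  have H1 := smooth_function_base (smooth_app_bilin hN sg (sC u) (sC v)).
  have sr := smooth_radius x.
  have H2 := smooth_function_add (smooth_function_cst x (dr u * dr v))
    (smooth_function_mul (smooth_function_mul sr sr) H1).
  apply: (near_eq_smooth_function hC _ H2).
  apply: filterS (chart_dom_near hC px) => z pz.
  apply: (etrans _ (esym (f_equal2 (gC z) (cone_coord hN u pz) (cone_coord hN v pz)))).
  apply: (etrans _ (esym (cone_metric_cvec _ _ _ _ _))).
  exact: (f_equal (fun s => dr u * dr v + s * app_bilin g (coord_field p.2 (dpr u))
    (coord_field p.2 (dpr v)) z.2) (esym (expr2 (rad z)))).
- by move=> x u v; rewrite /cone_metric gs mulrC.
- move=> x w w0; rewrite /cone_metric.
  have r2 : 0 < rad x ^+ 2 by rewrite exprn_gt0 // radius_gt0.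
  have [d0|d0] := eqVneq (dpr w) 0.
    rewrite d0 (lin0 (gl _ _)) mulr0 addr0 -expr2 exprn_even_gt0 //=.
    by apply: contra w0 => /eqP r0; rewrite -(cvecK w) r0 d0 cvec0.
  have := metric_pos hg x.2 d0; rewrite -/(base x) => gp.
  by apply: ltr_wpDl; [rewrite -expr2 sqr_ge0|rewrite mulr_gt0].
Qed.

Definition cone_J_at x (u : F) : F :=
  cvec (- (rad x * g x.2 (xi x.2) (dpr u)))
       (((rad x)^-1 * dr u) *: xi x.2 + phi x.2 (dpr u)).

(** The explicit vector satisfies the defining equation, and non-degeneracy of the cone metric makes
    the value chosen by [xget] unique. *)
Lemma cone_JE x u : J x u = cone_J_at x u.
Proof.
have r0 : rad x != 0 by rewrite gt_eqF // radius_gt0.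
have key (w : F) : gC x (cone_J_at x u) w = cone_form g xi phi x u w.
  rewrite /cone_metric /cone_form /cone_J_at dr_cvec dpr_cvec /Defs.eta /fund_form /base.
  rewrite (scalar_app _ _ (gr _ _)) (scalarZ _ _ (gr _ _)).
  move: (g _ _ _) (g _ _ _) (g _ _ _) => a b c; field.
  exact: r0.
rewrite /cone_J; apply: xget_unique => // y Hy.
by apply: (@metric_inj _ _ _ gC cone_riemannian x) => w; rewrite Hy key.
Qed.

Lemma cone_JJ x u : J x (J x u) = - u.
Proof.
have r0 : rad x != 0 by rewrite gt_eqF // radius_gt0.
rewrite !cone_JE /cone_J_at !dr_cvec !dpr_cvec.
rewrite (linD (phil _)) (linZ (phil _)) phixi scaler0 add0r phi2.
rewrite (scalar_app _ _ (gl _ _)) (scalarZ _ _ (gl _ _)) xi1 etaphi mulr1 addr0.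
have -> : - u = cvec (- dr u) (- dpr u).
  by rewrite -{1}(cvecK u) -scaleN1r cvecZ mulN1r scaleN1r.
apply: (f_equal2 (@cvec R n)).
  by rewrite mulrA mulfV // mul1r.
rewrite mulrN mulrA mulVf // mul1r scaleNr addrCA addNr addr0.
by [].
Qed.

Lemma cone_gJJ x (u w : F) : gC x (J x u) (J x w) = gC x u w.
Proof.
have r0 : rad x != 0 by rewrite gt_eqF // radius_gt0.
rewrite !cone_JE /cone_J_at /cone_metric !dr_cvec !dpr_cvec /base.
rewrite !(scalar_app _ _ (gr _ _)) !(scalar_app _ _ (gl _ _)).
rewrite !(scalarZ _ _ (gr _ _)) !(scalarZ _ _ (gl _ _)).
rewrite etaphi (gs _ (phi _ _) (xi _)) etaphi xi1 gphi.
move: (g _ _ _) (g _ _ _) (g _ _ _) => a b c; field.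
exact: r0.
Qed.

Lemma cone_J_linear x : linear (J x).
Proof.
move=> a u v; rewrite !cone_JE /cone_J_at dr_scalar dpr_linear.
rewrite (gl x.2 (xi x.2) a (dpr u) (dpr v)) (phil x.2) -cvec_linear.
apply: (f_equal2 (@cvec R n)).
  by move: (g _ _ _) (g _ _ _) => s t; ring.
by apply/rowP => k; rewrite !mxE; ring.
Qed.

(* Componentwise derivatives at q of phi, xi and eta: see dfun_eta for the last. *)
Local Notation Pq q := (dendo q phi).
Local Notation Qq q := (dfield q xi).
Local Notation A q := (d_eta_at (g q) (xi q) (Qq q) (dbilin q g)).

Lemma dfun_eta q V w : smooth_field_at q V ->
  dfun q (app_bilin g xi V) w = A q w (V q) + g q (xi q) (dfield q V w).
Proof. by move=> sV; exact: (dfun_app_bilin hN sg w (sxi q) sV). Qed.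

Lemma d_etaE q X Y : smooth_field_at q X -> smooth_field_at q Y ->
  d_eta g xi X Y q = A q (X q) (Y q) - A q (Y q) (X q).
Proof.
move=> sX sY; rewrite /d_eta /d1 !lie_derivE lie_bracketE /Defs.eta.
have e V w : smooth_field_at q V -> dfun q (fun z : N => g z (xi z) (V z)) w =
    A q w (V q) + g q (xi q) (dfield q V w) by move=> sV; exact: (dfun_eta w sV).
rewrite (e Y (X q) sY) (e X (Y q) sX) (linB (gl q (xi q))).
have alg (a b c d : R) : a + c - (b + d) - (c - d) = a - b by ring.
exact: alg.
Qed.

(** Coordinate fields of the cone have a constant radial part and an [N]-part pulled back from [N].
    On fields of this shape [J] is a combination of [dradius], [lift xi] and the lift of [phi V]
    with smooth coefficients, to which the product rule applies; both smoothness and the derivative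
    of [J] follow. *)
Lemma smooth_J_adapted x (a : R) V : smooth_field_at x.2 V ->
  smooth_field_at x (fun z : C => J z (cvec a (V z.2))) /\
  forall w : F, dfield x (fun z : C => J z (cvec a (V z.2))) w =
    cvec (- (dr w * g x.2 (xi x.2) (V x.2)
             + rad x * (A x.2 (dpr w) (V x.2) + g x.2 (xi x.2) (dfield x.2 V (dpr w)))))
      ((- ((rad x)^-1 * (rad x)^-1) * dr w * a) *: xi x.2
       + ((rad x)^-1 * a) *: Qq x.2 (dpr w)
       + (Pq x.2 (dpr w) (V x.2) + phi x.2 (dfield x.2 V (dpr w)))).
Proof.
move=> sV; have r0 : rad x != 0 by rewrite gt_eqF // radius_gt0.
have sr := smooth_radius x.
have seta := smooth_function_base (smooth_app_bilin hN sg (sxi x.2) sV).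
have s1 := smooth_function_opp (smooth_function_mul sr seta).
have s2 := smooth_function_mul (smooth_function_inv hC r0 sr) (smooth_function_cst x a).
have sphiV := smooth_app_endo hN sphi sV.
have f1 := smooth_field_scale hC s1 (smooth_dradius hN x).
have f2 := smooth_field_scale hC s2 (smooth_lift hN (sxi x.2)).
have f3 := smooth_lift hN sphiV.
have f12 := smooth_field_add hC f1 f2; have f123 := smooth_field_add hC f12 f3.
have EJ : (fun z : C => J z (cvec a (V z.2))) = (fun z : C =>
   - (rad z * app_bilin g xi V z.2) *: dradius z
   + ((rad z)^-1 * a) *: lift xi z + lift (app_endo phi V) z).
  apply/funext => z; rewrite cone_JE /cone_J_at dr_cvec dpr_cvec /dradius /lift.
  by rewrite !cvecZ !cvecD !mulr0 !addr0 mulr1 scaler0 add0r.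
split; first by rewrite EJ.
move=> w; rewrite EJ (dfield_add hC w f12 f3) (dfield_add hC w f1 f2).
rewrite (dfield_scale hC w s1 (smooth_dradius hN x)).
rewrite (dfield_scale hC w s2 (smooth_lift hN (sxi x.2))).
rewrite (dfield_dradius hN) scaler0 addr0 (dfield_lift hN _ (sxi x.2)) (dfield_lift hN _ sphiV).
rewrite (dfun_opp w (smooth_function_mul sr seta)) (dfun_mul hC w sr seta).
rewrite (dfun_mul hC w (smooth_function_inv hC r0 sr) (smooth_function_cst x a)) dfun_cst.
rewrite (dfun_inv hC w r0 sr) dfun_radius.
rewrite (dfun_base w (smooth_app_bilin hN sg (sxi x.2) sV)) (dfun_eta _ sV).
rewrite (dfield_app_endo hN sphi _ sV) /dradius /lift /app_bilin.
by rewrite !cvecZ !cvecD !(mulr0, mulr1, addr0, scaler0, add0r).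
Qed.

Lemma cone_J_smooth : smooth_endo J.
Proof.
split; first exact: cone_J_linear.
move=> p u; apply: germ_smooth_on => _ [x px <-].
apply: (smooth_field_atP hC _ px).1.
have sV := @smooth_field_coord _ _ _ hN p.2 x.2 (dpr u) px.
apply: (near_eq_smooth_field hC _ (smooth_J_adapted (dr u) sV).1).
by apply: filterS (chart_dom_near hC px) => z pz; rewrite cone_coord.
Qed.

Lemma cone_dendo x (w u : F) : dendo x J w u =
  cvec (- (dr w * g x.2 (xi x.2) (dpr u) + rad x * A x.2 (dpr w) (dpr u)))
    ((- ((rad x)^-1 * (rad x)^-1) * dr w * dr u) *: xi x.2
     + ((rad x)^-1 * dr u) *: Qq x.2 (dpr w) + Pq x.2 (dpr w) (dpr u)).
Proof.
have xx := chart_dom_self hC x; have qq := chart_dom_self hN x.2.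
have sV := smooth_field_coord hN (dpr u) qq.
have [_ D] := smooth_J_adapted (dr u) sV.
have e : \forall z \near x, app_endo J (coord_field x u) z =
    J z (cvec (dr u) (coord_field x.2 (dpr u) z.2)).
  by apply: filterS (chart_dom_near hC xx) => z pz; rewrite /app_endo cone_coord.
rewrite dendoE (near_eq_dfield hC w e) D (coord_field_self hN) (dfield_coord hN).
by rewrite (lin0 (gl _ _)) (lin0 (phil _)) !addr0.
Qed.

End AlmostContactCone.

Lemma normality_algebra (R : realType) n (j : 'rV[R]_n -> 'rV[R]_n)
  (a b c d p q r s k : 'rV[R]_n) : linear j ->
  a + j p - (b + j q) + j (j (r - s)) - j (p - (c + j s)) - j (d + j r - q) + k =
  a - b + j c - j d + k.
Proof.
move=> jl; rewrite !(linD jl, linN jl).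
by apply/rowP => i; rewrite !mxE; ring.
Qed.

(** * Normality and the Killing equation at a point *)

Section STPoint.
Context {R : realType} {n : nat} {N : charted_space R n}.
Context {g : bilin_field N} {xi : vector_field N} {phi : endo_field N}.
Context (hST : is_ST g xi phi).
Local Notation E := 'rV[R]_n.
Implicit Types (q : N) (v w : E) (V W X Y : vector_field N).

Let hacm : almost_contact_metric g xi phi. Proof. by case: hST. Qed.
Let hN : smooth_manifold N. Proof. by case: hacm. Qed.
Let hg : riemannian_metric g. Proof. by case: hacm => _ _ []. Qed.
Let sg : smooth_bilin g. Proof. by case: hg. Qed.
Let sxi q : smooth_field_at q xi.
Proof. by case: hacm => _ _ [_ /(smooth_fieldP hN) H _] _ _; exact: H. Qed.
Let sphi : smooth_endo phi. Proof. by case: hacm => _ _ []. Qed.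
Let gl q u : scalar (g q u). Proof. exact: bilin_l. Qed.
Let gr q v : scalar (g q ^~ v). Proof. exact: bilin_r. Qed.
Let gs q u v : g q u v = g q v u. Proof. exact: (metric_sym hg). Qed.
Let phil q : linear (phi q). Proof. by case: sphi. Qed.
Let xi1 q : g q (xi q) (xi q) = 1. Proof. by case: hacm => _ _ _ []. Qed.
Let phixi q : phi q (xi q) = 0. Proof. by case: hacm => _ _ _ []. Qed.
Let phi2 q v : phi q (phi q v) = - v + g q (xi q) v *: xi q.
Proof. by case: hacm => _ _ _ _ /(_ q v v)[]. Qed.
Let gphi q v w : g q (phi q v) (phi q w) = g q v w - g q (xi q) v * g q (xi q) w.
Proof. by case: hacm => _ _ _ _ /(_ q v w)[]. Qed.
Let sC q u := smooth_field_coord hN u (chart_dom_self hN q).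
Let C0 q u := coord_field_self hN q u.

Local Notation Pq q := (dendo q phi).
Local Notation Qq q := (dfield q xi).
Local Notation A q := (d_eta_at (g q) (xi q) (Qq q) (dbilin q g)).

Lemma st_phi_skew q v w : g q (phi q v) w = - g q v (phi q w).
Proof.
exact: (phi_skew (gl q) (gr q) (gs q) (xi1 q) (phil q) (phixi q) (phi2 q) (gphi q)).
Qed.

Lemma dendo_xi q u : Pq q u (xi q) + phi q (Qq q u) = 0.
Proof.
rewrite -(dfield_app_endo hN sphi u (sxi q)) -(dfield0 hN q u).
by apply: (f_equal (fun X => dfield q X u)); apply/funext => z; exact: phixi.
Qed.

Lemma d_eta_xi q u : A q u (xi q) + g q (xi q) (Qq q u) = 0.
Proof.
rewrite -(dfun_eta hacm u (sxi q)) -(dfun_cst q 1 u).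
by apply: (f_equal (fun f => dfun q f u)); apply/funext => z; exact: xi1.
Qed.

Lemma dendo_phi q u v : Pq q u (phi q v) + phi q (Pq q u v) =
  A q u v *: xi q + g q (xi q) v *: Qq q u.
Proof.
have s1 := smooth_app_endo hN sphi (sC q v).
have H : dfield q (app_endo phi (app_endo phi (coord_field q v))) u =
    Pq q u (phi q v) + phi q (Pq q u v).
  rewrite (dfield_app_endo hN sphi u s1) -dendoE.
  exact: (f_equal (fun z => Pq q u (phi q z) + phi q (Pq q u v)) (C0 q v)).
apply: (etrans (esym H)).
have seta := smooth_app_bilin hN sg (sxi q) (sC q v).
have s2 := smooth_field_scale hN seta (sxi q).
have s3 := smooth_field_opp hN (sC q v).
have -> : app_endo phi (app_endo phi (coord_field q v)) =
    (fun z => - coord_field q v z + app_bilin g xi (coord_field q v) z *: xi z).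
  by apply/funext => z; exact: phi2.
rewrite (dfield_add hN u s3 s2) (dfield_opp hN u (sC q v)) (dfield_coord hN) oppr0 add0r.
rewrite (dfield_scale hN u seta (sxi q)) (dfun_eta hacm u (sC q v)).
by rewrite (dfield_coord hN) (lin0 (gl _ _)) addr0 /app_bilin C0.
Qed.

Let P1 q v : linear (fun u => Pq q u v). Proof. exact: dendo_linear. Qed.
Let P2 q u : linear (Pq q u). Proof. exact: dendo_linear_r. Qed.
Let Ql q : linear (Qq q). Proof. exact: dfield_linear. Qed.
Let DG1 q u v : scalar (fun w => dbilin q g w u v). Proof. exact: dbilin_linear. Qed.
Let DGr q w u : scalar (dbilin q g w u). Proof. exact: dbilin_linear_r. Qed.

Lemma normality_tensorE q X Y : smooth_field_at q X -> smooth_field_at q Y ->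
  normality_tensor g xi phi X Y q =
  normality_at (g q) (xi q) (phi q) (Pq q) (Qq q) (dbilin q g) (X q) (Y q).
Proof.
move=> sX sY; rewrite /normality_tensor (d_etaE hacm) // !lie_bracketE.
rewrite !(dfield_app_endo hN sphi) // /app_endo.
exact: normality_algebra (phil q).
Qed.

(* Normality and the Killing equation are assumed for global fields only.  Working
   with the values of such fields avoids having to extend tangent vectors by
   cutoff functions. *)
Definition global_value q v := exists2 V, smooth_field V & V q = v.

Lemma global_value_phi q v : global_value q v -> global_value q (phi q v).
Proof.
move=> [V sV <-]; exists (app_endo phi V) => //.
by apply/(smooth_fieldP hN) => x; apply/(smooth_app_endo hN sphi)/(smooth_fieldP hN V).1.
Qed.

Lemma global_value_xi q : global_value q (xi q).
Proof. by exists xi => //; case: hacm => _ _ []. Qed.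

Lemma st_normal q u v : global_value q u -> global_value q v ->
  normality_at (g q) (xi q) (phi q) (Pq q) (Qq q) (dbilin q g) u v = 0.
Proof.
move=> [X sX <-] [Y sY <-].
rewrite -normality_tensorE; first by case: hST => _ H _; exact: H.
- exact: (smooth_fieldP hN X).1.
- exact: (smooth_fieldP hN Y).1.
Qed.

Lemma st_deta_xi q w : global_value q w -> A q (xi q) w = A q w (xi q).
Proof.
exact: (deta_xi (gl q) (gr q) (xi1 q) (phil q) (phixi q) (phi2 q) (P1 q) (dendo_xi q)
  (global_value_xi q) (@st_normal q)).
Qed.

Lemma st_lie_phi q w : global_value q w ->
  Pq q (xi q) w - Qq q (phi q w) + phi q (Qq q w) = 0.
Proof.
exact: (lie_xi_phi (gl q) (gr q) (xi1 q) (phil q) (phixi q) (phi2 q) (P1 q) (P2 q)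
  (dendo_xi q) (dendo_phi q) (d_eta_xi q) (@global_value_phi q)
  (global_value_xi q) (@st_normal q)).
Qed.

Lemma st_deta_phi q v w : global_value q v -> global_value q w ->
  A q (phi q v) w - A q w (phi q v) = - (A q v (phi q w) - A q (phi q w) v).
Proof.
exact: (deta_phi (gl q) (gr q) (xi1 q) (phil q) (phixi q) (phi2 q) (P1 q) (P2 q)
  (Ql q) (DG1 q) (DGr q) (dendo_xi q) (dendo_phi q) (@global_value_phi q)
  (global_value_xi q) (@st_normal q)).
Qed.

Lemma st_A_phi q u v : A q u (phi q v) + g q (xi q) (Pq q u v) = 0.
Proof.
exact: (A_phi (gl q) (gr q) (xi1 q) (phil q) (phixi q) (phi2 q) (P2 q) (dendo_xi q)
  (dendo_phi q)).
Qed.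

Lemma st_A_linear1 q v : scalar (fun u => A q u v).
Proof. exact: (A_linear1 (xi q) (gr q) (Ql q) (DG1 q)). Qed.

(** This is [L_xi g = 0] in components: the derivatives of the two fields cancel between the
    derivative of [g (X, Y)] and the brackets. *)
Lemma st_killing q v w : global_value q v -> global_value q w ->
  dbilin q g (xi q) v w + g q (Qq q v) w + g q v (Qq q w) = 0.
Proof.
move=> [X sX <-] [Y sY <-].
have sXq := (smooth_fieldP hN X).1 sX q; have sYq := (smooth_fieldP hN Y).1 sY q.
have := hST; case=> _ _ /(_ X Y sX sY q).
rewrite lie_derivE (dfun_app_bilin hN sg _ sXq sYq) /app_bilin !lie_bracketE.
rewrite (linB (gr q (Y q))) (linB (gl q (X q))).
have alg (a b c d e : R) : a + b + c = b - d + (c - e) -> a + d + e = 0.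
  by move=> ?; lra.
exact: alg.
Qed.

End STPoint.

(** * The cone of an ST manifold *)

Section ConePoint.
Context {R : realType} {n : nat}.
Local Notation E := 'rV[R]_n.
Local Notation F := 'rV[R]_(1 + n).
Context (r : R) (eta : E -> R) (xi : E) (phi : E -> E) (A : E -> E -> R).
Context (P : E -> E -> E) (Q : E -> E) (r0 : r != 0).
Context (etal : scalar eta) (phil : linear phi) (etaxi : eta xi = 1).
Context (phixi : phi xi = 0).
Context (Al : forall v, scalar (A ^~ v)).
Context (P1 : forall v, linear (P ^~ v)) (Ql : linear Q).
Context (dxi1 : forall u, A u xi + eta (Q u) = 0).
Context (dphi : forall u v, A u (phi v) + eta (P u v) = 0).

Let cj (u : F) : F := cvec (- (r * eta (dpr u))) ((r^-1 * dr u) *: xi + phi (dpr u)).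
Let cd (w u : F) : F := cvec (- (dr w * eta (dpr u) + r * A (dpr w) (dpr u)))
  ((- (r^-1 * r^-1) * dr w * dr u) *: xi + (r^-1 * dr u) *: Q (dpr w) + P (dpr w) (dpr u)).

(** [cj] is [J] on the cone and [cd] its componentwise derivative. The radial component of the
    Nijenhuis tensor reduces to the identities for [d eta], after [eta] of the derivatives of [xi]
    and [phi] is rewritten through [A]; the [N]-component reduces to normality and
    [L_xi phi = 0]. *)
Lemma cone_nijenhuis_algebra (a b : R) (v t : E) :
  A xi v = A v xi -> A xi t = A t xi ->
  P xi v - Q (phi v) + phi (Q v) = 0 -> P xi t - Q (phi t) + phi (Q t) = 0 ->
  A (phi v) t - A t (phi v) = - (A v (phi t) - A (phi t) v) ->
  P (phi v) t - P (phi t) v + phi (P t v) - phi (P v t) + (A v t - A t v) *: xi = 0 ->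
  let u := cvec a v in let w := cvec b t in
  cd (cj u) w - cd (cj w) u + cj (cd w u) - cj (cd u w) = 0.
Proof.
move=> Av At Lv Lt dv nv u w; rewrite /cd /cj /u /w !dr_cvec !dpr_cvec.
rewrite !(linD phil, linZ phil) phixi !scaler0 !add0r.
rewrite !(linD Ql, linZ Ql).
have AE c z s : A (c *: xi + z) s = c * A xi s + A z s by exact: Al.
have PE c z s : P (c *: xi + z) s = c *: P xi s + P z s by exact: P1.
have eE c d z s : eta (c *: xi + d *: z + s) = c + d * eta z + eta s.
  by rewrite !(linD etal) !(scalarZ _ _ etal) etaxi mulr1.
rewrite !AE !PE !eE !(cvecB, cvecD).
have -> : 0 = cvec 0 0 :> F by rewrite cvec0.
apply: (f_equal2 (@cvec R n)).
  have e1 := dxi1 t; have e2 := dxi1 v; have e3 := dphi v t; have e4 := dphi t v.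
  have -> : eta (Q t) = - A t xi by apply/eqP; rewrite -addr_eq0 addrC e1.
  have -> : eta (Q v) = - A v xi by apply/eqP; rewrite -addr_eq0 addrC e2.
  have -> : eta (P v t) = - A v (phi t) by apply/eqP; rewrite -addr_eq0 addrC e3.
  have -> : eta (P t v) = - A t (phi v) by apply/eqP; rewrite -addr_eq0 addrC e4.
  rewrite Av At.
  have -> : A (phi v) t = A t (phi v) - (A v (phi t) - A (phi t) v).
    by rewrite -dv addrC subrK.
  by move: (A _ _) (A _ _) (A _ _) (A _ _) (A _ _) (eta v) (eta t) => *; field.
have -> : P (phi v) t =
    P (phi t) v - phi (P t v) + phi (P v t) - (A v t - A t v) *: xi.
  by apply/eqP; rewrite -subr_eq0 -nv; apply/eqP/rowP => k; rewrite !mxE; ring.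
have -> : P xi v = Q (phi v) - phi (Q v).
  by apply/eqP; rewrite -subr_eq0 -Lv; apply/eqP/rowP => k; rewrite !mxE; ring.
have -> : P xi t = Q (phi t) - phi (Q t).
  by apply/eqP; rewrite -subr_eq0 -Lt; apply/eqP/rowP => k; rewrite !mxE; ring.
move: (A v t) (A t v) (eta v) (eta t) => ? ? ? ?.
by apply/rowP => k; rewrite !mxE; field.
Qed.

End ConePoint.

Section STCone.
Context {R : realType} {n : nat} {N : charted_space R n}.
Context {g : bilin_field N} {xi : vector_field N} {phi : endo_field N}.
Context (hST : is_ST g xi phi).
Local Notation C := (cone N).
Local Notation E := 'rV[R]_n.
Local Notation F := 'rV[R]_(1 + n).
Local Notation J := (cone_J g xi phi).
Local Notation gC := (cone_metric g).
Implicit Types (q : N) (x : C) (v w : E) (V W : vector_field N).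

Let hacm : almost_contact_metric g xi phi. Proof. by case: hST. Qed.
Let hN : smooth_manifold N. Proof. by case: hacm. Qed.
Let hC : smooth_manifold C. Proof. exact: cone_smooth_manifold. Qed.
Let hg : riemannian_metric g. Proof. by case: hacm => _ _ []. Qed.
Let sphi : smooth_endo phi. Proof. by case: hacm => _ _ []. Qed.
Let phil q : linear (phi q). Proof. by case: sphi. Qed.
Let xi1 q : g q (xi q) (xi q) = 1. Proof. by case: hacm => _ _ _ []. Qed.
Let phixi q : phi q (xi q) = 0. Proof. by case: hacm => _ _ _ []. Qed.
Let sxi q : smooth_field_at q xi.
Proof. by case: hacm => _ _ [_ /(smooth_fieldP hN) H _] _ _; exact: H. Qed.
Let gl q u : scalar (g q u). Proof. by apply: bilin_l; case: hg. Qed.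

Lemma global_value_slice x (X : vector_field C) : smooth_field X -> global_value x.2 (dpr (X x)).
Proof.
case: x => r q sX; exists (slice X r) => //.
apply/(smooth_fieldP hN) => p; apply: (smooth_slice hN).
exact: (smooth_fieldP hC X).1.
Qed.

Lemma cone_hermitian : Defs.hermitian gC J.
Proof.
split.
- exact: hC.
- exact: (cone_riemannian hacm).
- exact: (cone_J_smooth hacm).
- by move=> x v w; split; [exact: (cone_JJ hacm)|exact: (cone_gJJ hacm)].
move=> X Y sX sY x; have r0 : rad x != 0 by rewrite gt_eqF // radius_gt0.
have gX := global_value_slice x sX; have gY := global_value_slice x sY.
rewrite (nijenhuisE hC (cone_J_smooth hacm) (cone_JJ hacm)
  ((smooth_fieldP hC X).1 sX x) ((smooth_fieldP hC Y).1 sY x)).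
have key (d d' : F -> F -> F) (j j' : F -> F) : (forall w u : F, d w u = d' w u) ->
    (forall u : F, j u = j' u) -> forall u w : F,
    d (j u) w - d (j w) u + j (d w u) - j (d u w) =
    d' (j' u) w - d' (j' w) u + j' (d' w u) - j' (d' u w).
  by move=> Hd Hj u w; rewrite !Hd !Hj.
apply: (etrans (key _ _ _ _ (cone_dendo hacm x) (cone_JE hacm x) (X x) (Y x))).
rewrite -(cvecK (X x)) -(cvecK (Y x)).
have H := (cone_nijenhuis_algebra r0 (gl x.2 (xi x.2)) (phil x.2) (xi1 x.2) (phixi x.2)
  (st_A_linear1 hST x.2) (fun v => dendo_linear hN sphi x.2 v)
  (dfield_linear (sxi x.2)) (d_eta_xi hST x.2) (st_A_phi hST x.2) (dr (X x)) (dr (Y x))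
  (st_deta_xi hST gX) (st_deta_xi hST gY) (st_lie_phi hST gX) (st_lie_phi hST gY)
  (st_deta_phi hST gX gY) (st_normal hST gX gY)).
exact: H.
Qed.

End STCone.

(** * Commuting coordinate fields *)

Section CoordinateFields.
Context {R : realType} {n : nat} {M : charted_space R n} (hM : smooth_manifold M).
Local Notation E := 'rV[R]_n.
Implicit Types (x p : M) (u v w : E) (f : M -> R).

Lemma field_in_coord p u x : chart_dom p x ->
  \forall y \near chart p x, u = field_in p (coord_field p u) y.
Proof.
move=> px; apply: filterS (near_chart_invK hM px) => y [py Ey].
have yy := chart_dom_self hM (chart_inv p y).
by rewrite /field_in /coord_field (transfer_trans hM) // (transfer_id hM).
Qed.

(** The bracket at [x] is defined in the chart of [x]; moved to the chart [p], both fields have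
    constant components. It thus vanishes throughout the chart domain and may be dropped before
    differentiating again. *)
Lemma lie_bracket_coord p u v x : chart_dom p x ->
  lie_bracket (coord_field p u) (coord_field p v) x = 0.
Proof.
move=> px; have xx := chart_dom_self hM x.
have su := (smooth_field_atP hM _ px).1 (smooth_field_coord hM u px).
have sv := (smooth_field_atP hM _ px).1 (smooth_field_coord hM v px).
have D0 w a : 'D_a (field_in p (coord_field p w)) (chart p x) = 0.
  by apply: (etrans (esym (near_eq_derive a (field_in_coord w px)))); exact: derive_cst.
have H := lie_bracket_chart hM px (germ_smooth_at su) (germ_smooth_at sv).
have H0 := etrans H (f_equal2 (fun a b => a - b) (D0 v _) (D0 u _)).
rewrite /= subr0 in H0.
apply: (etrans (esym (field_coord hM _ px))).
apply: (etrans (f_equal (fun a => coord_field p a x) H0)).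
exact: lin0 (transfer_linear hM px xx).
Qed.

(** Near [x] the derivative along a coordinate field is a directional derivative in one fixed chart,
    so this is Schwarz's theorem. *)
Lemma lie_deriv_coordC x u w f : smooth_function_at x f ->
  dfun x (lie_deriv (coord_field x u) f) w = dfun x (lie_deriv (coord_field x w) f) u.
Proof.
move=> sf; have xx := chart_dom_self hM x.
have key a b : dfun x (lie_deriv (coord_field x a) f) b =
    'D_b ('D_a (f \o chart_inv x : E -> R^o)) (chart x x).
  apply: (etrans (esym (lie_derivE (fun=> b) _ _))); rewrite /lie_deriv.
  apply: (@near_eq_derive _ _ R^o).
  apply: filterS3 (near_chart_invK hM xx) (germ_smooth_near sf) (field_in_coord a xx).
  move=> y [xy Ey] df Ea; have := @lie_deriv_chart _ _ _ hM x (chart_inv x y)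
    (coord_field x a) f xy.
  by rewrite Ey -Ea => /(_ df) <-.
exact: (etrans (key u w) (etrans (derive_comm_real u w sf) (esym (key w u)))).
Qed.

End CoordinateFields.

(** * The forms [F], [d eta] and [2 F - d eta] on [N] *)

Section FundamentalForm.
Context {R : realType} {n : nat} {N : charted_space R n}.
Context {g : bilin_field N} {xi : vector_field N} {phi : endo_field N}.
Context (hacm : almost_contact_metric g xi phi).
Local Notation E := 'rV[R]_n.
Implicit Types (q : N) (u v w : E) (V W X Y : vector_field N).

Let hN : smooth_manifold N. Proof. by case: hacm. Qed.
Let hg : riemannian_metric g. Proof. by case: hacm => _ _ []. Qed.
Let sg : smooth_bilin g. Proof. by case: hg. Qed.
Let sxi q : smooth_field_at q xi.
Proof. by case: hacm => _ _ [_ /(smooth_fieldP hN) H _] _ _; exact: H. Qed.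
Let sphi : smooth_endo phi. Proof. by case: hacm => _ _ []. Qed.
Let gl q u : scalar (g q u). Proof. exact: bilin_l. Qed.
Let gr q v : scalar (g q ^~ v). Proof. exact: bilin_r. Qed.
Let phil q : linear (phi q). Proof. by case: sphi. Qed.
Let sC q u := smooth_field_coord hN u (chart_dom_self hN q).
Let C0 q u := coord_field_self hN q u.

Local Notation F := (fund_form g phi).
Local Notation A q := (d_eta_at (g q) (xi q) (dfield q xi) (dbilin q g)).

Lemma smooth_fund_form : smooth_bilin F.
Proof.
apply: (smooth_bilin_intro hN) => [q u|q X Y sX sY].
  split=> [a v w|a v w]; rewrite /fund_form; first exact: (gl q (phi q u) a v w).
  by rewrite phil; exact: (gr q u a (phi q v) (phi q w)).
exact: (smooth_app_bilin hN sg (smooth_app_endo hN sphi sX) sY).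
Qed.

Lemma dbilin_fund_form q w u v :
  dbilin q F w u v = dbilin q g w (phi q u) v + g q (dendo q phi w u) v.
Proof.
rewrite dbilinE.
have := dfun_app_bilin hN sg w (smooth_app_endo hN sphi (sC q u)) (sC q v).
rewrite (dfield_coord hN) (lin0 (gl q _)) addr0 -dendoE /app_endo !C0.
exact.
Qed.

Definition deta_form : bilin_field N := fun q u v => A q u v - A q v u.

Lemma deta_form_alt q u v : deta_form q u v = - deta_form q v u.
Proof. by rewrite /deta_form opprB. Qed.

Lemma smooth_eta q V : smooth_field_at q V -> smooth_function_at q (app_bilin g xi V).
Proof. exact: (smooth_app_bilin hN sg (sxi q)). Qed.

Lemma smooth_d_eta q X Y : smooth_field_at q X -> smooth_field_at q Y ->
  smooth_function_at q (d_eta g xi X Y).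
Proof.
move=> sX sY.
have H1 := smooth_lie_deriv hN sX (smooth_eta sY).
have H2 := smooth_lie_deriv hN sY (smooth_eta sX).
have H3 := smooth_eta (smooth_lie_bracket hN sX sY).
exact: (smooth_function_sub (smooth_function_sub H1 H2) H3).
Qed.

Lemma near_deta_coord p q u v : chart_dom p q -> \forall z \near q,
  d_eta g xi (coord_field p u) (coord_field p v) z =
  app_bilin deta_form (coord_field p u) (coord_field p v) z.
Proof.
move=> pq; apply: filterS (chart_dom_near hN pq) => z pz.
exact: (d_etaE hacm (smooth_field_coord hN u pz) (smooth_field_coord hN v pz)).
Qed.

Lemma smooth_deta_form : smooth_bilin deta_form.
Proof.
have Al1 q v : scalar (fun u => A q u v).
  exact: (A_linear1 (xi q) (gr q) (dfield_linear (sxi q)) (fun u v => dbilin_linear hN sg q u v)).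
have Al2 q u : scalar (A q u).
  exact: (A_linear2 (xi q) (dfield q xi) (gl q) (fun w u => dbilin_linear_r hN sg q w u)).
split=> [q u|p u v].
  split=> a v w; rewrite /deta_form.
    have := Al1 q u a v w; have := Al2 q u a v w; cbv beta.
    by move=> -> ->; move: (d_eta_at _ _ _ _ _ _) (d_eta_at _ _ _ _ _ _)
      (d_eta_at _ _ _ _ _ _) (d_eta_at _ _ _ _ _ _) => *; ring.
  have := Al1 q u a v w; have := Al2 q u a v w; cbv beta.
  by move=> -> ->; move: (d_eta_at _ _ _ _ _ _) (d_eta_at _ _ _ _ _ _)
    (d_eta_at _ _ _ _ _ _) (d_eta_at _ _ _ _ _ _) => *; ring.
apply: germ_smooth_on => _ [q pq <-].
apply: (smooth_function_atP hN _ pq).1.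
apply: (near_eq_smooth_function hN (near_deta_coord u v pq)).
by apply: smooth_d_eta; apply: smooth_field_coord.
Qed.

Lemma dbilin_deta_form q w u v : dbilin q deta_form w u v =
  dfun q (lie_deriv (coord_field q u) (app_bilin g xi (coord_field q v))) w
  - dfun q (lie_deriv (coord_field q v) (app_bilin g xi (coord_field q u))) w.
Proof.
have qq := chart_dom_self hN q.
rewrite dbilinE -(near_eq_dfun hN w (near_deta_coord u v qq)).
have H1 := smooth_lie_deriv hN (sC q u) (smooth_eta (sC q v)).
have H2 := smooth_lie_deriv hN (sC q v) (smooth_eta (sC q u)).
rewrite -(dfun_sub w H1 H2); apply: (near_eq_dfun hN).
apply: filterS (chart_dom_near hN qq) => z qz.
rewrite /d_eta /d1 (lie_bracket_coord hN _ _ qz) /Defs.eta (lin0 (gl _ _)) subr0.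
exact: erefl.
Qed.

(* d d eta = 0, by symmetry of second derivatives on coordinate fields. *)
Lemma dform_deta_form q u v w : dform deta_form q u v w = 0.
Proof.
have alg (a b c d e f : R) : a = c -> b = e -> d = f -> a - b - (c - d) + (e - f) = 0.
  by move=> -> -> ->; ring.
rewrite /dform (dbilin_deta_form q u v w) (dbilin_deta_form q v u w).
rewrite (dbilin_deta_form q w u v).
apply: alg.
- exact: (lie_deriv_coordC hN v u (smooth_eta (sC q w))).
- exact: (lie_deriv_coordC hN w u (smooth_eta (sC q v))).
- exact: (lie_deriv_coordC hN w v (smooth_eta (sC q u))).
Qed.

Definition sasaki_defect : bilin_field N := fun q u v => 2 * F q u v - deta_form q u v.

Lemma smooth_sasaki_defect : smooth_bilin sasaki_defect.
Proof.
split=> [q u|p u v].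
  split=> a v w; rewrite /sasaki_defect.
    rewrite (bilin_l smooth_fund_form q u a v w) (bilin_l smooth_deta_form q u a v w).
    by move: (fund_form _ _ _ _ _) (fund_form _ _ _ _ _) (deta_form _ _ _)
      (deta_form _ _ _) => *; ring.
  rewrite (bilin_r smooth_fund_form q u a v w) (bilin_r smooth_deta_form q u a v w).
  by move: (fund_form _ _ _ _ _) (fund_form _ _ _ _ _) (deta_form _ _ _)
      (deta_form _ _ _) => *; ring.
apply: germ_smooth_on => _ [q pq <-]; apply: (smooth_function_atP hN _ pq).1.
have su := smooth_field_coord hN u pq; have sv := smooth_field_coord hN v pq.
exact: (smooth_function_sub (smooth_function_mul (smooth_function_cst q 2)
  (smooth_app_bilin hN smooth_fund_form su sv))
  (smooth_app_bilin hN smooth_deta_form su sv)).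
Qed.

(** Since [d d eta = 0], differentiating [2 F - d eta] leaves [2 dF]. In the Sasaki case this is how
    [dF = 0] is obtained. *)
Lemma dform_sasaki_defect q u v w : dform sasaki_defect q u v w = 2 * dform F q u v w.
Proof.
have key a b c : dbilin q sasaki_defect a b c =
    2 * dbilin q F a b c - dbilin q deta_form a b c.
  have s1 := smooth_app_bilin hN smooth_fund_form (sC q b) (sC q c).
  have s2 := smooth_app_bilin hN smooth_deta_form (sC q b) (sC q c).
  have s3 := smooth_function_mul (smooth_function_cst q 2) s1.
  rewrite !dbilinE; apply: (etrans (dfun_sub a s3 s2)).
  by rewrite (dfun_mul hN a (smooth_function_cst q 2) s1) dfun_cst mul0r add0r.
have := dform_deta_form q u v w; rewrite /dform !key.
have alg (a b c d e f : R) : d - e + f = 0 ->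
  (2 * a - d) - (2 * b - e) + (2 * c - f) = 2 * (a - b + c) by move=> ?; lra.
exact: alg.
Qed.

End FundamentalForm.

(** * The exterior derivative of the fundamental form of the cone *)

Section ConeForm.
Context {R : realType} {n : nat} {N : charted_space R n}.
Context {g : bilin_field N} {xi : vector_field N} {phi : endo_field N}.
Context (hST : is_ST g xi phi).
Local Notation C := (cone N).
Local Notation E := 'rV[R]_n.
Local Notation F := 'rV[R]_(1 + n).
Local Notation J := (cone_J g xi phi).
Local Notation gC := (cone_metric g).
Implicit Types (q : N) (x : C) (v w : E) (V W : vector_field N).

Let hacm : almost_contact_metric g xi phi. Proof. by case: hST. Qed.
Let hN : smooth_manifold N. Proof. by case: hacm. Qed.
Let hC : smooth_manifold C. Proof. exact: cone_smooth_manifold. Qed.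
Let hg : riemannian_metric g. Proof. by case: hacm => _ _ []. Qed.
Let sg : smooth_bilin g. Proof. by case: hg. Qed.
Let phixi q : phi q (xi q) = 0. Proof. by case: hacm => _ _ _ []. Qed.
Let gl q u : scalar (g q u). Proof. exact: bilin_l. Qed.
Let gr q v : scalar (g q ^~ v). Proof. exact: bilin_r. Qed.
Let gs q u v : g q u v = g q v u. Proof. exact: (metric_sym hg). Qed.
Let sC q u := smooth_field_coord hN u (chart_dom_self hN q).
Let C0 q u := coord_field_self hN q u.

Local Notation om := (@fundamental_form _ _ _ gC J).
Local Notation fF := (fund_form g phi).
Local Notation A q := (d_eta_at (g q) (xi q) (dfield q xi) (dbilin q g)).
Local Notation beta := (@sasaki_defect _ _ _ g xi phi).

Lemma fundamental_form_cvec x (a b : R) v w : om x (cvec a v) (cvec b w) =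
  rad x * (a * g x.2 (xi x.2) w - b * g x.2 (xi x.2) v) + (rad x * rad x) * fF x.2 v w.
Proof.
have r0 : rad x != 0 by rewrite gt_eqF // radius_gt0.
apply: (etrans (f_equal (fun u => gC x u (cvec b w)) (cone_JE hacm x (cvec a v)))).
rewrite /cone_J_at dr_cvec dpr_cvec; apply: (etrans (cone_metric_cvec _ _ _ _ _)).
rewrite (scalar_app _ _ (gr x.2 w)) (scalarZ _ _ (gr x.2 w)) /fund_form.
by move: (g _ _ _) (g _ _ _) (g _ _ _) => *; field.
Qed.

(** On coordinate fields the radial components [dr u] and [dr v] are constants, so the form is [r]
    times a pulled-back function plus [r^2] times another, and the product rule applies; the factor
    2 is the derivative of [r^2]. *)
Lemma dbilin_cone_form x (w u v : F) : dbilin x om w u v =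
  dr w * (dr u * g x.2 (xi x.2) (dpr v) - dr v * g x.2 (xi x.2) (dpr u))
  + rad x * (dr u * A x.2 (dpr w) (dpr v) - dr v * A x.2 (dpr w) (dpr u))
  + (2 * rad x * dr w) * fF x.2 (dpr u) (dpr v)
  + (rad x * rad x) * dbilin x.2 fF (dpr w) (dpr u) (dpr v).
Proof.
pose q : N := x.2; pose eu := app_bilin g xi (coord_field q (dpr u)).
pose ev := app_bilin g xi (coord_field q (dpr v)).
pose f := app_bilin fF (coord_field q (dpr u)) (coord_field q (dpr v)).
have se : smooth_function_at q eu by exact: (smooth_eta hacm).
have sv : smooth_function_at q ev by exact: (smooth_eta hacm).
have sf : smooth_function_at q f.
  exact: (smooth_app_bilin hN (smooth_fund_form hacm) (sC q _) (sC q _)).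
have E0 : \forall z \near x, rad z * (dr u * ev z.2 - dr v * eu z.2)
    + (rad z * rad z) * f z.2 = app_bilin om (coord_field x u) (coord_field x v) z.
  apply: filterS (chart_dom_near hC (chart_dom_self hC x)) => z pz.
  apply: (etrans _ (esym (f_equal2 (om z) (cone_coord hN u pz) (cone_coord hN v pz)))).
  exact: (esym (fundamental_form_cvec _ _ _ _ _)).
rewrite dbilinE -(near_eq_dfun hC w E0).
have sr := smooth_radius x; have srr := smooth_function_mul sr sr.
have bu := smooth_function_base se; have bv := smooth_function_base sv.
have bf := smooth_function_base sf.
have cu := smooth_function_cst x (dr u); have cv := smooth_function_cst x (dr v).
have s1 := smooth_function_mul cu bv; have s2 := smooth_function_mul cv bu.
have s12 := smooth_function_sub s1 s2.
have s3 := smooth_function_mul sr s12; have s4 := smooth_function_mul srr bf.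
have De b : dfun x (fun z : C => app_bilin g xi (coord_field q b) z.2) w =
    A q (dpr w) b.
  apply: (etrans (dfun_base w (smooth_eta hacm (sC q b)))).
  apply: (etrans (dfun_eta hacm (dpr w) (sC q b))).
  rewrite (dfield_coord hN) (lin0 (gl q (xi q))) addr0.
  exact: (f_equal (A q (dpr w)) (C0 q b)).
have Dm a h : smooth_function_at x h ->
    dfun x (fun z : C => a * h z) w = a * dfun x h w.
  move=> sh; apply: (etrans (dfun_mul hC w (smooth_function_cst x a) sh)).
  by rewrite dfun_cst mul0r add0r.
have D12 := etrans (dfun_sub w s1 s2) (f_equal2 (fun a b => a - b)
  (etrans (Dm (dr u) _ bv) (f_equal ( *%R (dr u)) (De (dpr v))))
  (etrans (Dm (dr v) _ bu) (f_equal ( *%R (dr v)) (De (dpr u))))).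
have Dr := dfun_radius x w.
have Drr := etrans (dfun_mul hC w sr sr)
  (f_equal2 (fun a b => a * rad x + rad x * b) Dr Dr).
have D3 := etrans (dfun_mul hC w sr s12) (f_equal2 (fun a b =>
  a * (dr u * ev q - dr v * eu q) + rad x * b) Dr D12).
have D4 := etrans (dfun_mul hC w srr bf) (f_equal2 (fun a b =>
  a * f q + (rad x * rad x) * b) Drr (dfun_base w sf)).
apply: (etrans (dfun_add w s3 s4)); apply: (etrans (f_equal2 +%R D3 D4)).
have Cu : coord_field q (dpr u) q = dpr u by exact: C0.
have Cv : coord_field q (dpr v) q = dpr v by exact: C0.
rewrite /eu /ev /f /app_bilin Cu Cv.
have alg (a b r r' e1 e2 a1 a2 f0 f1 : R) :
  r' * (a * e1 - b * e2) + r * (a * a1 - b * a2)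
  + ((r' * r + r * r') * f0 + r * r * f1) =
  r' * (a * e1 - b * e2) + r * (a * a1 - b * a2) + 2 * r * r' * f0 + r * r * f1.
  by ring.
exact: alg.
Qed.

(* d omega = r dr /\ (2 F - d eta) + r^2 dF. *)
Lemma dform_cone_form x (a b c : R) (u v w : E) :
  dform om x (cvec a u) (cvec b v) (cvec c w) =
  rad x * (a * beta x.2 v w - b * beta x.2 u w + c * beta x.2 u v)
  + (rad x * rad x) * dform fF x.2 u v w.
Proof.
rewrite /dform (dbilin_cone_form x (cvec a u)) (dbilin_cone_form x (cvec b v)).
rewrite (dbilin_cone_form x (cvec c w)) !dr_cvec !dpr_cvec /sasaki_defect /deta_form.
move: (dbilin _ fF _ _ _) (dbilin _ fF _ _ _) (dbilin _ fF _ _ _) => d1 d2 d3.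
move: (d_eta_at _ _ _ _ _ _) (d_eta_at _ _ _ _ _ _) (d_eta_at _ _ _ _ _ _).
move: (d_eta_at _ _ _ _ _ _) (d_eta_at _ _ _ _ _ _) (d_eta_at _ _ _ _ _ _).
move=> a1 a2 a3 a4 a5 a6.
move: (fund_form _ _ _ _ _) (fund_form _ _ _ _ _) (fund_form _ _ _ _ _) => f1 f2 f3.
move: (g _ _ _) (g _ _ _) (g _ _ _) (rad x) => e1 e2 e3 r.
ring.
Qed.

(* Killing turns the derivative of g along xi into derivatives of xi, and
   L_xi phi = 0 does the same for phi. *)
Lemma dform_fund_xi q v w : global_value q v -> global_value q w ->
  dform fF q (xi q) v w = 0.
Proof.
have alg (t1 t2 t3 a b c d e f h : R) : t1 = a + b -> t2 = - c -> t3 = - d ->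
  b = e - c -> a + e + f = 0 -> d = - h -> h = f -> t1 - t2 + t3 = 0 by move=> *; lra.
move=> gv gw; rewrite /dform.
have gNl a b : g q (- a) b = - g q a b by exact: (linN (gr q b)).
(* As [phi xi = 0], the 1-form [F (xi, -)] vanishes identically; its derivative leaves only the
   derivative of [xi]. *)
have swap u z : dbilin q fF u (xi q) z = - g q (phi q (dfield q xi u)) z.
  rewrite (dbilin_fund_form hacm) -gNl.
  have -> : dendo q phi u (xi q) = - phi q (dfield q xi u).
    by apply/eqP; rewrite -addr_eq0; apply/eqP; exact: (dendo_xi hST q u).
  apply: (etrans (f_equal (fun a => dbilin q g u a z + _) (phixi q))).
  by rewrite (lin0 (dbilin_linear_l hN sg q u z)) add0r.
have e1 : g q (dendo q phi (xi q) v) w =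
    g q (dfield q xi (phi q v)) w - g q (phi q (dfield q xi v)) w.
  have := f_equal (fun a => g q a w) (st_lie_phi hST gv).
  rewrite /= (linD (gr q w)) (linB (gr q w)) (lin0 (gr q w)).
  have alg2 (a b c : R) : a - b + c = 0 -> a = b - c by move=> *; lra.
  exact: alg2.
have k := st_killing hST (global_value_phi hST gv) gw.
have s1 := st_phi_skew hST q (dfield q xi w) v.
have s2 := gs q (dfield q xi w) (phi q v).
exact: (alg _ _ _ _ _ _ _ _ _ _ (dbilin_fund_form hacm q (xi q) v w) (swap v w) (swap w v)
  e1 k s1 s2).
Qed.

End ConeForm.

Lemma lie_deriv0 (R : realType) n (M : charted_space R n) (X : vector_field M) x :
  lie_deriv X (fun=> 0) x = 0.
Proof. by rewrite lie_derivE dfun_cst. Qed.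

Section VanishingTerms.
Context {R : realType} {n : nat} {M : charted_space R n}.
Implicit Types X Y Z W : vector_field M.

Lemma d2_eq0 (b : vector_field M -> vector_field M -> M -> R) X Y Z x :
  b Y Z = (fun=> 0) -> b X Z = (fun=> 0) -> b X Y = (fun=> 0) ->
  b (lie_bracket X Y) Z x = 0 -> b (lie_bracket X Z) Y x = 0 ->
  b (lie_bracket Y Z) X x = 0 -> d2 b X Y Z x = 0.
Proof.
rewrite /d2; move: (lie_bracket X Y) (lie_bracket X Z) (lie_bracket Y Z) => XY XZ YZ.
by move=> -> -> -> -> -> ->; rewrite !lie_deriv0 !(subr0, addr0).
Qed.

(** For [c] closed under these vanishing conditions only the derivative along [X] is left. With [X]
    the Euler field this is the term that detects the Sasaki condition; in the Sasaki case it
    vanishes too. *)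
Lemma d3_lie_deriv (c : vector_field M -> vector_field M -> vector_field M -> M -> R)
  X Y Z W x :
  c X Z W = (fun=> 0) -> c X Y W = (fun=> 0) -> c X Y Z = (fun=> 0) ->
  c (lie_bracket X Y) Z W x = 0 -> c (lie_bracket X Z) Y W x = 0 ->
  c (lie_bracket X W) Y Z x = 0 -> c (lie_bracket Y Z) X W x = 0 ->
  c (lie_bracket Y W) X Z x = 0 -> c (lie_bracket Z W) X Y x = 0 ->
  d3 c X Y Z W x = lie_deriv X (c Y Z W) x.
Proof.
rewrite /d3; move: (lie_bracket X Y) (lie_bracket X Z) (lie_bracket X W) => XY XZ XW.
move: (lie_bracket Y Z) (lie_bracket Y W) (lie_bracket Z W) => YZ YW ZW.
move=> -> -> -> -> -> -> -> -> ->.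
by rewrite !lie_deriv0 !(subr0, addr0).
Qed.

End VanishingTerms.

(** * The torsion form of the cone and the SKT condition *)

Section STConeTorsion.
Context {R : realType} {n : nat} {N : charted_space R n}.
Context {g : bilin_field N} {xi : vector_field N} {phi : endo_field N}.
Context (hST : is_ST g xi phi).
Local Notation C := (cone N).
Local Notation E := 'rV[R]_n.
Local Notation J := (cone_J g xi phi).
Local Notation gC := (cone_metric g).
Implicit Types (q : N) (x : C) (v w : E).

Let hacm : almost_contact_metric g xi phi. Proof. by case: hST. Qed.
Let hN : smooth_manifold N. Proof. by case: hacm. Qed.
Let hC : smooth_manifold C. Proof. exact: cone_smooth_manifold. Qed.
Let hg : riemannian_metric g. Proof. by case: hacm => _ _ []. Qed.
Let hH : Defs.hermitian gC J. Proof. exact: cone_hermitian. Qed.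
Let sphi : smooth_endo phi. Proof. by case: hacm => _ _ []. Qed.
Let sJ : smooth_endo J. Proof. exact: cone_J_smooth. Qed.
Let phil q : linear (phi q). Proof. by case: sphi. Qed.
Let phixi q : phi q (xi q) = 0. Proof. by case: hacm => _ _ _ []. Qed.
Let phi2 q v : phi q (phi q v) = - v + g q (xi q) v *: xi q.
Proof. by case: hacm => _ _ _ _ /(_ q v v)[]. Qed.
Let gr q v : scalar (g q ^~ v). Proof. by apply: bilin_r; case: hg. Qed.
Let gs q u v : g q u v = g q v u. Proof. exact: (metric_sym hg). Qed.
Let xi1 q : g q (xi q) (xi q) = 1. Proof. by case: hacm => _ _ _ []. Qed.
Let sxi : smooth_field xi. Proof. by case: hacm => _ _ []. Qed.

Local Notation fF := (fund_form g phi).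
Local Notation beta := (@sasaki_defect _ _ _ g xi phi).
Let sbeta : smooth_bilin beta. Proof. exact: smooth_sasaki_defect. Qed.

Lemma fund_form_alt q v w : fF q v w = - fF q w v.
Proof. by rewrite /fund_form (st_phi_skew hST) gs. Qed.

Lemma sasaki_defect_alt q v w : beta q v w = - beta q w v.
Proof.
rewrite /sasaki_defect (fund_form_alt q v w) (@deta_form_alt _ _ _ g xi q v w).
by move: (fund_form _ _ _ _ _) (deta_form _ _ _) => a b; ring.
Qed.

(** [F (xi, -)] vanishes because [phi xi = 0], and [i_xi d eta = 0] by normality. *)
Lemma sasaki_defect_xi q w : global_value q w -> beta q (xi q) w = 0.
Proof.
move=> gw; rewrite /sasaki_defect /fund_form phixi (lin0 (gr q w)) mulr0 sub0r.
rewrite /deta_form (st_deta_xi hST gw).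
by rewrite subrr oppr0.
Qed.

(** The square of [phi] is [-1] up to multiples of [xi], on which the form vanishes. The torsion
    form of the cone shows the defect on images of [phi] only, and this recovers it on [v] and
    [w]. *)
Lemma sasaki_defect_phi q v w : global_value q v -> global_value q w ->
  beta q (phi q (phi q v)) (phi q (phi q w)) = beta q v w.
Proof.
move=> gv gw; rewrite !phi2.
have bl := bilin_l sbeta q; have br := bilin_r sbeta q.
rewrite (scalar_app _ _ (br _)) (linN (br _)) (scalarZ _ _ (br _)).
rewrite (scalar_app _ _ (bl v)) (scalar_app _ _ (bl (xi q))).
rewrite !(linN (bl _)) !(scalarZ _ _ (bl _)).
rewrite (sasaki_defect_alt q v (xi q)).
rewrite (sasaki_defect_xi gv) (sasaki_defect_xi gw).
rewrite (sasaki_defect_xi (global_value_xi hST q)).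
by rewrite !(oppr0, mulr0, addr0) opprK.
Qed.

Lemma sasakiP : is_Sasaki g xi phi <->
  forall q v w, global_value q v -> global_value q w -> beta q v w = 0.
Proof.
have key q X Y : smooth_field X -> smooth_field Y ->
    d_eta g xi X Y q = @deta_form _ _ _ g xi q (X q) (Y q).
  move=> sX sY.
  exact: (d_etaE hacm ((smooth_fieldP hN X).1 sX q) ((smooth_fieldP hN Y).1 sY q)).
split=> [[_ H] q v w [X sX <-] [Y sY <-]|H].
  by rewrite /sasaki_defect -(key _ _ _ sX sY) (H _ _ sX sY) subrr.
split=> // X Y sX sY q; rewrite (key _ _ _ sX sY); apply/esym/eqP; rewrite -subr_eq0.
by apply/eqP; apply: H; [exists X|exists Y].
Qed.

Lemma global_value_J x (X : vector_field C) : smooth_field X ->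
  global_value x.2 (dpr (J x (X x))).
Proof.
move=> sX; apply: (global_value_slice hST x (X := app_endo J X)).
by apply/(smooth_fieldP hC) => z; apply/(smooth_app_endo hC sJ)/(smooth_fieldP hC X).1.
Qed.

(* If 2 F = d eta then dF = 0 too, so that d omega = 0. *)
Lemma sasaki_kt_form (X Y Z : vector_field C) : is_Sasaki g xi phi ->
  smooth_field X -> smooth_field Y -> smooth_field Z -> kt_form gC J X Y Z = fun=> 0.
Proof.
move=> /sasakiP b0 sX sY sZ; apply/funext => x.
rewrite (kt_formE hH ((smooth_fieldP hC X).1 sX x) ((smooth_fieldP hC Y).1 sY x)
  ((smooth_fieldP hC Z).1 sZ x)) /torsion_at.
have [gX gY gZ] := And3 (global_value_J x sX) (global_value_J x sY) (global_value_J x sZ).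
rewrite -(cvecK (J x (X x))) -(cvecK (J x (Y x))) -(cvecK (J x (Z x))).
rewrite (dform_cone_form hST) (b0 _ _ _ gX gY) (b0 _ _ _ gX gZ) (b0 _ _ _ gY gZ).
suff -> : dform fF x.2 (dpr (J x (X x))) (dpr (J x (Y x))) (dpr (J x (Z x))) = 0.
  by rewrite !(mulr0, subr0, addr0).
(* The defect is known to vanish on values of global fields only, so its exterior derivative is
   computed with the global fields [U], [V], [W], whose brackets are global fields as well. *)
move: gX gY gZ => [U sU <-] [V sV <-] [W sW <-].
apply: two_mul_inj; rewrite mulr0 -(dform_sasaki_defect hacm).
have sf (T : vector_field N) : smooth_field T -> smooth_field_at x.2 T.
  by move=> sT; exact: (smooth_fieldP hN T).1.
rewrite -(d2E hN sbeta sasaki_defect_alt (sf _ sU) (sf _ sV) (sf _ sW)).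
have B0 (S T : vector_field N) : smooth_field S -> smooth_field T ->
    app_bilin beta S T = fun=> 0.
  by move=> sS sT; apply/funext => z; apply: b0; [exists S|exists T].
have sB (S T : vector_field N) : smooth_field S -> smooth_field T ->
    smooth_field (lie_bracket S T).
  move=> sS sT; apply/(smooth_fieldP hN) => z.
  by apply: (smooth_lie_bracket hN); exact: (smooth_fieldP hN _).1.
have B0x (S T : vector_field N) : smooth_field S -> smooth_field T ->
    app_bilin beta S T x.2 = 0 by move=> sS sT; rewrite (B0 S T sS sT).
exact: (d2_eq0 (B0 _ _ sV sW) (B0 _ _ sU sW) (B0 _ _ sU sV) (B0x _ _ (sB _ _ sU sV) sW)
  (B0x _ _ (sB _ _ sU sW) sV) (B0x _ _ (sB _ _ sV sW) sU)).
Qed.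

Let smooth_bracket (X Y : vector_field C) : smooth_field X -> smooth_field Y ->
  smooth_field (lie_bracket X Y).
Proof.
move=> sX sY; apply/(smooth_fieldP hC) => z.
by apply: (smooth_lie_bracket hC); exact: (smooth_fieldP hC _).1.
Qed.

Lemma sasaki_SKT : is_Sasaki g xi phi -> is_SKT gC J.
Proof.
move=> hS; split=> [|X Y Z W sX sY sZ sW x]; first exact: hermitian_is_KT.
have K (S T U : vector_field C) : smooth_field S -> smooth_field T -> smooth_field U ->
  kt_form gC J S T U = fun=> 0 by exact: sasaki_kt_form.
have [sXY sXZ sXW] := And3 (smooth_bracket sX sY) (smooth_bracket sX sZ) (smooth_bracket sX sW).
have [sYZ sYW sZW] := And3 (smooth_bracket sY sZ) (smooth_bracket sY sW) (smooth_bracket sZ sW).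
have Kx (S T U : vector_field C) : smooth_field S -> smooth_field T -> smooth_field U ->
  kt_form gC J S T U x = 0 by move=> sS sT sU; rewrite (K S T U sS sT sU).
apply: (etrans (d3_lie_deriv (K _ _ _ sX sZ sW) (K _ _ _ sX sY sW) (K _ _ _ sX sY sZ)
  (Kx _ _ _ sXY sZ sW) (Kx _ _ _ sXZ sY sW) (Kx _ _ _ sXW sY sZ) (Kx _ _ _ sYZ sX sW)
  (Kx _ _ _ sYW sX sZ) (Kx _ _ _ sZW sX sY))).
by rewrite (K _ _ _ sY sZ sW) lie_deriv0.
Qed.

(** The radial field [r d/dr]. The factor [r] cancels the [1 / r] in [J], so that [J] maps this
    field to the lift of [xi]. *)
Definition euler : vector_field C := fun x => rad x *: dradius x.

Lemma eulerE x : euler x = cvec (rad x) 0.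
Proof. by rewrite /euler /dradius cvecZ mulr1 scaler0. Qed.

Lemma smooth_euler : smooth_field euler.
Proof.
apply/(smooth_fieldP hC) => x.
exact: (smooth_field_scale hC (smooth_radius x) (smooth_dradius hN x)).
Qed.

Lemma smooth_field_lift (V : vector_field N) : smooth_field V -> smooth_field (lift V).
Proof.
move=> sV; apply/(smooth_fieldP hC) => x.
exact: (smooth_lift hN ((smooth_fieldP hN V).1 sV x.2)).
Qed.

Lemma lie_bracket_euler_lift (V : vector_field N) x : smooth_field V ->
  lie_bracket euler (lift V) x = 0.
Proof.
move=> sV; have sVx := (smooth_fieldP hN V).1 sV x.2.
rewrite lie_bracketE; apply: (etrans (f_equal2 (fun a b => a - b)
  (dfield_lift hN (euler x) sVx)
  (dfield_scale hC (lift V x) (smooth_radius x) (smooth_dradius hN x)))).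
rewrite eulerE dpr_cvec (lin0 (dfield_linear sVx)) (dfield_dradius hN) dfun_radius.
by rewrite /lift dr_cvec scale0r scaler0 addr0 cvec0 subrr.
Qed.

Lemma J_euler x : J x (euler x) = cvec 0 (xi x.2).
Proof.
have r0 : rad x != 0 by rewrite gt_eqF // radius_gt0.
rewrite (cone_JE hacm) /cone_J_at eulerE dr_cvec dpr_cvec mulVf // scale1r.
rewrite (lin0 (phil x.2)) addr0 (_ : g x.2 (xi x.2) 0 = 0) ?mulr0 ?oppr0 //.
by rewrite gs (lin0 (gr x.2 _)).
Qed.

Lemma J_lift x (V : vector_field N) :
  J x (lift V x) = cvec (- (rad x * g x.2 (xi x.2) (V x.2))) (phi x.2 (V x.2)).
Proof.
by rewrite (cone_JE hacm) /cone_J_at /lift dr_cvec dpr_cvec mulr0 scale0r add0r.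
Qed.

(** As [J] maps the Euler field to the lift of [xi], the claim is that [d omega] vanishes when [xi]
    is inserted: the radial component is zero, the defect vanishes on [xi], and [i_xi dF = 0]. *)
Lemma kt_form_euler (X Y : vector_field C) : smooth_field X -> smooth_field Y ->
  kt_form gC J euler X Y = fun=> 0.
Proof.
move=> sX sY; apply/funext => x.
rewrite (kt_formE hH ((smooth_fieldP hC euler).1 smooth_euler x)
  ((smooth_fieldP hC X).1 sX x) ((smooth_fieldP hC Y).1 sY x)) /torsion_at J_euler.
have gX := global_value_J x sX; have gY := global_value_J x sY.
rewrite -(cvecK (J x (X x))) -(cvecK (J x (Y x))).
rewrite (dform_cone_form hST) (sasaki_defect_xi gX) (sasaki_defect_xi gY).
by rewrite (dform_fund_xi hST gX gY) mul0r !(mulr0, subr0, addr0).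
Qed.

(** [J] maps the lift of [xi] to [- r d/dr], whose [N]-component is zero. In [d omega] the term with
    [dF] and those pairing this zero component drop out, and the factors [r] and [- r] multiply. *)
Lemma kt_form_lift_xi (V W : vector_field N) x : smooth_field V -> smooth_field W ->
  kt_form gC J (lift xi) (lift V) (lift W) x =
  - (rad x * rad x) * app_bilin beta (app_endo phi V) (app_endo phi W) x.2.
Proof.
move=> sV sW.
have sl U : smooth_field U -> smooth_field_at x (lift U).
  by move=> sU; exact: (smooth_fieldP hC _).1 (smooth_field_lift sU) x.
rewrite (kt_formE hH (sl _ sxi) (sl _ sV) (sl _ sW)) /torsion_at !J_lift.
rewrite phixi xi1 mulr1 (dform_cone_form hST).
rewrite (lin0 (bilin_r sbeta x.2 (phi x.2 (V x.2)))).
rewrite (lin0 (bilin_r sbeta x.2 (phi x.2 (W x.2)))).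
rewrite (lin0 (dform_linear1 hN (smooth_fund_form hacm) x.2 _ _)).
rewrite !mulr0 subr0 !addr0.
by rewrite /app_bilin /app_endo mulrA mulrN.
Qed.

(* With E the Euler field, c (E, -, -) = 0 and E commutes with lifts, so
   dc (E, xi, V, W) is the derivative along E of c (xi, V, W), which is homogeneous
   of degree 2 in r: it is 2 c (xi, V, W). *)
Lemma SKT_sasaki : is_SKT gC J -> is_Sasaki g xi phi.
Proof.
move=> [_ H]; apply/sasakiP => q v w gv gw; rewrite -(sasaki_defect_phi gv gw).
(* The fields [X] and [Y] take the values [phi v] and [phi w] at [q], so that [c (xi, X, Y)] shows
   the defect on the second images under [phi]. The point [x] below is taken at radius 1. *)
have [X sX <-] := global_value_phi hST gv; have [Y sY <-] := global_value_phi hST gw.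
pose x : C := (exist _ (1 : R) (mem_set (ltr01 : @pos_reals R 1)), q).
have r0 : rad x * rad x != 0 by rewrite mulf_neq0 // gt_eqF // radius_gt0.
have [sE sxiC sV sW] := And4 smooth_euler (smooth_field_lift sxi)
  (smooth_field_lift sX) (smooth_field_lift sY).
pose b := app_bilin beta (app_endo phi X) (app_endo phi Y).
have sb : smooth_function_at x.2 b.
  by apply: (smooth_app_bilin hN sbeta); apply: (smooth_app_endo hN sphi);
    exact: (smooth_fieldP hN _).1.
have sA (U : vector_field C) : smooth_field U -> smooth_field_at x U.
  by move=> sU; exact: (smooth_fieldP hC U).1.
have K0 (U S : vector_field C) (V : vector_field N) : smooth_field V -> smooth_field U ->
    smooth_field S -> kt_form gC J (lie_bracket euler (lift V)) U S x = 0.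
  move=> sV' sU sS.
  rewrite (kt_formE hH (sA _ (smooth_bracket sE (smooth_field_lift sV'))) (sA _ sU) (sA _ sS)).
  by rewrite (lie_bracket_euler_lift x sV') (lin0 (torsion_at_linear1 hH x _ _)).
have K1 (U S : vector_field C) : smooth_field U -> smooth_field S ->
    kt_form gC J U euler S x = 0.
  move=> sU sS; rewrite (kt_formE hH (sA _ sU) (sA _ sE) (sA _ sS)).
  rewrite (torsion_at_swap12 hH) -(kt_formE hH (sA _ sE) (sA _ sU) (sA _ sS)).
  by rewrite (kt_form_euler sU sS) oppr0.
have [s1 s2 s3] := And3 (smooth_bracket sxiC sV) (smooth_bracket sxiC sW) (smooth_bracket sV sW).
have D3 := d3_lie_deriv (kt_form_euler sV sW) (kt_form_euler sxiC sW)
  (kt_form_euler sxiC sV) (K0 _ _ _ sxi sV sW) (K0 _ _ _ sX sxiC sW) (K0 _ _ _ sY sxiC sV)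
  (K1 _ _ s1 sW) (K1 _ _ s2 sV) (K1 _ _ s3 sxiC).
have := etrans (esym D3) (H euler (lift xi) (lift X) (lift Y) sE sxiC sV sW x).
have -> : kt_form gC J (lift xi) (lift X) (lift Y) =
    (fun z : C => - (rad z * rad z) * b z.2).
  by apply/funext => z; exact: kt_form_lift_xi.
rewrite lie_derivE.
have sr := smooth_radius x; have srr := smooth_function_mul sr sr.
have sn := smooth_function_opp srr; have sbb := smooth_function_base sb.
rewrite (dfun_mul hC (euler x) sn sbb) (dfun_opp (euler x) srr).
rewrite (dfun_mul hC (euler x) sr sr) dfun_radius (dfun_base (euler x) sb).
rewrite eulerE dr_cvec dpr_cvec (lin0 (dfun_linear sb)) mulr0 addr0 mulNr.
(* Along the Euler field [r] has derivative [r], and [b], pulled back from [N], has derivative zero;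
   the equation reads [- (r r + r r) b = 0] at [x]. *)
move=> /eqP; rewrite oppr_eq0 mulf_eq0 -mulr2n mulrn_eq0 (negPf r0) /= => /eqP.
exact.
Qed.

End STConeTorsion.


Theorem proposition3p4 (R : realType) (n : nat) (N : charted_space R n)
    (g : bilin_field N) (xi : vector_field N) (phi : endo_field N)
    (hST : is_ST g xi phi) :
  is_KT (cone_metric g) (cone_J g xi phi) /\
  (is_SKT (cone_metric g) (cone_J g xi phi) <-> is_Sasaki g xi phi).
Proof.
Proof.
split; first exact: hermitian_is_KT (cone_hermitian hST).
by split; [exact: SKT_sasaki|exact: sasaki_SKT].
Qed.
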